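(* Identify $\mathbb{R}^2\cong\mathbb{C}$ and let $B_1$ be the open unit disk. Let $a_1,\dots,a_N$ ($N\ge1$) be distinct points on $\partial B_1$ with multiplicities $d_1,\dots,d_N\in\mathbb{Z}\setminus\{0\}$ such that $\sum_{j=1}^Nd_j=2$, and let $b\in\partial B_1\setminus\{a_1,\dots,a_N\}$. Then every canonical harmonic map in $B_1$ with prescribed boundary vortices $\{(a_j,d_j)\}$ has the form $$m_*(z)=\pm\,\mathrm{i}\,b\prod_{j=1}^N\Big(\frac{z-a_j}{|z-a_j|}\,\frac{|b-a_j|}{b-a_j}\Big)^{d_j},\qquad z\in B_1.$$ Moreover, if $\Omega\subset\mathbb{R}^2$ is a bounded, simply connected $C^{1,1}$ domain for which there exists a $C^1$ conformal diffeomorphism $\Phi:\overline{B_1}\to\overline\Omega$ with inverse $\Psi$, then $$M_*(w)=m_*(\Psi(w))\,\frac{\Phi'(\Psi(w))}{|\Phi'(\Psi(w))|},\qquad w\in\Omega,$$ is a canonical harmonic map in $\Omega$ with prescribed boundary vortices $\{(\Phi(a_j),d_j)\}$ on $\partial\Omega$.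
   Context: Canonical harmonic map: let $\Omega\subset\mathbb{R}^2$ be a bounded, simply connected $C^{1,1}$ domain with outer unit normal $\nu$, tangent $\tau=\nu^\perp=(-\nu_2,\nu_1)$ and curvature $\varkappa$ of $\partial\Omega$ (so that $\int_{\partial\Omega}\varkappa\,d\mathcal{H}^1=2\pi$). Given $N\ge1$ distinct points $a_1,\dots,a_N\in\partial\Omega$ and $d_1,\dots,d_N\in\mathbb{Z}\setminus\{0\}$ with $\sum d_j=2$, let $\phi:\partial\Omega\to\mathbb{R}$ be a $BV$ function with $e^{\mathrm{i}\phi}\cdot\nu=0$ on $\partial\Omega\setminus\{a_1,\dots,a_N\}$ and $\partial_\tau\phi=\varkappa-\pi\sum_jd_j\delta_{a_j}$ (as measures on $\partial\Omega$). If $\phi_*$ is the harmonic extension of $\phi$ to $\Omega$, then $m_*=e^{\mathrm{i}\phi_*}$ is called a canonical harmonic map associated to $\{(a_j,d_j)\}$ (such $\phi$ is unique up to an additive constant in $\pi\mathbb{Z}$, so there are exactly two such maps $\pm e^{\mathrm{i}\phi_*}$). *)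

(* Defs.v *)
From Stdlib Require Import Reals ZArith.
From Coquelicot Require Import Coquelicot.
Open Scope R_scope.

Definition expi (t : R) : C := (cos t, sin t).

Definition dotC (u v : C) : R := fst u * fst v + snd u * snd v.

Fixpoint Cpown (w : C) (n : nat) : C :=
  match n with O => RtoC 1 | S k => Cmult w (Cpown w k) end.
Definition Cpowz (w : C) (k : Z) : C :=
  if (0 <=? k)%Z then Cpown w (Z.to_nat k) else Cpown (Cinv w) (Z.to_nat (- k)).

Fixpoint Cprod (n : nat) (f : nat -> C) : C :=
  match n with O => RtoC 1 | S k => Cmult (Cprod k f) (f k) end.
Fixpoint Rsumn (n : nat) (f : nat -> R) : R :=
  match n with O => 0 | S k => Rsumn k f + f k end.
Fixpoint Zsumn (n : nat) (f : nat -> Z) : Z :=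
  match n with O => 0%Z | S k => (Zsumn k f + f k)%Z end.

Definition unit_disk (z : C) : Prop := Cmod z < 1.
Definition closed_unit_disk (z : C) : Prop := Cmod z <= 1.

Definition open_set (U : C -> Prop) : Prop :=
  forall z, U z -> exists r, 0 < r /\ forall w, Cmod (Cminus w z) < r -> U w.

Definition bounded_set (U : C -> Prop) : Prop :=
  exists M, forall z, U z -> Cmod z <= M.

Definition connected_set (U : C -> Prop) : Prop :=
  forall A B : C -> Prop, open_set A -> open_set B ->
    (forall z, U z -> A z \/ B z) ->
    (exists z, U z /\ A z) -> (exists z, U z /\ B z) ->
    exists z, U z /\ A z /\ B z.

Definition closure_set (U : C -> Prop) (z : C) : Prop :=
  forall eps, 0 < eps -> exists w, U w /\ Cmod (Cminus w z) < eps.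

Definition boundary_set (U : C -> Prop) (z : C) : Prop :=
  closure_set U z /\ ~ U z.

Definition contC_within (D : C -> Prop) (f : C -> R) (z : C) : Prop :=
  forall eps, 0 < eps -> exists del, 0 < del /\
    forall w, D w -> Cmod (Cminus w z) < del -> Rabs (f w - f z) < eps.
Definition contCC_within (D : C -> Prop) (f : C -> C) (z : C) : Prop :=
  forall eps, 0 < eps -> exists del, 0 < del /\
    forall w, D w -> Cmod (Cminus w z) < del -> Cmod (Cminus (f w) (f z)) < eps.

Definition pdx (u : C -> R) (z : C) : R := Derive (fun t => u (t, snd z)) (fst z).
Definition pdy (u : C -> R) (z : C) : R := Derive (fun t => u (fst z, t)) (snd z).

Definition C1_on (U : C -> Prop) (u : C -> R) : Prop :=
  (forall z, U z -> ex_derive (fun t => u (t, snd z)) (fst z)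
                 /\ ex_derive (fun t => u (fst z, t)) (snd z)) /\
  (forall z, U z -> contC_within (fun _ => True) u z
                 /\ contC_within (fun _ => True) (pdx u) z
                 /\ contC_within (fun _ => True) (pdy u) z).

Definition harmonic_on (U : C -> Prop) (u : C -> R) : Prop :=
  C1_on U u /\ C1_on U (pdx u) /\ C1_on U (pdy u) /\
  forall z, U z -> pdx (pdx u) z + pdy (pdy u) z = 0.

(* gamma : R -> C is an L-periodic, arc-length (|gamma'| = 1), injective on
   [0,L) parametrisation of the boundary of Omega, with Lipschitz tangent
   dgamma = gamma' (i.e. the boundary is a C^{1,1} Jordan curve), oriented
   counterclockwise: Omega lies on the left, i.e. the outer unit normal is
   nu = -i gamma' and the tangent is tau = nu^perp = (-nu_2, nu_1) = gamma'. *)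
Definition arc_param (Om : C -> Prop) (L : R) (gamma dgamma : R -> C) : Prop :=
  0 < L /\
  (forall s, gamma (s + L) = gamma s) /\
  (forall s t, 0 <= s < L -> 0 <= t < L -> gamma s = gamma t -> s = t) /\
  (forall s, is_derive (fun t => fst (gamma t)) s (fst (dgamma s)) /\
             is_derive (fun t => snd (gamma t)) s (snd (dgamma s))) /\
  (forall s, Cmod (dgamma s) = 1) /\
  (exists K, forall s t, Cmod (Cminus (dgamma s) (dgamma t)) <= K * Rabs (s - t)) /\
  (forall z, boundary_set Om z <-> exists s, gamma s = z) /\
  (forall s, exists e, 0 < e /\ forall t, 0 < t < e ->
       Om (Cplus (gamma s) (Cmult (RtoC t) (Cmult Ci (dgamma s))))).

Definition outer_normal (dgamma : R -> C) (s : R) : C :=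
  (snd (dgamma s), - fst (dgamma s)).

(* bounded, simply connected C^{1,1} domain: a bounded connected open set
   whose boundary is a C^{1,1} Jordan curve (simple connectivity follows). *)
Definition C11_domain (Om : C -> Prop) : Prop :=
  open_set Om /\ bounded_set Om /\ connected_set Om /\
  exists L gamma dgamma, arc_param Om L gamma dgamma.

Definition bounded_variation (f : R -> R) (L : R) : Prop :=
  exists M, forall (n : nat) (t : nat -> R),
    0 <= t O -> t n <= L -> (forall i, (i < n)%nat -> t i <= t (S i)) ->
    Rsumn n (fun i => Rabs (f (t (S i)) - f (t i))) <= M.

Definition smooth_periodic (f : R -> R) (L : R) : Prop :=
  (forall s, f (s + L) = f s) /\ (forall (n : nat) s, ex_derive_n f n s).

(* m is a canonical harmonic map in Om associated to {(a_j, d_j)}_{j<N}.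
   - theta is a continuous lift of the tangent angle (gamma' = e^{i theta});
     the curvature measure kappa dH^1 is d theta (kappa = d theta / ds);
   - phi is BV on the boundary (the representative continuous away from the
     vortices), e^{i phi}.nu = 0 off the vortices, and
     d_tau phi = kappa - pi sum_j d_j delta_{a_j} in the sense of
     distributions: for every smooth test function psi on the boundary
       -int phi psi' ds = int psi d(theta) - pi sum_j d_j psi(a_j),
     where int psi d(theta) = psi(gamma 0)(theta L - theta 0) - int theta psi';
   - phis is the harmonic extension of phi: bounded harmonic in Om attaining
     the boundary values phi at every non-vortex boundary point;
   - m = e^{i phis} in Om. *)
Definition canonical_harmonic (Om : C -> Prop) (N : nat) (a : nat -> C)
    (d : nat -> Z) (m : C -> C) : Prop :=
  exists (L : R) (gamma dgamma : R -> C) (theta : R -> R) (phi phis : C -> R),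
    arc_param Om L gamma dgamma /\
    (forall j, (j < N)%nat -> exists s, gamma s = a j) /\
    (forall s, continuity_pt theta s /\ dgamma s = expi (theta s)) /\
    bounded_variation (fun s => phi (gamma s)) L /\
    (forall s, (forall j, (j < N)%nat -> gamma s <> a j) ->
        continuity_pt (fun t => phi (gamma t)) s) /\
    (forall s, (forall j, (j < N)%nat -> gamma s <> a j) ->
        dotC (expi (phi (gamma s))) (outer_normal dgamma s) = 0) /\
    (forall psi : C -> R, smooth_periodic (fun s => psi (gamma s)) L ->
        RInt (fun s => phi (gamma s) * Derive (fun t => psi (gamma t)) s) 0 L
        = RInt (fun s => theta s * Derive (fun t => psi (gamma t)) s) 0 L
          - (theta L - theta 0) * psi (gamma 0)
          + PI * Rsumn N (fun j => IZR (d j) * psi (a j))) /\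
    harmonic_on Om phis /\
    (exists M, forall z, Om z -> Rabs (phis z) <= M) /\
    (forall s, (forall j, (j < N)%nat -> gamma s <> a j) ->
        forall eps, 0 < eps -> exists del, 0 < del /\
          forall x, Om x -> Cmod (Cminus x (gamma s)) < del ->
            Rabs (phis x - phi (gamma s)) < eps) /\
    (forall z, Om z -> m z = expi (phis z)).

Definition disk_map (N : nat) (a : nat -> C) (d : nat -> Z) (b z : C) : C :=
  Cmult (Cmult Ci b)
    (Cprod N (fun j =>
       Cpowz (Cmult (Cdiv (Cminus z (a j)) (RtoC (Cmod (Cminus z (a j)))))
                    (Cdiv (RtoC (Cmod (Cminus b (a j)))) (Cminus b (a j))))
             (d j))).

(* Main.v *)
(* On the unit circle the argument of 1 - z / a_j is half the polar angle plus a
   constant, with a jump of - PI at a_j. Hence H = sum_j d_j arg (1 - z / a_j) is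
   a bounded harmonic function on the disk whose boundary values have the
   prescribed tangential derivative because sum_j d_j = 2. The boundary phase of a
   canonical map differs from H by a locally constant function; the measure
   equation forbids jumps, and the maximum principle, with logarithmic barriers at
   the vortices, gives phi_* = H + c in the disk. The value of c modulo PI is read
   off at b.

   On Omega the phase is (H + c + arg Phi') o Psi. It is the imaginary part of a
   holomorphic function, as Cauchy's integral formula makes Phi' smooth. On the
   boundary Psi o gamma = e^(i sigma) with sigma increasing by 2 PI over a period
   and gamma' = i e^(i sigma) Phi' / |Phi'|, so that the conditions on the circle
   carry over to the boundary of Omega. *)

Require Import Defs.
From Stdlib Require Import Reals ZArith.
From Coquelicot Require Import Coquelicot.
From Stdlib Require Import Lra Lia Psatz Classical ClassicalEpsilon FunctionalExtensionality.
Open Scope R_scope.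

(* Rtopology also has an [open_set], for subsets of the line. *)
Import Defs.

(** * Complex differentiability within a set *)

(** The hypotheses give the complex derivative of [Phi] only in the open disk, while the boundary
    conditions need it on the circle. Hence derivatives are taken within a set, which may be the
    open disk, the closed disk, the closure of [Om] or the real axis, and a mean value inequality
    along chords carries the derivative to the circle. The vortex arguments have a single branch,
    because [RtoC 1 - z * Cconj (a j)] stays in the right half plane. [dPhi] has no such half plane,
    so its argument must be built. That [Psi] sends the boundary of [Om] to the circle has to be
    proved. One direction is local and uses rays, the other is topological; the orientation of
    [gamma] enters through the side on which [Om] lies. The circle is the case where [Phi] is the
    identity, so an arbitrary arc length parametrisation of it is covered by the same lemmas.
    Uniqueness is used only in the disk: the transfer to [Om] takes from the given map its phase and
    the tangency of that phase on the circle, and checks the definition directly. *)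

Lemma C_eq (z w : C) : fst z = fst w -> snd z = snd w -> z = w.
Proof. destruct z, w; simpl; congruence. Qed.

Lemma Cmod_fst (z : C) : Rabs (fst z) <= Cmod z.
Proof. eapply Rle_trans; [apply Rmax_l | apply Rmax_Cmod]. Qed.

Lemma Cmod_snd (z : C) : Rabs (snd z) <= Cmod z.
Proof. eapply Rle_trans; [apply Rmax_r | apply Rmax_Cmod]. Qed.

Lemma Cmod_le_parts (z : C) : Cmod z <= Rabs (fst z) + Rabs (snd z).
Proof.
  unfold Cmod.
  assert (0 <= Rabs (fst z)) by apply Rabs_pos.
  assert (0 <= Rabs (snd z)) by apply Rabs_pos.
  rewrite <- (sqrt_Rsqr (Rabs (fst z) + Rabs (snd z))) by lra.
  apply sqrt_le_1_alt. unfold Rsqr.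
  rewrite <- (pow2_abs (fst z)), <- (pow2_abs (snd z)). nra.
Qed.

Lemma Cmod_sqr (z : C) : Cmod z * Cmod z = fst z * fst z + snd z * snd z.
Proof.
  unfold Cmod. rewrite sqrt_sqrt; [ring|].
  generalize (pow2_ge_0 (fst z)), (pow2_ge_0 (snd z)); lra.
Qed.

Lemma Cmod_sub_sym (z w : C) : Cmod (z - w)%C = Cmod (w - z)%C.
Proof. rewrite <- Cmod_opp. f_equal. ring. Qed.

Lemma Cmod_sub_triangle (x y z : C) : Cmod (x - z)%C <= Cmod (x - y)%C + Cmod (y - z)%C.
Proof. replace (x - z)%C with ((x - y) + (y - z))%C by ring. apply Cmod_triangle. Qed.

Lemma Cmod_sub_lower (x y : C) : Cmod x - Cmod y <= Cmod (x - y)%C.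
Proof.
  assert (H := Cmod_triangle (x - y)%C y).
  replace (x - y + y)%C with x in H by ring. lra.
Qed.

Lemma Cmod_pos_sub (z w : C) : z <> w -> 0 < Cmod (z - w)%C.
Proof.
  intros H. apply Cmod_gt_0. intros E. apply H.
  replace z with ((z - w) + w)%C by ring. rewrite E. ring.
Qed.

Lemma Cmod_diag (z : C) : Cmod (z - z)%C = 0.
Proof. replace (z - z)%C with (RtoC 0) by ring. apply Cmod_0. Qed.

Definition near (D : C -> Prop) (z : C) (P : C -> Prop) : Prop :=
  exists d, 0 < d /\ forall w, D w -> Cmod (w - z)%C < d -> P w.

Lemma near_imp D z (P Q : C -> Prop) :
  (forall w, D w -> P w -> Q w) -> near D z P -> near D z Q.
Proof. intros H [d [Hd K]]. exists d; split; auto. Qed.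

Lemma near_and D z (P Q R : C -> Prop) :
  (forall w, D w -> P w -> Q w -> R w) -> near D z P -> near D z Q -> near D z R.
Proof.
  intros H [d1 [H1 K1]] [d2 [H2 K2]]. exists (Rmin d1 d2).
  split; [now apply Rmin_pos|]. intros w Dw Hw.
  apply H; auto; [apply K1|apply K2]; auto;
    (eapply Rlt_le_trans; [apply Hw|]); [apply Rmin_l|apply Rmin_r].
Qed.

Notation ccont := contCC_within.

Lemma ccont_mono (D D' : C -> Prop) f z :
  (forall w, D w -> D' w) -> ccont D' f z -> ccont D f z.
Proof. intros H Hf e He. destruct (Hf e He) as [d [Hd K]]. exists d; split; auto. Qed.

Lemma ccont_ext (D : C -> Prop) f g z :
  (forall w, D w -> f w = g w) -> f z = g z -> ccont D f z -> ccont D g z.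
Proof.
  intros H Hz Hf e He. refine (near_imp _ _ _ _ _ (Hf e He)).
  intros w Dw. now rewrite <- H, <- Hz.
Qed.

Lemma ccont_const D c z : ccont D (fun _ => c) z.
Proof. intros e He. exists 1; split; [lra|]. intros. now rewrite Cmod_diag. Qed.

Lemma ccont_id D z : ccont D (fun w => w) z.
Proof. intros e He. exists e; split; auto. Qed.

Lemma ccont_plus D f g z : ccont D f z -> ccont D g z -> ccont D (fun w => f w + g w)%C z.
Proof.
  intros Hf Hg e He. assert (He2 : 0 < e / 2) by lra.
  refine (near_and _ _ _ _ _ _ (Hf _ He2) (Hg _ He2)). intros w _ K1 K2.
  replace (f w + g w - (f z + g z))%C with ((f w - f z) + (g w - g z))%C by ring.
  eapply Rle_lt_trans; [apply Cmod_triangle|]. lra.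
Qed.

Lemma ccont_mult D f g z : ccont D f z -> ccont D g z -> ccont D (fun w => f w * g w)%C z.
Proof.
  intros Hf Hg e He.
  assert (P1 := Cmod_ge_0 (f z)). assert (P2 := Cmod_ge_0 (g z)).
  (* Both increments are below [q <= 1], so their product is also below [q], and the three terms of
     the expansion sum to at most [q * M]. *)
  set (M := 1 + Cmod (f z) + Cmod (g z)). assert (HM : 1 <= M) by (unfold M; lra).
  set (q := Rmin 1 (e / (2 * M))).
  assert (Pq : 0 < q) by (apply Rmin_pos; [lra|]; apply Rdiv_lt_0_compat; lra).
  assert (Q1 : q <= 1) by apply Rmin_l.
  assert (Q2 : q * M <= e / 2).
  { replace (e / 2) with (e / (2 * M) * M) by (field; lra).
    apply Rmult_le_compat_r; [lra|apply Rmin_r]. }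
  refine (near_and _ _ _ _ _ _ (Hf q Pq) (Hg q Pq)). intros w _ K1 K2.
  replace (f w * g w - f z * g z)%C
    with ((f w - f z) * (g w - g z) + ((f w - f z) * g z + f z * (g w - g z)))%C by ring.
  eapply Rle_lt_trans; [apply Cmod_triangle|].
  eapply Rle_lt_trans; [apply Rplus_le_compat_l, Cmod_triangle|].
  rewrite !Cmod_mult.
  assert (Pa := Cmod_ge_0 (f w - f z)%C). assert (Pb := Cmod_ge_0 (g w - g z)%C).
  unfold M in Q2. nra.
Qed.

Lemma ccont_opp D f z : ccont D f z -> ccont D (fun w => - f w)%C z.
Proof.
  intros H. apply ccont_ext with (f := fun w => (- RtoC 1 * f w)%C).
  - intros. ring.
  - ring.
  - apply ccont_mult; [apply ccont_const | exact H].
Qed.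

Lemma ccont_minus D f g z : ccont D f z -> ccont D g z -> ccont D (fun w => f w - g w)%C z.
Proof. intros Hf Hg. apply ccont_plus; [exact Hf | now apply ccont_opp]. Qed.

Lemma ccont_inv D f z : f z <> RtoC 0 -> ccont D f z -> ccont D (fun w => / f w)%C z.
Proof.
  intros Hz Hf e He.
  assert (P : 0 < Cmod (f z)) by now apply Cmod_gt_0.
  set (m := Cmod (f z)) in *.
  assert (He' : 0 < Rmin (m / 2) (e * (m * m / 2))).
  { apply Rmin_pos; [lra|]. apply Rmult_lt_0_compat; [lra|]. nra. }
  refine (near_imp _ _ _ _ _ (Hf _ He')). intros w Dw K.
  assert (K1 := Rlt_le_trans _ _ _ K (Rmin_l _ _)).
  assert (K2 := Rlt_le_trans _ _ _ K (Rmin_r _ _)).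
  assert (Q : m / 2 < Cmod (f w)).
  { assert (H := Cmod_sub_lower (f z) (f w)). rewrite Cmod_sub_sym in H. fold m in H. lra. }
  assert (Hw0 : f w <> RtoC 0) by (apply Cmod_gt_0; lra).
  replace (/ f w - / f z)%C with ((f z - f w) * / (f w * f z))%C by (field; auto).
  rewrite Cmod_mult, Cmod_inv, Cmod_mult, Cmod_sub_sym by now apply Cmult_neq_0.
  fold m. apply Rmult_lt_reg_r with (Cmod (f w) * m); [nra|].
  rewrite Rmult_assoc, Rinv_l, Rmult_1_r by nra.
  eapply Rlt_le_trans; [exact K2|]. apply Rmult_le_compat_l; nra.
Qed.

Lemma ccont_comp (D D' : C -> Prop) f g z :
  (forall w, D w -> D' (g w)) -> ccont D' f (g z) -> ccont D g z ->
  ccont D (fun w => f (g w)) z.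
Proof.
  intros H Hf Hg e He. destruct (Hf e He) as [d1 [Hd1 K1]].
  destruct (Hg d1 Hd1) as [d2 [Hd2 K2]]. exists d2; split; auto.
Qed.

Lemma ccont_pair D (f g : C -> R) z :
  contC_within D f z -> contC_within D g z -> ccont D (fun w => (f w, g w)) z.
Proof.
  intros Hf Hg e He. assert (He2 : 0 < e / 2) by lra.
  refine (near_and _ _ _ _ _ _ (Hf _ He2) (Hg _ He2)). intros w _ K1 K2.
  eapply Rle_lt_trans; [apply Cmod_le_parts|].
  simpl. unfold Rminus in *. lra.
Qed.

Lemma ccont_fst D f z : ccont D f z -> contC_within D (fun w => fst (f w)) z.
Proof.
  intros H e He. refine (near_imp _ _ _ _ _ (H e He)). intros w _ K.
  eapply Rle_lt_trans; [apply (Cmod_fst (f w - f z)%C)|exact K].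
Qed.

Lemma ccont_snd D f z : ccont D f z -> contC_within D (fun w => snd (f w)) z.
Proof.
  intros H e He. refine (near_imp _ _ _ _ _ (H e He)). intros w _ K.
  eapply Rle_lt_trans; [apply (Cmod_snd (f w - f z)%C)|exact K].
Qed.

Lemma continuity_pt_eps (f : R -> R) x :
  continuity_pt f x <-> (forall eps, 0 < eps -> exists del, 0 < del /\
    forall y, Rabs (y - x) < del -> Rabs (f y - f x) < eps).
Proof.
  rewrite continuity_pt_locally. split.
  - intros H e He. destruct (H (mkposreal e He)) as [d Hd].
    exists d; split; [apply cond_pos|]. intros y Hy. apply Hd. exact Hy.
  - intros H e. destruct (H e (cond_pos e)) as [d [Hd K]].
    exists (mkposreal d Hd). intros y Hy. apply K. exact Hy.
Qed.

Lemma contC_comp D (f : R -> R) (u : C -> R) z :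
  continuity_pt f (u z) -> contC_within D u z -> contC_within D (fun w => f (u w)) z.
Proof.
  rewrite continuity_pt_eps. intros Hf Hu e He.
  destruct (Hf e He) as [d1 [Hd1 K1]].
  destruct (Hu d1 Hd1) as [d2 [Hd2 K2]]. exists d2; split; auto.
Qed.

Lemma ccont_RtoC D (u : C -> R) z :
  contC_within D u z -> ccont D (fun w => RtoC (u w)) z.
Proof.
  intros H. apply ccont_pair; [exact H|].
  intros e He. exists 1; split; [lra|]. intros. now rewrite Rminus_diag, Rabs_R0.
Qed.

Lemma contC_RtoC D (u : C -> R) z :
  ccont D (fun w => RtoC (u w)) z -> contC_within D u z.
Proof. intros H. apply (ccont_fst _ _ _ H). Qed.

Lemma contC_plus D (u v : C -> R) z :
  contC_within D u z -> contC_within D v z -> contC_within D (fun w => u w + v w) z.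
Proof.
  intros Hu Hv. apply contC_RtoC.
  apply ccont_ext with (f := fun w => (RtoC (u w) + RtoC (v w))%C).
  - intros; now rewrite RtoC_plus.
  - now rewrite RtoC_plus.
  - apply ccont_plus; now apply ccont_RtoC.
Qed.

Lemma contC_mult D (u v : C -> R) z :
  contC_within D u z -> contC_within D v z -> contC_within D (fun w => u w * v w) z.
Proof.
  intros Hu Hv. apply contC_RtoC.
  apply ccont_ext with (f := fun w => (RtoC (u w) * RtoC (v w))%C).
  - intros; now rewrite RtoC_mult.
  - now rewrite RtoC_mult.
  - apply ccont_mult; now apply ccont_RtoC.
Qed.

Lemma contC_const D (c : R) z : contC_within D (fun _ => c) z.
Proof. intros e He. exists 1; split; [lra|]. intros. now rewrite Rminus_diag, Rabs_R0. Qed.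

Lemma contC_inv D (u : C -> R) z :
  u z <> 0 -> contC_within D u z -> contC_within D (fun w => / u w) z.
Proof.
  intros Hz Hu. apply (contC_comp D Rinv u z); [|exact Hu].
  apply continuity_pt_inv; [|exact Hz]. apply derivable_continuous_pt, derivable_pt_id.
Qed.

Lemma contC_Cmod D f z : ccont D f z -> contC_within D (fun w => Cmod (f w)) z.
Proof.
  intros H e He. refine (near_imp _ _ _ _ _ (H e He)). intros w _ K.
  eapply Rle_lt_trans; [|exact K]. apply Rabs_le. split.
  - rewrite Cmod_sub_sym. generalize (Cmod_sub_lower (f z) (f w)); lra.
  - apply Cmod_sub_lower.
Qed.

(** Carathéodory's form of the derivative makes the product, chain and inverse
    rules statements about continuity. *)
Definition cder (D : C -> Prop) (f : C -> C) (z l : C) : Prop :=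
  exists q : C -> C, (forall w, D w -> (f w - f z = q w * (w - z))%C)
    /\ q z = l /\ ccont D q z.

Lemma cder_eps D f z l :
  cder D f z l <-> (forall eps, 0 < eps -> exists del, 0 < del /\
    forall w, D w -> Cmod (w - z)%C < del ->
      Cmod (f w - f z - l * (w - z))%C <= eps * Cmod (w - z)%C).
Proof.
  split.
  - intros [q [Hq [Hz Hc]]] e He. destruct (Hc e He) as [d [Hd K]].
    exists d; split; auto. intros w Dw Hw.
    rewrite (Hq w Dw), <- Hz.
    replace (q w * (w - z) - q z * (w - z))%C with ((q w - q z) * (w - z))%C by ring.
    rewrite Cmod_mult. apply Rmult_le_compat_r; [apply Cmod_ge_0|].
    left. now apply K.
  - intros H.
    exists (fun w => if excluded_middle_informative (w = z) then l
                     else ((f w - f z) / (w - z))%C).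
    split; [|split].
    + intros w Dw. destruct excluded_middle_informative as [->|n].
      * ring.
      * field. intros E. apply n. replace w with ((w - z) + z)%C by ring. rewrite E. ring.
    + now destruct excluded_middle_informative.
    + intros e He. destruct (H (e/2)) as [d [Hd K]]; [lra|].
      exists d; split; auto. intros w Dw Hw.
      destruct (excluded_middle_informative (z = z)) as [_|n]; [|now elim n].
      destruct excluded_middle_informative as [E|n].
      * now rewrite Cmod_diag.
      * specialize (K w Dw Hw). assert (P := Cmod_pos_sub _ _ n).
        assert (N : (w - z)%C <> RtoC 0) by now apply Cmod_gt_0.
        replace ((f w - f z) / (w - z) - l)%C
          with ((f w - f z - l * (w - z)) / (w - z))%C by (field; exact N).
        rewrite Cmod_div by exact N.
        apply Rle_lt_trans with (e/2); [|lra].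
        apply Rmult_le_reg_r with (Cmod (w - z)); [exact P|].
        replace (Cmod (f w - f z - l * (w - z)) / Cmod (w - z) * Cmod (w - z))
          with (Cmod (f w - f z - l * (w - z))) by (field; lra). exact K.
Qed.

Lemma cder_mono (D D' : C -> Prop) f z l :
  (forall w, D w -> D' w) -> cder D' f z l -> cder D f z l.
Proof.
  intros H [q [Hq [Hz Hc]]]. exists q; repeat split; auto.
  now apply ccont_mono with D'.
Qed.

Lemma cder_ext (D : C -> Prop) f g z l :
  (forall w, D w -> f w = g w) -> f z = g z -> cder D f z l -> cder D g z l.
Proof.
  intros H Hz [q [Hq [Hz' Hc]]]. exists q; repeat split; auto.
  intros w Dw. rewrite <- H, <- Hz by auto. auto.
Qed.

Lemma cder_ccont D f z l : cder D f z l -> ccont D f z.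
Proof.
  intros [q [Hq [Hz Hc]]].
  apply ccont_ext with (f := fun w => (f z + q w * (w - z))%C).
  - intros w Dw. rewrite <- Hq by exact Dw. ring.
  - ring.
  - apply ccont_plus; [apply ccont_const|]. apply ccont_mult; [exact Hc|].
    apply ccont_minus; [apply ccont_id|apply ccont_const].
Qed.

Lemma cder_const D c z : cder D (fun _ => c) z (RtoC 0).
Proof.
  exists (fun _ => RtoC 0); repeat split; [intros; ring|apply ccont_const].
Qed.

Lemma cder_id D z : cder D (fun w => w) z (RtoC 1).
Proof.
  exists (fun _ => RtoC 1); repeat split; [intros; ring|apply ccont_const].
Qed.

Lemma cder_plus D f g z l k :
  cder D f z l -> cder D g z k -> cder D (fun w => f w + g w)%C z (l + k)%C.
Proof.
  intros [p [Hp [<- Cp]]] [q [Hq [<- Cq]]].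
  exists (fun w => p w + q w)%C; repeat split; [|now apply ccont_plus].
  intros w Dw. replace (f w + g w - (f z + g z))%C with ((f w - f z) + (g w - g z))%C by ring.
  rewrite Hp, Hq by exact Dw. ring.
Qed.

Lemma cder_mult D f g z l k :
  cder D f z l -> cder D g z k ->
  cder D (fun w => f w * g w)%C z (l * g z + f z * k)%C.
Proof.
  intros Hf Hg. assert (Cg := cder_ccont _ _ _ _ Hg).
  destruct Hf as [p [Hp [<- Cp]]]. destruct Hg as [q [Hq [<- Cq]]].
  exists (fun w => p w * g w + f z * q w)%C; repeat split.
  - intros w Dw.
    replace (f w * g w - f z * g z)%C with ((f w - f z) * g w + f z * (g w - g z))%C by ring.
    rewrite Hp, Hq by exact Dw. ring.
  - apply ccont_plus; apply ccont_mult; auto. apply ccont_const.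
Qed.

Lemma cder_scal D c f z l : cder D f z l -> cder D (fun w => c * f w)%C z (c * l)%C.
Proof.
  intros H. replace (c * l)%C with (RtoC 0 * f z + c * l)%C by ring.
  apply (cder_mult D (fun _ => c) f); [apply cder_const|exact H].
Qed.

Lemma cder_inv D f z l :
  f z <> RtoC 0 -> (forall w, D w -> f w <> RtoC 0) -> cder D f z l ->
  cder D (fun w => / f w)%C z (- l * (/ f z * / f z))%C.
Proof.
  intros Nz N Hf. assert (Cf := cder_ccont _ _ _ _ Hf).
  destruct Hf as [p [Hp [<- Cp]]].
  exists (fun w => - p w * (/ f w * / f z))%C; repeat split.
  - intros w Dw.
    replace (/ f w - / f z)%C with (- (f w - f z) * (/ f w * / f z))%C by (field; auto).
    rewrite Hp by exact Dw. ring.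
  - apply ccont_mult; [now apply ccont_opp|].
    apply ccont_mult; [now apply ccont_inv|apply ccont_const].
Qed.

Lemma cder_comp (D D' : C -> Prop) f g z l k :
  (forall w, D w -> D' (g w)) -> cder D' f (g z) l -> cder D g z k ->
  cder D (fun w => f (g w)) z (l * k)%C.
Proof.
  intros HD Hf Hg. assert (Cg := cder_ccont _ _ _ _ Hg).
  destruct Hf as [p [Hp [<- Cp]]]. destruct Hg as [q [Hq [<- Cq]]].
  exists (fun w => p (g w) * q w)%C; repeat split.
  - intros w Dw. rewrite Hp, Hq by auto. ring.
  - apply ccont_mult; [|exact Cq]. now apply ccont_comp with D'.
Qed.

(** The Carathéodory factor of [f], read along [g], never vanishes: at [z] it is [l], elsewhere its
    product with [g w - g z] is [w - z]. Its reciprocal is the factor of [g]. Continuity of [g] is a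
    premise, supplied later by compactness. *)
Lemma cder_inverse (D D' : C -> Prop) f g z l :
  (forall w, D w -> D' (g w)) -> (forall w, D w -> f (g w) = w) -> f (g z) = z ->
  l <> RtoC 0 -> ccont D g z -> cder D' f (g z) l -> cder D g z (/ l)%C.
Proof.
  intros HD Hfg Hz Nl Cg [p [Hp [El Cp]]].
  assert (Np : forall w, D w -> p (g w) <> RtoC 0).
  { intros w Dw E. destruct (classic (w = z)) as [->|n]; [congruence|].
    apply n. specialize (Hp (g w) (HD w Dw)). rewrite Hfg, Hz, E in Hp by exact Dw.
    replace w with ((w - z) + z)%C by ring. rewrite Hp. ring. }
  exists (fun w => / p (g w))%C; repeat split.
  - intros w Dw. specialize (Hp (g w) (HD w Dw)). rewrite Hfg, Hz in Hp by exact Dw.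
    rewrite Hp. field. now apply Np.
  - now rewrite El.
  - apply ccont_inv; [congruence|]. now apply ccont_comp with D'.
Qed.

(** * Curves in the plane *)

Definition Rline (z : C) : Prop := snd z = 0.

(** A curve is treated as a function on the real axis of the plane, so that the rules for [cder]
    apply to it; [rder_parts] leads back to real derivatives. *)
Definition rder (c : R -> C) (s : R) (v : C) : Prop :=
  cder Rline (fun z => c (fst z)) (RtoC s) v.

Definition rcont (c : R -> C) (s : R) : Prop :=
  ccont Rline (fun z => c (fst z)) (RtoC s).

Lemma Cmod_Rline (z : C) s : Rline z -> Cmod (z - RtoC s)%C = Rabs (fst z - s).
Proof.
  intros H. destruct z as [x y]. unfold Rline in H; simpl in H; subst y.
  replace ((x, 0) - RtoC s)%C with (RtoC (x - s)).
  - apply Cmod_R.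
  - unfold RtoC, Cminus, Cplus, Copp; simpl. f_equal; ring.
Qed.

Lemma is_derive_eps (f : R -> R) x l :
  is_derive f x l <-> (forall eps, 0 < eps -> exists del, 0 < del /\
    forall y, Rabs (y - x) < del -> Rabs (f y - f x - l * (y - x)) <= eps * Rabs (y - x)).
Proof.
  split.
  - intros [_ H] e He.
    destruct (H x (fun P HP => HP) (mkposreal e He)) as [d Hd].
    exists d; split; [apply cond_pos|]. intros y Hy. specialize (Hd y Hy).
    unfold norm, minus, plus, opp, scal in Hd; simpl in Hd.
    unfold mult, abs in Hd; simpl in Hd.
    replace (f y - f x - l * (y - x)) with (f y + - f x + - ((y + - x) * l)) by ring.
    exact Hd.
  - intros H. split; [apply is_linear_scal_l|].
    intros x' Hx'. assert (E := is_filter_lim_locally_unique _ _ Hx'). subst x'.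
    intros e. destruct (H e (cond_pos e)) as [d [Hd K]].
    exists (mkposreal d Hd). intros y Hy. specialize (K y Hy).
    unfold norm, minus, plus, opp, scal; simpl. unfold mult, abs; simpl.
    replace (f y + - f x + - ((y + - x) * l)) with (f y - f x - l * (y - x)) by ring.
    exact K.
Qed.

Lemma rder_eps c s v : rder c s v <-> (forall eps, 0 < eps -> exists del, 0 < del /\
    forall t, Rabs (t - s) < del ->
      Cmod (c t - c s - v * RtoC (t - s))%C <= eps * Rabs (t - s)).
Proof.
  unfold rder. rewrite cder_eps. split.
  - intros H e He. destruct (H e He) as [d [Hd K]]. exists d; split; auto.
    intros t Ht. specialize (K (RtoC t) eq_refl).
    rewrite (Cmod_Rline (RtoC t) s eq_refl) in K. simpl in K.
    rewrite RtoC_minus. now apply K.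
  - intros H e He. destruct (H e He) as [d [Hd K]]. exists d; split; auto.
    intros w Dw. rewrite (Cmod_Rline w s Dw). intros Hw. specialize (K (fst w) Hw).
    replace (w - RtoC s)%C with (RtoC (fst w - s)); [exact K|].
    apply C_eq; simpl; [ring|]. unfold Rline in Dw. rewrite Dw. ring.
Qed.

Lemma rcont_eps c s : rcont c s <-> (forall eps, 0 < eps -> exists del, 0 < del /\
    forall t, Rabs (t - s) < del -> Cmod (c t - c s)%C < eps).
Proof.
  unfold rcont, ccont. split.
  - intros H e He. destruct (H e He) as [d [Hd K]]. exists d; split; auto.
    intros t Ht. specialize (K (RtoC t) eq_refl).
    rewrite (Cmod_Rline (RtoC t) s eq_refl) in K. now apply K.
  - intros H e He. destruct (H e He) as [d [Hd K]]. exists d; split; auto.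
    intros w Dw. rewrite (Cmod_Rline w s Dw). intros Hw. apply (K (fst w) Hw).
Qed.

Lemma rder_parts c s v :
  rder c s v <-> is_derive (fun t => fst (c t)) s (fst v)
                 /\ is_derive (fun t => snd (c t)) s (snd v).
Proof.
  rewrite rder_eps, !is_derive_eps.
  assert (E1 : forall t, fst (c t - c s - v * RtoC (t - s))%C
     = fst (c t) - fst (c s) - fst v * (t - s)) by (intros; simpl; ring).
  assert (E2 : forall t, snd (c t - c s - v * RtoC (t - s))%C
     = snd (c t) - snd (c s) - snd v * (t - s)) by (intros; simpl; ring).
  split.
  - intros H; split; intros e He; destruct (H e He) as [d [Hd K]];
      exists d; split; auto; intros t Ht; (eapply Rle_trans; [|apply (K t Ht)]).
    + rewrite <- E1. apply Cmod_fst.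
    + rewrite <- E2. apply Cmod_snd.
  - intros [H1 H2] e He.
    destruct (H1 (e/2)) as [d1 [Hd1 K1]]; [lra|].
    destruct (H2 (e/2)) as [d2 [Hd2 K2]]; [lra|].
    exists (Rmin d1 d2). split; [now apply Rmin_pos|]. intros t Ht.
    specialize (K1 t (Rlt_le_trans _ _ _ Ht (Rmin_l _ _))).
    specialize (K2 t (Rlt_le_trans _ _ _ Ht (Rmin_r _ _))).
    eapply Rle_trans; [apply Cmod_le_parts|]. rewrite E1, E2. lra.
Qed.

Lemma rcont_parts c s :
  rcont c s <-> continuity_pt (fun t => fst (c t)) s /\ continuity_pt (fun t => snd (c t)) s.
Proof.
  assert (R : forall u : R -> R, continuity_pt u s <-> contC_within Rline (fun z => u (fst z)) (RtoC s)).
  { intros u. rewrite continuity_pt_eps. split; intros H e He; destruct (H e He) as [d [Hd K]];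
      exists d; split; auto.
    - intros w Dw. rewrite (Cmod_Rline w s Dw). apply K.
    - intros t Ht. apply (K (RtoC t) eq_refl). now rewrite Cmod_Rline. }
  rewrite !R. split.
  - intros H. split; [exact (ccont_fst _ _ _ H)|exact (ccont_snd _ _ _ H)].
  - intros [H1 H2]. apply ccont_ext with (2 := eq_sym (surjective_pairing _)) (3 := ccont_pair _ _ _ _ H1 H2).
    intros. symmetry. apply surjective_pairing.
Qed.

Lemma rder_rcont c s v : rder c s v -> rcont c s.
Proof. apply cder_ccont. Qed.

Lemma rder_comp (D : C -> Prop) f c s l v :
  (forall t, D (c t)) -> cder D f (c s) l -> rder c s v ->
  rder (fun t => f (c t)) s (l * v)%C.
Proof.
  intros HD Hf Hc. apply (cder_comp Rline D f (fun z => c (fst z))); auto.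
Qed.

Lemma rcont_comp (D : C -> Prop) f c s :
  (forall t, D (c t)) -> ccont D f (c s) -> rcont c s -> rcont (fun t => f (c t)) s.
Proof.
  intros HD Hf Hc. apply (ccont_comp Rline D f (fun z => c (fst z))); auto.
Qed.

Lemma rder_RtoC (f : R -> R) s l : is_derive f s l -> rder (fun t => RtoC (f t)) s (RtoC l).
Proof. intros H. apply rder_parts. split; [exact H|]. apply is_derive_Reals, derivable_pt_lim_const. Qed.

Lemma rcont_RtoC (f : R -> R) s : continuity_pt f s -> rcont (fun t => RtoC (f t)) s.
Proof.
  intros H. apply rcont_parts. split; [exact H|].
  apply continuity_pt_const. now intros x y.
Qed.

Lemma rder_expi t : rder expi t (Ci * expi t)%C.
Proof.
  apply rder_parts. unfold expi; simpl. split.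
  - evar_last; [apply is_derive_Reals, derivable_pt_lim_cos|]. ring.
  - evar_last; [apply is_derive_Reals, derivable_pt_lim_sin|]. ring.
Qed.

Lemma rder_expi_comp (f : R -> R) s l :
  is_derive f s l -> rder (fun t => expi (f t)) s (Ci * expi (f s) * RtoC l)%C.
Proof.
  intros H.
  apply (cder_comp Rline Rline (fun z => expi (fst z)) (fun z => RtoC (f (fst z)))).
  - intros; reflexivity.
  - exact (rder_expi (f s)).
  - exact (rder_RtoC f s l H).
Qed.

Lemma expi_plus a b : expi (a + b) = (expi a * expi b)%C.
Proof. unfold expi. rewrite cos_plus, sin_plus. apply C_eq; simpl; ring. Qed.

Lemma Cmod_expi t : Cmod (expi t) = 1.
Proof.
  unfold Cmod, expi; simpl. rewrite !Rmult_1_r.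
  assert (H := sin2_cos2 t). unfold Rsqr in H.
  replace (cos t * cos t + sin t * sin t) with 1 by lra. apply sqrt_1.
Qed.

Lemma expi_nz t : expi t <> RtoC 0.
Proof. apply Cmod_gt_0. rewrite Cmod_expi. lra. Qed.

Lemma expi_0 : expi 0 = RtoC 1.
Proof. unfold expi. now rewrite cos_0, sin_0. Qed.

Lemma expi_PI2 : expi (PI / 2) = Ci.
Proof. unfold expi. now rewrite cos_PI2, sin_PI2. Qed.

Lemma expi_opp t : (expi t * expi (- t))%C = RtoC 1.
Proof. rewrite <- expi_plus. replace (t + - t) with 0 by ring. apply expi_0. Qed.

Lemma expi_2PI : expi (2 * PI) = RtoC 1.
Proof. unfold expi. now rewrite cos_2PI, sin_2PI. Qed.

Lemma expi_exists (z : C) : Cmod z = 1 -> exists t, z = expi t.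
Proof.
  intros H. destruct z as [x y].
  assert (E : x * x + y * y = 1).
  { assert (Q := Cmod_sqr (x, y)). rewrite H in Q. simpl in Q. lra. }
  assert (B : -1 <= x <= 1) by nra.
  assert (S := sin_acos x B). unfold Rsqr in S.
  destruct (Rle_dec 0 y).
  - exists (acos x). unfold expi. rewrite cos_acos, S by exact B. f_equal.
    replace (1 - x * x) with (Rsqr y) by (unfold Rsqr; lra). now rewrite sqrt_Rsqr.
  - exists (- acos x). unfold expi. rewrite cos_neg, sin_neg, cos_acos, S by exact B. f_equal.
    replace (1 - x * x) with (Rsqr (- y)) by (unfold Rsqr; lra).
    rewrite sqrt_Rsqr by lra. ring.
Qed.

(** * Holomorphic functions and the logarithm *)

(** Finite orders of continuous complex differentiability, so that each closure rule is an
    induction. Harmonicity asks for order two. *)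
Fixpoint holo (D : C -> Prop) (n : nat) (f : C -> C) : Prop :=
  match n with
  | O => forall z, D z -> ccont D f z
  | S k => exists f1, (forall z, D z -> cder D f z (f1 z)) /\ holo D k f1
  end.

Lemma holo_pred D n f : holo D (S n) f -> holo D n f.
Proof.
  revert f. induction n as [|n IH]; intros f [f1 [H H1]].
  - intros z Dz. exact (cder_ccont _ _ _ _ (H z Dz)).
  - exists f1; split; auto.
Qed.

Lemma holo_ext D n f g : (forall z, D z -> f z = g z) -> holo D n f -> holo D n g.
Proof.
  intros E. destruct n; simpl.
  - intros H z Dz. apply ccont_ext with f; auto.
  - intros [f1 [H H1]]. exists f1; split; auto.
    intros z Dz. apply cder_ext with f; auto.
Qed.

Lemma holo_const D n c : holo D n (fun _ => c).
Proof.
  revert c. induction n as [|n IH]; intros c; simpl.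
  - intros; apply ccont_const.
  - exists (fun _ => RtoC 0); split; [intros; apply cder_const|apply IH].
Qed.

Lemma holo_id D n : holo D n (fun z => z).
Proof.
  destruct n; simpl.
  - intros; apply ccont_id.
  - exists (fun _ => RtoC 1); split; [intros; apply cder_id|apply holo_const].
Qed.

Lemma holo_plus D n f g : holo D n f -> holo D n g -> holo D n (fun z => f z + g z)%C.
Proof.
  revert f g. induction n as [|n IH]; simpl; intros f g.
  - intros Hf Hg z Dz. apply ccont_plus; auto.
  - intros [f1 [Hf Hf1]] [g1 [Hg Hg1]].
    exists (fun z => f1 z + g1 z)%C; split; auto.
    intros; apply cder_plus; auto.
Qed.

Lemma holo_mult D n f g : holo D n f -> holo D n g -> holo D n (fun z => f z * g z)%C.
Proof.
  revert f g. induction n as [|n IH]; intros f g Hf Hg.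
  - intros z Dz. apply ccont_mult; auto.
  - assert (Pf := holo_pred _ _ _ Hf). assert (Pg := holo_pred _ _ _ Hg).
    destruct Hf as [f1 [Hf Hf1]]. destruct Hg as [g1 [Hg Hg1]].
    exists (fun z => f1 z * g z + f z * g1 z)%C; split.
    + intros; apply cder_mult; auto.
    + apply holo_plus; auto.
Qed.

Lemma holo_opp D n f : holo D n f -> holo D n (fun z => - f z)%C.
Proof.
  intros H. apply holo_ext with (fun z => - RtoC 1 * f z)%C.
  - intros. ring.
  - apply holo_mult; [apply holo_const|exact H].
Qed.

Lemma holo_inv D n f : (forall z, D z -> f z <> RtoC 0) ->
  holo D n f -> holo D n (fun z => / f z)%C.
Proof.
  intros N. revert f N. induction n as [|n IH]; intros f N Hf.
  - intros z Dz. apply ccont_inv; auto.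
  - assert (Pf := IH f N (holo_pred _ _ _ Hf)). destruct Hf as [f1 [Hf Hf1]].
    exists (fun z => - f1 z * (/ f z * / f z))%C; split.
    + intros; apply cder_inv; auto.
    + apply holo_mult; [now apply holo_opp|now apply holo_mult].
Qed.

Lemma holo_comp (D D' : C -> Prop) n f g : (forall z, D z -> D' (g z)) ->
  holo D' n f -> holo D n g -> holo D n (fun z => f (g z)).
Proof.
  intros HD. revert f. induction n as [|n IH]; intros f Hf Hg.
  - intros z Dz. apply ccont_comp with D'; auto.
  - assert (Pg := holo_pred _ _ _ Hg).
    destruct Hf as [f1 [Hf Hf1]]. destruct Hg as [g1 [Hg Hg1]].
    exists (fun z => f1 (g z) * g1 z)%C; split.
    + intros z Dz. apply cder_comp with D'; auto.
    + apply holo_mult; auto.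
Qed.

Fixpoint Csum (n : nat) (f : nat -> C) : C :=
  match n with O => RtoC 0 | S k => (Csum k f + f k)%C end.

Lemma holo_sum D n N (f : nat -> C -> C) : (forall j, (j < N)%nat -> holo D n (f j)) ->
  holo D n (fun z => Csum N (fun j => f j z)).
Proof.
  induction N as [|N IH]; intros H; simpl.
  - apply holo_const.
  - apply holo_plus; [apply IH; intros; apply H; lia|apply H; lia].
Qed.

Lemma fst_Csum n f : fst (Csum n f) = Rsumn n (fun j => fst (f j)).
Proof. induction n; simpl; congruence. Qed.

Lemma snd_Csum n f : snd (Csum n f) = Rsumn n (fun j => snd (f j)).
Proof. induction n; simpl; congruence. Qed.

Definition everywhere (z : C) : Prop := True.

Lemma open_ccont (D : C -> Prop) f z : open_set D -> D z -> ccont D f z -> ccont everywhere f z.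
Proof.
  intros OD Dz H e He. destruct (OD z Dz) as [r [Hr Kr]].
  destruct (H e He) as [d [Hd K]]. exists (Rmin r d). split; [now apply Rmin_pos|].
  intros w _ Hw. apply K.
  - apply Kr. eapply Rlt_le_trans; [apply Hw|apply Rmin_l].
  - eapply Rlt_le_trans; [apply Hw|apply Rmin_r].
Qed.

Lemma open_cder (D : C -> Prop) f z l :
  open_set D -> D z -> cder D f z l -> cder everywhere f z l.
Proof.
  rewrite !cder_eps. intros OD Dz H e He. destruct (OD z Dz) as [r [Hr Kr]].
  destruct (H e He) as [d [Hd K]]. exists (Rmin r d). split; [now apply Rmin_pos|].
  intros w _ Hw. apply K.
  - apply Kr. eapply Rlt_le_trans; [apply Hw|apply Rmin_l].
  - eapply Rlt_le_trans; [apply Hw|apply Rmin_r].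
Qed.

(** Both numbers are the derivative along the horizontal line through [z]. This identifies the
    derivative found from Cauchy's formula with the given one. *)
Lemma cder_unique (D : C -> Prop) f z l k :
  open_set D -> D z -> cder D f z l -> cder D f z k -> l = k.
Proof.
  intros OD Dz Hl Hk.
  apply (open_cder D) in Hl; auto. apply (open_cder D) in Hk; auto.
  set (c := fun t : R => (z + RtoC t)%C).
  assert (Hc : rder c 0 (RtoC 1)).
  { replace (RtoC 1) with (RtoC 0 + RtoC 1)%C by ring.
    apply (cder_plus Rline (fun _ => z) (fun w => RtoC (fst w))); [apply cder_const|].
    apply (rder_RtoC (fun t => t) 0 1). apply @is_derive_id. }
  assert (E : c 0 = z) by (unfold c; ring).
  rewrite <- E in Hl, Hk.
  assert (A := rder_comp everywhere f c 0 l _ (fun _ => I) Hl Hc).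
  assert (B := rder_comp everywhere f c 0 k _ (fun _ => I) Hk Hc).
  apply rder_parts in A. apply rder_parts in B.
  destruct A as [A1 A2], B as [B1 B2].
  apply is_derive_unique in A1, A2, B1, B2.
  replace l with (l * RtoC 1)%C by ring. replace k with (k * RtoC 1)%C by ring.
  apply C_eq; congruence.
Qed.

Lemma cder_partials f z l : cder everywhere f z l ->
  rder (fun t => f (t, snd z)) (fst z) l /\ rder (fun t => f (fst z, t)) (snd z) (Ci * l)%C.
Proof.
  intros H. split.
  - replace l with (l * RtoC 1)%C by ring.
    apply (rder_comp everywhere f (fun t => (t, snd z))); [exact (fun _ => I)| |].
    + now destruct z.
    + apply rder_parts; simpl. split; [apply @is_derive_id|].
      apply is_derive_Reals, derivable_pt_lim_const.
  - replace (Ci * l)%C with (l * Ci)%C by ring.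
    apply (rder_comp everywhere f (fun t => (fst z, t))); [exact (fun _ => I)| |].
    + now destruct z.
    + apply rder_parts; simpl. split; [|apply @is_derive_id].
      apply is_derive_Reals, derivable_pt_lim_const.
Qed.

Lemma open_near_fst (U : C -> Prop) z : open_set U -> U z ->
  locally (fst z) (fun t : R => U (t, snd z)).
Proof.
  intros OU Uz. destruct (OU z Uz) as [r [Hr K]]. exists (mkposreal r Hr).
  intros t Ht. apply K. eapply Rle_lt_trans; [apply Cmod_le_parts|]. simpl.
  replace (snd z + - snd z) with 0 by ring. rewrite Rabs_R0, Rplus_0_r. exact Ht.
Qed.

Lemma open_near_snd (U : C -> Prop) z : open_set U -> U z ->
  locally (snd z) (fun t : R => U (fst z, t)).
Proof.
  intros OU Uz. destruct (OU z Uz) as [r [Hr K]]. exists (mkposreal r Hr).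
  intros t Ht. apply K. eapply Rle_lt_trans; [apply Cmod_le_parts|]. simpl.
  replace (fst z + - fst z) with 0 by ring. rewrite Rabs_R0, Rplus_0_l. exact Ht.
Qed.

Lemma open_contC_snd (U : C -> Prop) u f z : open_set U -> U z ->
  (forall w, U w -> u w = snd (f w)) -> ccont U f z -> contC_within (fun _ => True) u z.
Proof.
  intros OU Uz E H e He. apply (open_ccont U) in H; auto.
  apply ccont_snd in H. destruct (OU z Uz) as [r [Hr Kr]].
  destruct (H e He) as [d [Hd K]]. exists (Rmin r d). split; [now apply Rmin_pos|].
  intros w _ Hw. rewrite !E; auto.
  - apply K; [exact I|]. eapply Rlt_le_trans; [apply Hw|apply Rmin_r].
  - apply Kr. eapply Rlt_le_trans; [apply Hw|apply Rmin_l].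
Qed.

(** Agreement of [u] with the imaginary part is asked on [U] only, because the lemma is applied
    again to [pdx] and [pdy], which are known only there. *)
Lemma C1_on_Im (U : C -> Prop) u f f1 : open_set U ->
  (forall z, U z -> u z = snd (f z)) -> (forall z, U z -> cder U f z (f1 z)) ->
  (forall z, U z -> ccont U f1 z) ->
  C1_on U u /\ (forall z, U z -> pdx u z = snd (f1 z))
  /\ (forall z, U z -> pdy u z = snd (Ci * f1 z)%C).
Proof.
  intros OU E Hf Hf1.
  assert (X : forall z, U z -> is_derive (fun t => u (t, snd z)) (fst z) (snd (f1 z))).
  { intros z Uz. apply is_derive_ext_loc with (fun t => snd (f (t, snd z))).
    - apply filter_imp with (2 := open_near_fst U z OU Uz). intros t Ht. now rewrite E.
    - specialize (Hf z Uz). apply (open_cder U) in Hf; auto. apply cder_partials in Hf.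
      destruct Hf as [H _]. apply rder_parts in H. apply H. }
  assert (Y : forall z, U z -> is_derive (fun t => u (fst z, t)) (snd z) (snd (Ci * f1 z)%C)).
  { intros z Uz. apply is_derive_ext_loc with (fun t => snd (f (fst z, t))).
    - apply filter_imp with (2 := open_near_snd U z OU Uz). intros t Ht. now rewrite E.
    - specialize (Hf z Uz). apply (open_cder U) in Hf; auto. apply cder_partials in Hf.
      destruct Hf as [_ H]. apply rder_parts in H. apply H. }
  assert (X' : forall z, U z -> pdx u z = snd (f1 z)).
  { intros z Uz. apply is_derive_unique, X, Uz. }
  assert (Y' : forall z, U z -> pdy u z = snd (Ci * f1 z)%C).
  { intros z Uz. apply is_derive_unique, Y, Uz. }
  split; [split|split]; auto.
  - intros z Uz. split; eexists; [apply X|apply Y]; exact Uz.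
  - intros z Uz. split; [|split].
    + apply (open_contC_snd U u f); auto. eapply cder_ccont; auto.
    + apply (open_contC_snd U _ f1); auto.
    + apply (open_contC_snd U _ (fun z => Ci * f1 z)%C); auto.
      apply ccont_mult; [apply ccont_const|auto].
Qed.

(** The second partial derivatives are the imaginary parts of [f2 z] and of [Ci * (Ci * f2 z)],
    which cancel. *)
Lemma harmonic_Im (U : C -> Prop) f : open_set U -> holo U 2 f ->
  harmonic_on U (fun z => snd (f z)).
Proof.
  intros OU [f1 [H [f2 [H1 H2]]]]. simpl in H2.
  assert (C1 : forall z, U z -> ccont U f1 z) by (intros z Uz; eapply cder_ccont; auto).
  destruct (C1_on_Im U (fun z => snd (f z)) f f1) as [A [AX AY]]; auto.
  destruct (C1_on_Im U (pdx (fun z => snd (f z))) f1 f2) as [B [BX BY]]; auto.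
  destruct (C1_on_Im U (pdy (fun z => snd (f z))) (fun z => Ci * f1 z)%C (fun z => Ci * f2 z)%C)
    as [K [KX KY]]; auto.
  - intros z Uz. now apply cder_scal, H1.
  - intros z Uz. apply ccont_mult; [apply ccont_const|auto].
  - split; [exact A|]. split; [exact B|]. split; [exact K|].
    intros z Uz. rewrite BX, KY by exact Uz. simpl. ring.
Qed.

(* The argument on the right half plane only: [atan] ignores the sign of [fst w]. *)
Definition carg (w : C) : R := atan (snd w / fst w).
Definition Log (w : C) : C := (ln (Cmod w), carg w).
Definition right_half (w : C) : Prop := 0 < fst w.
Definition cexp (z : C) : C := (RtoC (exp (fst z)) * expi (snd z))%C.

Lemma right_half_nz w : right_half w -> w <> RtoC 0.
Proof. intros H E. subst w. unfold right_half in H. simpl in H. lra. Qed.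

Lemma expi_carg w : right_half w -> expi (carg w) = (w / RtoC (Cmod w))%C.
Proof.
  intros H. assert (N := right_half_nz w H). assert (P := proj1 (Cmod_gt_0 w) N).
  unfold right_half in H. destruct w as [x y]. simpl in H.
  unfold expi, carg. rewrite cos_atan, sin_atan. simpl fst. simpl snd.
  assert (E : sqrt (1 + (y / x)²) = Cmod (x, y) / x).
  { apply Rsqr_inj.
    - apply sqrt_pos.
    - apply Rlt_le, Rdiv_lt_0_compat; lra.
    - rewrite Rsqr_sqrt; [|generalize (Rle_0_sqr (y / x)); lra].
      unfold Rsqr. replace (Cmod (x, y) / x * (Cmod (x, y) / x))
        with (Cmod (x, y) * Cmod (x, y) / (x * x)) by (field; lra).
      rewrite Cmod_sqr. simpl. field. lra. }
  rewrite E. set (m := Cmod (x, y)) in *. clearbody m.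
  unfold Cdiv. rewrite <- RtoC_inv by lra.
  apply C_eq; simpl; field; lra.
Qed.

Lemma cexp_Log w : right_half w -> cexp (Log w) = w.
Proof.
  intros H. assert (N := right_half_nz w H). assert (P := proj1 (Cmod_gt_0 w) N).
  unfold cexp, Log; simpl. rewrite exp_ln by exact P. rewrite expi_carg by exact H.
  field. intros E. apply RtoC_inj in E. lra.
Qed.

Lemma cexp_plus z w : cexp (z + w)%C = (cexp z * cexp w)%C.
Proof. unfold cexp; simpl. rewrite exp_plus, expi_plus, RtoC_mult. ring. Qed.

Lemma cexp_0 : cexp (RtoC 0) = RtoC 1.
Proof. unfold cexp; simpl. rewrite exp_0, expi_0. ring. Qed.

Lemma cder_cexp_0 : cder everywhere cexp (RtoC 0) (RtoC 1).
Proof.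
  apply cder_eps. intros e He.
  assert (X : is_derive exp 0 1).
  { evar_last; [apply is_derive_Reals, derivable_pt_lim_exp|]. apply exp_0. }
  assert (Y := rder_expi 0). rewrite expi_0 in Y.
  assert (Z : continuity_pt exp 0) by apply derivable_continuous_pt, derivable_pt_exp.
  rewrite is_derive_eps in X. rewrite rder_eps in Y. rewrite continuity_pt_eps in Z.
  (* The three remainders below contribute 2, 1 and 1 times this bound, whence [e / 4]; the bound
     [1/2] keeps [exp a] below 2. *)
  assert (He' : 0 < Rmin (1/2) (e / 4)) by (apply Rmin_pos; lra).
  destruct (X _ He') as [d1 [Hd1 K1]]. destruct (Y _ He') as [d2 [Hd2 K2]].
  destruct (Z _ He') as [d3 [Hd3 K3]].
  exists (Rmin d1 (Rmin d2 d3)). split; [repeat apply Rmin_pos; auto|].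
  intros w _ Hw. rewrite cexp_0.
  replace (w - RtoC 0)%C with w in * by ring.
  destruct w as [a b]. assert (Ba := Cmod_fst (a, b)). assert (Bb := Cmod_snd (a, b)).
  simpl in Ba, Bb.
  assert (M1 := Rmin_l d1 (Rmin d2 d3)). assert (M2 := Rmin_r d1 (Rmin d2 d3)).
  assert (M3 := Rmin_l d2 d3). assert (M4 := Rmin_r d2 d3).
  assert (M5 := Rmin_l (1/2) (e/4)). assert (M6 := Rmin_r (1/2) (e/4)).
  specialize (K1 a). specialize (K2 b). specialize (K3 a).
  rewrite !Rminus_0_r in *. rewrite exp_0 in *.
  specialize (K1 ltac:(lra)). specialize (K2 ltac:(lra)). specialize (K3 ltac:(lra)).
  rewrite expi_0 in K2.
  (* The remainder splits into the remainder of [expi] at [b], that of [exp] at [a], and a mixed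
     term with two small factors. *)
  replace (cexp (a, b) - RtoC 1 - RtoC 1 * (a, b))%C
    with (RtoC (exp a) * (expi b - RtoC 1 - Ci * RtoC 1 * RtoC b)
          + (RtoC (exp a - 1 - 1 * a) + Ci * RtoC b * RtoC (exp a - 1)))%C.
  2:{ unfold cexp; simpl fst; simpl snd. rewrite !RtoC_minus, RtoC_mult.
      replace ((a, b) : C) with (RtoC a + Ci * RtoC b)%C; [ring|].
      apply C_eq; simpl; ring. }
  eapply Rle_trans; [apply Cmod_triangle|].
  eapply Rle_trans; [apply Rplus_le_compat_l, Cmod_triangle|].
  rewrite !Cmod_mult, Cmod_Ci, !Cmod_R.
  set (k := Cmod (expi b - RtoC 1 - Ci * RtoC 1 * RtoC b)) in *.
  set (mu := Rmin (1/2) (e/4)) in *. set (mw := Cmod (a, b)) in *.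
  assert (Pk : 0 <= k) by apply Cmod_ge_0.
  assert (Pa := Rabs_pos a). assert (Pb := Rabs_pos b).
  assert (Q : Rabs (exp a) <= 2).
  { apply Rabs_le. apply Rabs_def2 in K3. lra. }
  assert (Pq := Rabs_pos (exp a)).
  assert (Rabs (exp a) * k <= 2 * (mu * mw)).
  { apply Rmult_le_compat; auto. eapply Rle_trans; [apply K2|]. nra. }
  assert (Rabs (exp a - 1 - 1 * a) <= mu * mw) by (eapply Rle_trans; [apply K1|]; nra).
  assert (1 * Rabs b * Rabs (exp a - 1) <= mw * mu).
  { rewrite Rmult_1_l. apply Rmult_le_compat; auto; try apply Rabs_pos. lra. }
  nra.
Qed.

Lemma cder_cexp z : cder everywhere cexp z (cexp z).
Proof.
  apply cder_ext with (f := fun w => (cexp z * cexp (w - z))%C).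
  - intros w _. rewrite <- cexp_plus. f_equal. ring.
  - rewrite <- cexp_plus. f_equal. ring.
  - assert (H : cder everywhere (fun w => cexp (w - z)%C) z (RtoC 1 * (RtoC 1 + RtoC 0))%C).
    { apply (cder_comp everywhere everywhere cexp (fun w => w - z)%C); [easy| |].
      - replace (z - z)%C with (RtoC 0) by ring. apply cder_cexp_0.
      - apply cder_plus; [apply cder_id|apply cder_const]. }
    apply cder_scal with (c := cexp z) in H.
    now replace (cexp z * (RtoC 1 * (RtoC 1 + RtoC 0)))%C with (cexp z) in H by ring.
Qed.

Lemma contC_carg (D : C -> Prop) f z :
  right_half (f z) -> ccont D f z -> contC_within D (fun w => carg (f w)) z.
Proof.
  intros Hz Hf. apply (contC_comp D atan (fun w => snd (f w) / fst (f w))).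
  - apply derivable_continuous_pt, derivable_pt_atan.
  - apply contC_mult; [now apply ccont_snd|].
    apply contC_inv; [unfold right_half in Hz; lra|now apply ccont_fst].
Qed.

(** [Log] is a continuous right inverse of [cexp], whose derivative at [Log w] is
    [cexp (Log w) = w]; the inverse rule replaces a computation with [ln] and [atan]. *)
Lemma cder_Log w : right_half w -> cder right_half Log w (/ w)%C.
Proof.
  intros H. assert (P := proj1 (Cmod_gt_0 w) (right_half_nz w H)).
  apply (cder_inverse right_half everywhere cexp Log).
  - easy.
  - apply cexp_Log.
  - now apply cexp_Log.
  - now apply right_half_nz.
  - apply ccont_pair.
    + apply (contC_comp right_half ln (fun w => Cmod w)).
      * apply derivable_continuous_pt. eexists. now apply derivable_pt_lim_ln.
      * apply contC_Cmod, ccont_id.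
    + apply (contC_carg right_half (fun w => w)); [exact H|apply ccont_id].
  - rewrite <- (cexp_Log w H) at 2. apply cder_cexp.
Qed.

Lemma holo_Log n : holo right_half n Log.
Proof.
  destruct n.
  - intros z Hz. eapply cder_ccont, cder_Log, Hz.
  - exists (fun w => / w)%C. split; [apply cder_Log|].
    apply (holo_inv right_half n (fun w => w)); [apply right_half_nz|apply holo_id].
Qed.

(** * Compactness and the closed disk *)

(** One covering statement behind all compactness arguments: [P u r] records what holds within [r]
    of [u], and the radii in use have a common lower bound. Every centre of the plane must be
    served, so the applications add a case for centres off the compact set. *)
Lemma lebesgue_number (M : R) (P : C -> R -> Prop) :
  (forall u, exists r, 0 < r /\ P u r) ->
  exists d, 0 < d /\ forall z, Cmod z <= M ->
    exists u r, P u r /\ Cmod (z - u)%C < r /\ d <= r.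
Proof.
  intros H.
  assert (H' : forall u, {r : R | 0 < r /\ P u r}).
  { intros u. apply constructive_indefinite_description, H. }
  set (r := fun u => proj1_sig (H' u)).
  assert (Pr : forall u, 0 < r u /\ P u (r u)) by (intros u; exact (proj2_sig (H' u))).
  (* The cover consists of squares; those of half side [r / 2] lie in the disks of radius [r]. *)
  assert (Hp : forall x y, 0 < r (x, y) / 2) by (intros x y; generalize (proj1 (Pr (x, y))); lra).
  destruct (compactness_value_2d (-M) M (-M) M (fun x y => mkposreal _ (Hp x y))) as [d Hd].
  exists d; split; [apply cond_pos|]. intros z Hz.
  assert (B1 := Cmod_fst z). assert (B2 := Cmod_snd z).
  specialize (Hd (fst z) (snd z)).
  apply NNPP. intros K. apply Hd; try (apply Rabs_le_between; lra).
  intros [x [y [_ [_ [Hx [Hy Hxy]]]]]]. simpl in Hx, Hy, Hxy.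
  apply K. exists (x, y), (r (x, y)). destruct (Pr (x, y)) as [P1 P2].
  split; [exact P2|]. split; [|lra].
  eapply Rle_lt_trans; [apply Cmod_le_parts|]. simpl. unfold Rminus in *. lra.
Qed.

Definition compact_set (D : C -> Prop) : Prop :=
  bounded_set D /\ forall z, ~ D z -> exists r, 0 < r /\ forall w, Cmod (w - z)%C < r -> ~ D w.

Lemma uniform_ccont D f : compact_set D -> (forall z, D z -> ccont D f z) ->
  forall e, 0 < e -> exists d, 0 < d /\
    forall z w, D z -> D w -> Cmod (w - z)%C < d -> Cmod (f w - f z)%C < e.
Proof.
  intros [[M HM] HD] Hf e He.
  destruct (lebesgue_number M (fun u r =>
    (D u /\ forall w, D w -> Cmod (w - u)%C < 2 * r -> Cmod (f w - f u)%C < e / 2)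
    \/ forall w, Cmod (w - u)%C < r -> ~ D w)) as [d [Hd K]].
  { intros u. destruct (classic (D u)) as [Du|Nu].
    - destruct (Hf u Du (e/2)) as [r [Hr Kr]]; [lra|].
      exists (r/2). split; [lra|]. left. split; [exact Du|].
      intros w Dw Hw. apply Kr; [exact Dw|lra].
    - destruct (HD u Nu) as [r [Hr Kr]]. exists r; auto. }
  exists d; split; auto. intros z w Dz Dw Hzw.
  destruct (K z (HM z Dz)) as [u [r [[[Du Hu]|Nu] [Hz Hr]]]].
  - assert (A := Hu z Dz ltac:(lra)).
    assert (B : Cmod (w - u)%C < 2 * r).
    { eapply Rle_lt_trans; [apply (Cmod_sub_triangle w z u)|]. lra. }
    specialize (Hu w Dw B).
    eapply Rle_lt_trans; [apply (Cmod_sub_triangle (f w) (f u) (f z))|].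
    rewrite (Cmod_sub_sym (f u)). lra.
  - now elim (Nu z Hz).
Qed.

(** The value at a centre is encoded in the radius: with [r <= / (1 + Cmod (f u))], a lower bound
    [d] on the radii becomes an upper bound [/ d] on the values at the centres. *)
Lemma compact_bounded D f : compact_set D -> (forall z, D z -> ccont D f z) ->
  exists B, 0 < B /\ forall z, D z -> Cmod (f z) <= B.
Proof.
  intros [[M HM] HD] Hf.
  destruct (lebesgue_number M (fun u r =>
    (r <= / (1 + Cmod (f u)) /\ forall w, D w -> Cmod (w - u)%C < r -> Cmod (f w - f u)%C < 1)
    \/ forall w, Cmod (w - u)%C < r -> ~ D w)) as [d [Hd K]].
  { intros u. destruct (classic (D u)) as [Du|Nu].
    - destruct (Hf u Du 1) as [r [Hr Kr]]; [lra|].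
      assert (0 < / (1 + Cmod (f u))).
      { apply Rinv_0_lt_compat. generalize (Cmod_ge_0 (f u)); lra. }
      exists (Rmin r (/ (1 + Cmod (f u)))). split; [now apply Rmin_pos|]. left.
      split; [apply Rmin_r|].
      intros w Dw Hw. apply Kr; [exact Dw|]. eapply Rlt_le_trans; [apply Hw|apply Rmin_l].
    - destruct (HD u Nu) as [r [Hr Kr]]. exists r; auto. }
  exists (/ d + 1). split; [generalize (Rinv_0_lt_compat d Hd); lra|]. intros z Dz.
  destruct (K z (HM z Dz)) as [u [r [[[Hu Hw]|Nu] [Hz Hr]]]].
  - specialize (Hw z Dz Hz). assert (P := Cmod_ge_0 (f u)).
    assert (1 + Cmod (f u) <= / d).
    { rewrite <- (Rinv_inv (1 + Cmod (f u))). apply Rinv_le_contravar; lra. }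
    generalize (Cmod_sub_lower (f z) (f u)). lra.
  - now elim (Nu z Hz).
Qed.

(** A continuous inverse comes from compactness. The radius at a centre away from [z0] also bounds
    from below the distance of the values to [f z0], so the common lower bound on the radii is the
    modulus sought. *)
Lemma compact_inverse D f z0 : compact_set D -> (forall z, D z -> ccont D f z) ->
  (forall z, D z -> f z = f z0 -> z = z0) ->
  forall e, 0 < e -> exists d, 0 < d /\
    forall w, D w -> Cmod (f w - f z0)%C < d -> Cmod (w - z0)%C < e.
Proof.
  intros [[M HM] HD] Hf Inj e He.
  destruct (lebesgue_number M (fun u r =>
    (forall w, Cmod (w - u)%C < r -> Cmod (w - z0)%C < e) \/
    (forall w, D w -> Cmod (w - u)%C < r -> r <= Cmod (f w - f z0)%C) \/
    (forall w, Cmod (w - u)%C < r -> ~ D w))) as [d [Hd K]].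
  { intros u. destruct (Rlt_dec (Cmod (u - z0)%C) e) as [L|NL].
    - exists (e - Cmod (u - z0)%C). split; [lra|]. left. intros w Hw.
      eapply Rle_lt_trans; [apply (Cmod_sub_triangle w u z0)|]. lra.
    - destruct (classic (D u)) as [Du|Nu].
      + assert (N : f u <> f z0).
        { intros E. apply NL. rewrite (Inj u Du E), Cmod_diag. exact He. }
        assert (P := Cmod_pos_sub _ _ N). set (m := Cmod (f u - f z0)%C) in *.
        destruct (Hf u Du (m/2)) as [r [Hr Kr]]; [lra|].
        exists (Rmin r (m/2)). split; [apply Rmin_pos; lra|]. right; left.
        intros w Dw Hw.
        specialize (Kr w Dw (Rlt_le_trans _ _ _ Hw (Rmin_l _ _))).
        eapply Rle_trans; [apply Rmin_r|].
        assert (T := Cmod_sub_triangle (f u) (f w) (f z0)).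
        rewrite (Cmod_sub_sym (f u) (f w)) in T. fold m in T. lra.
      + destruct (HD u Nu) as [r [Hr Kr]]. exists r; auto. }
  exists d; split; auto. intros w Dw Hw.
  destruct (K w (HM w Dw)) as [u [r [[A|[A|A]] [Hz Hr]]]].
  - now apply A.
  - specialize (A w Dw Hz). lra.
  - now elim (A w Hz).
Qed.

Lemma compact_closed_disk : compact_set closed_unit_disk.
Proof.
  split.
  - exists 1. auto.
  - intros z Hz. unfold closed_unit_disk in *. exists (Cmod z - 1). split; [lra|].
    intros w Hw. generalize (Cmod_sub_lower z w). rewrite Cmod_sub_sym. lra.
Qed.

Lemma open_disk : open_set unit_disk.
Proof.
  intros z Hz. unfold unit_disk in *. exists (1 - Cmod z). split; [lra|].
  intros w Hw. generalize (Cmod_sub_lower w z). lra.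
Qed.

Lemma disk_closed z : unit_disk z -> closed_unit_disk z.
Proof. unfold unit_disk, closed_unit_disk; lra. Qed.

Lemma Cmod_lt_1 z : Cmod z * Cmod z < 1 -> Cmod z < 1.
Proof. generalize (Cmod_ge_0 z). nra. Qed.

Lemma disk_convex z w t : closed_unit_disk z -> closed_unit_disk w -> 0 <= t <= 1 ->
  closed_unit_disk (z + RtoC t * (w - z))%C.
Proof.
  unfold closed_unit_disk. intros Hz Hw Ht.
  replace (z + RtoC t * (w - z))%C with (RtoC (1 - t) * z + RtoC t * w)%C
    by (rewrite RtoC_minus; ring).
  eapply Rle_trans; [apply Cmod_triangle|]. rewrite !Cmod_mult, !Cmod_R.
  rewrite !Rabs_pos_eq by lra. assert (P := Cmod_ge_0 z). assert (Q := Cmod_ge_0 w). nra.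
Qed.

(** Even with both ends on the circle, the interior of a chord lies where [f] is known to be
    differentiable. *)
Lemma disk_strictly_convex z w t : closed_unit_disk z -> closed_unit_disk w -> z <> w ->
  0 < t < 1 -> unit_disk (z + RtoC t * (w - z))%C.
Proof.
  unfold closed_unit_disk, unit_disk. intros Hz Hw N Ht. apply Cmod_lt_1.
  assert (P := Cmod_pos_sub _ _ N).
  assert (E1 := Cmod_sqr z). assert (E2 := Cmod_sqr w). assert (E3 := Cmod_sqr (z - w)%C).
  assert (P1 := Cmod_ge_0 z). assert (P2 := Cmod_ge_0 w).
  rewrite Cmod_sqr. destruct z as [x y], w as [x' y']. simpl in *.
  set (a := Cmod (x, y)) in *. set (b := Cmod (x', y')) in *.
  set (c := Cmod ((x, y) - (x', y'))%C) in *.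
  (* The squared modulus of [(1 - t) z + t w] is the convex combination of the squared moduli minus
     [t (1 - t)] times the squared distance. *)
  replace ((x + (t * (x' + - x) - 0 * (y' + - y))) * (x + (t * (x' + - x) - 0 * (y' + - y))) +
    (y + (t * (y' + - y) + 0 * (x' + - x))) * (y + (t * (y' + - y) + 0 * (x' + - x))))
    with ((1 - t) * (x * x + y * y) + t * (x' * x' + y' * y')
          - t * (1 - t) * ((x + - x') * (x + - x') + (y + - y') * (y + - y'))) by ring.
  rewrite <- E1, <- E2, <- E3.
  assert (a * a <= 1) by nra. assert (b * b <= 1) by nra.
  assert (0 < t * (1 - t) * (c * c)) by (apply Rmult_lt_0_compat; nra). nra.
Qed.

(** Extends a path on [[0, 1]] by constants, so that its continuity at the end points is two-sided,
    as [MVT_gen] asks. *)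
Definition clamp (t : R) : R := Rmax 0 (Rmin 1 t).

Lemma clamp_bounds t : 0 <= clamp t <= 1.
Proof.
  unfold clamp. split; [apply Rmax_l|]. apply Rmax_lub; [lra|apply Rmin_l].
Qed.

Lemma clamp_id t : 0 <= t <= 1 -> clamp t = t.
Proof. intros H. unfold clamp. rewrite Rmin_right, Rmax_right; lra. Qed.

Lemma clamp_lip s t : Rabs (clamp t - clamp s) <= Rabs (t - s).
Proof.
  unfold clamp, Rmax, Rmin.
  repeat destruct Rle_dec; apply Rabs_le; unfold Rabs; destruct Rcase_abs; lra.
Qed.

(** The derivative of [f] is used only inside the chord; at the ends continuity suffices. This is
    how differentiability reaches the circle. *)
Lemma segment_mean_value f f1 c e z w :
  (forall p, closed_unit_disk p -> ccont closed_unit_disk f p) ->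
  (forall p, unit_disk p -> cder unit_disk f p (f1 p)) ->
  closed_unit_disk z -> closed_unit_disk w ->
  (forall t, 0 <= t <= 1 -> Cmod (f1 (z + RtoC t * (w - z)) - c)%C <= e) ->
  Cmod (f w - f z - c * (w - z))%C <= e * Cmod (w - z)%C.
Proof.
  intros Cf Hf Dz Dw He.
  destruct (Ceq_dec z w) as [->|N].
  { replace (f w - f w - c * (w - w))%C with (RtoC 0) by ring.
    rewrite Cmod_diag, Cmod_0. lra. }
  set (k := (f w - f z - c * (w - z))%C).
  (* The mean value theorem fails for complex values, so the path is projected on the total
     increment [k] itself: the real part of [F] grows by exactly the squared modulus of [k]. *)
  set (F := fun t : R => (Cconj k * (f (z + RtoC t * (w - z)) - c * (RtoC t * (w - z))))%C).
  set (F1 := fun t : R => (Cconj k * ((f1 (z + RtoC t * (w - z)) - c) * (w - z)))%C).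
  assert (Dseg : forall t, 0 < t < 1 -> unit_disk (z + RtoC t * (w - z))%C)
    by (intros; now apply disk_strictly_convex).
  destruct (MVT_gen (fun t => fst (F (clamp t))) 0 1 (fun t => fst (F1 t))) as [x [Hx E]].
  - rewrite Rmin_left, Rmax_right by lra. intros t Ht.
    apply is_derive_ext_loc with (fun t => fst (F t)).
    { assert (P : 0 < Rmin t (1 - t)) by (apply Rmin_pos; lra).
      exists (mkposreal _ P). intros s Hs. rewrite clamp_id; [reflexivity|].
      change (Rabs (s - t) < Rmin t (1 - t)) in Hs.
      assert (A := Rmin_l t (1 - t)). assert (B := Rmin_r t (1 - t)).
      apply Rabs_def2 in Hs. lra. }
    apply (proj1 (rder_parts F t (F1 t))).
    assert (L : rder (fun t => RtoC t * (w - z))%C t (w - z)%C).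
    { assert (L : rder (fun t => RtoC t * (w - z))%C t (RtoC 1 * (w - z) + RtoC t * RtoC 0)%C).
      2:{ now replace (RtoC 1 * (w - z) + RtoC t * RtoC 0)%C with (w - z)%C in L by ring. }
      apply (cder_mult Rline (fun z => RtoC (fst z)) (fun _ => w - z)%C).
      - apply (rder_RtoC (fun t => t) t 1). apply @is_derive_id.
      - apply cder_const. }
    apply (cder_scal Rline (Cconj k)
      (fun s => f (z + RtoC (fst s) * (w - z)) - c * (RtoC (fst s) * (w - z)))%C).
    replace ((f1 (z + RtoC t * (w - z)) - c) * (w - z))%C
      with (f1 (z + RtoC t * (w - z)) * (RtoC 0 + (w - z)) + - RtoC 1 * (c * (w - z)))%C by ring.
    apply cder_ext with (f := fun s => (f (z + RtoC (fst s) * (w - z))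
       + - RtoC 1 * (c * (RtoC (fst s) * (w - z))))%C); [intros; ring|ring|].
    apply cder_plus.
    + apply (cder_comp Rline everywhere f (fun s => z + RtoC (fst s) * (w - z))%C).
      * easy.
      * apply (open_cder unit_disk); [apply open_disk|now apply Dseg|now apply Hf, Dseg].
      * apply cder_plus; [apply cder_const|exact L].
    + apply cder_scal, cder_scal. exact L.
  - intros t _.
    apply (proj1 (rcont_parts (fun t => F (clamp t)) t)).
    assert (L : rcont (fun t => RtoC (clamp t) * (w - z))%C t).
    { apply (ccont_mult Rline (fun z => RtoC (clamp (fst z))) (fun _ => w - z)%C);
        [|apply ccont_const].
      apply (rcont_RtoC clamp). apply continuity_pt_eps. intros eps Heps.
      exists eps; split; auto. intros y Hy.
      eapply Rle_lt_trans; [apply clamp_lip|exact Hy]. }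
    apply (ccont_mult Rline (fun _ => Cconj k)); [apply ccont_const|].
    apply ccont_minus.
    + apply (ccont_comp Rline closed_unit_disk f (fun s => z + RtoC (clamp (fst s)) * (w - z))%C).
      * intros s _. apply disk_convex; auto. apply clamp_bounds.
      * apply Cf. apply disk_convex; auto. apply clamp_bounds.
      * apply ccont_plus; [apply ccont_const|exact L].
    + apply ccont_mult; [apply ccont_const|exact L].
  - rewrite !clamp_id in E by lra.
    assert (Hk : fst (F 1) - fst (F 0) = Cmod k * Cmod k).
    { rewrite Cmod_sqr. unfold F.
      replace (z + RtoC 1 * (w - z))%C with w by ring.
      replace (z + RtoC 0 * (w - z))%C with z by ring.
      unfold k. destruct (f w), (f z), c, w, z; simpl. ring. }
    rewrite Hk, Rminus_0_r, Rmult_1_r in E.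
    rewrite Rmin_left, Rmax_right in Hx by lra. specialize (He x Hx).
    assert (B : Cmod k * Cmod k <= Cmod k * (e * Cmod (w - z))).
    { rewrite E. eapply Rle_trans; [apply Rle_abs|]. eapply Rle_trans; [apply Cmod_fst|].
      unfold F1. rewrite !Cmod_mult, Cmod_conj.
      apply Rmult_le_compat_l; [apply Cmod_ge_0|].
      apply Rmult_le_compat_r; [apply Cmod_ge_0|exact He]. }
    fold k. destruct (Cmod_ge_0 k) as [P|P]; [nra|]. rewrite <- P.
    apply Rmult_le_pos; [|apply Cmod_ge_0]. eapply Rle_trans; [apply Cmod_ge_0|exact He].
Qed.

(** Uniformity in the base point is what Cauchy's formula needs, where first order expansions are
    integrated over the circle. *)
Lemma closed_disk_uniform_der f f1 :
  (forall p, closed_unit_disk p -> ccont closed_unit_disk f p) ->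
  (forall p, unit_disk p -> cder unit_disk f p (f1 p)) ->
  (forall p, closed_unit_disk p -> ccont closed_unit_disk f1 p) ->
  forall e, 0 < e -> exists d, 0 < d /\ forall z w,
    closed_unit_disk z -> closed_unit_disk w -> Cmod (w - z)%C < d ->
    Cmod (f w - f z - f1 z * (w - z))%C <= e * Cmod (w - z)%C.
Proof.
  intros Cf Hf Cf1 e He.
  destruct (uniform_ccont _ _ compact_closed_disk Cf1 e He) as [d [Hd K]].
  exists d; split; auto. intros z w Dz Dw Hzw.
  apply segment_mean_value with f1; auto. intros t Ht. left. apply K; auto.
  - now apply disk_convex.
  - replace (z + RtoC t * (w - z) - z)%C with (RtoC t * (w - z))%C by ring.
    rewrite Cmod_mult, Cmod_R, Rabs_pos_eq by lra.
    assert (P := Cmod_ge_0 (w - z)%C). nra.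
Qed.

Lemma closed_disk_cder f f1 :
  (forall p, closed_unit_disk p -> ccont closed_unit_disk f p) ->
  (forall p, unit_disk p -> cder unit_disk f p (f1 p)) ->
  (forall p, closed_unit_disk p -> ccont closed_unit_disk f1 p) ->
  forall z, closed_unit_disk z -> cder closed_unit_disk f z (f1 z).
Proof.
  intros Cf Hf Cf1 z Dz. apply cder_eps. intros e He.
  destruct (closed_disk_uniform_der f f1 Cf Hf Cf1 e He) as [d [Hd K]].
  exists d; split; auto.
Qed.

(** * Integrals of complex curves *)

Definition cint (f : R -> C) (a b : R) : C :=
  (RInt (fun t => fst (f t)) a b, RInt (fun t => snd (f t)) a b).

Definition curve_cont (f : R -> C) : Prop := forall t, rcont f t.

Lemma continuity_continuous (f : R -> R) x : continuity_pt f x -> continuous f x.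
Proof. apply continuity_pt_filterlim. Qed.

Lemma curve_cont_ex_RInt f a b : curve_cont f ->
  ex_RInt (fun t => fst (f t)) a b /\ ex_RInt (fun t => snd (f t)) a b.
Proof.
  intros H. split; apply (ex_RInt_continuous (V := R_CompleteNormedModule));
    intros t _; apply continuity_continuous; apply (rcont_parts f t); apply H.
Qed.

Lemma cint_derive F f a b : (forall t, rder F t (f t)) -> curve_cont f ->
  cint f a b = (F b - F a)%C.
Proof.
  intros HF Hf. apply C_eq; unfold cint; simpl; apply is_RInt_unique.
  - apply (is_RInt_derive (V := R_CompleteNormedModule) (fun t => fst (F t))); intros t _.
    + apply (rder_parts F t (f t)). apply HF.
    + apply continuity_continuous; apply (rcont_parts f t); apply Hf.
  - apply (is_RInt_derive (V := R_CompleteNormedModule) (fun t => snd (F t))); intros t _.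
    + apply (rder_parts F t (f t)). apply HF.
    + apply continuity_continuous; apply (rcont_parts f t); apply Hf.
Qed.

Lemma cint_ext f g a b : (forall t, f t = g t) -> cint f a b = cint g a b.
Proof.
  intros H. unfold cint. f_equal; apply RInt_ext; intros; now rewrite H.
Qed.

Lemma cint_plus f g a b : curve_cont f -> curve_cont g ->
  cint (fun t => f t + g t)%C a b = (cint f a b + cint g a b)%C.
Proof.
  intros Hf Hg.
  destruct (curve_cont_ex_RInt f a b Hf), (curve_cont_ex_RInt g a b Hg).
  apply C_eq; unfold cint; simpl; now apply (RInt_plus (V := R_CompleteNormedModule)).
Qed.

Lemma cint_scal c f a b : curve_cont f ->
  cint (fun t => c * f t)%C a b = (c * cint f a b)%C.
Proof.
  intros Hf. destruct (curve_cont_ex_RInt f a b Hf) as [H1 H2].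
  assert (S : forall k (g : R -> R), ex_RInt g a b -> ex_RInt (fun t => k * g t) a b)
    by (intros k g Hg; apply (ex_RInt_scal (V := R_NormedModule)); exact Hg).
  assert (E : forall k (g : R -> R), ex_RInt g a b ->
            RInt (fun t => k * g t) a b = k * RInt g a b)
    by (intros k g Hg; apply (RInt_scal (V := R_CompleteNormedModule)); exact Hg).
  apply C_eq; unfold cint; simpl.
  - rewrite <- !E by assumption. apply (RInt_minus (V := R_CompleteNormedModule)); auto.
  - rewrite <- !E by assumption. apply (RInt_plus (V := R_CompleteNormedModule)); auto.
Qed.

(** The factor 2 comes from bounding the two coordinates separately. *)
Lemma cint_bound f a b M : a <= b -> curve_cont f ->
  (forall t, Cmod (f t) <= M) -> Cmod (cint f a b) <= 2 * ((b - a) * M).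
Proof.
  intros Hab Hf HM. destruct (curve_cont_ex_RInt f a b Hf) as [H1 H2].
  eapply Rle_trans; [apply Cmod_le_parts|]. unfold cint; simpl fst; simpl snd.
  assert (Rabs (RInt (fun t => fst (f t)) a b) <= (b - a) * M).
  { apply abs_RInt_le_const; auto. intros t _. eapply Rle_trans; [apply Cmod_fst|auto]. }
  assert (Rabs (RInt (fun t => snd (f t)) a b) <= (b - a) * M).
  { apply abs_RInt_le_const; auto. intros t _. eapply Rle_trans; [apply Cmod_snd|auto]. }
  lra.
Qed.

(** * Cauchy's integral formula *)

Lemma curve_cont_const c : curve_cont (fun _ => c).
Proof. intros t. apply ccont_const. Qed.

Lemma curve_cont_plus f g : curve_cont f -> curve_cont g -> curve_cont (fun t => f t + g t)%C.
Proof. intros Hf Hg t. apply ccont_plus; [apply Hf|apply Hg]. Qed.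

Lemma curve_cont_minus f g : curve_cont f -> curve_cont g -> curve_cont (fun t => f t - g t)%C.
Proof. intros Hf Hg t. apply ccont_minus; [apply Hf|apply Hg]. Qed.

Lemma curve_cont_mult f g : curve_cont f -> curve_cont g -> curve_cont (fun t => f t * g t)%C.
Proof. intros Hf Hg t. apply ccont_mult; [apply Hf|apply Hg]. Qed.

Lemma curve_cont_inv f : (forall t, f t <> RtoC 0) -> curve_cont f -> curve_cont (fun t => / f t)%C.
Proof.
  intros N Hf t. apply (ccont_inv Rline (fun z => f (fst z))); [apply N|apply Hf].
Qed.

Lemma curve_cont_pow f n : curve_cont f -> curve_cont (fun t => f t ^ n)%C.
Proof.
  intros Hf. induction n as [|n IH]; simpl.
  - apply curve_cont_const.
  - now apply curve_cont_mult.
Qed.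

Lemma curve_cont_expi : curve_cont expi.
Proof. intros t. eapply rder_rcont, rder_expi. Qed.

Lemma expi_minus_nz t z : unit_disk z -> (expi t - z)%C <> RtoC 0.
Proof.
  intros Hz E. unfold unit_disk in Hz.
  assert (H : expi t = z) by (replace z with (expi t - (expi t - z))%C by ring; rewrite E; ring).
  generalize (Cmod_expi t). rewrite H. lra.
Qed.

Lemma curve_cont_kernel z : unit_disk z -> curve_cont (fun t => / (expi t - z))%C.
Proof.
  intros Hz. apply curve_cont_inv; [intros; now apply expi_minus_nz|].
  apply curve_cont_minus; [apply curve_cont_expi|apply curve_cont_const].
Qed.

Create HintDb curves.
#[local] Hint Resolve curve_cont_const curve_cont_plus curve_cont_minus curve_cont_mult
  curve_cont_pow curve_cont_expi curve_cont_kernel : curves.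

Lemma one_minus_right_half z q : unit_disk z -> Cmod q = 1 -> right_half (RtoC 1 - z * q)%C.
Proof.
  intros Hz Hq. unfold right_half, unit_disk in *.
  assert (H : fst (z * q)%C < 1).
  { eapply Rle_lt_trans; [apply Rle_abs|].
    eapply Rle_lt_trans; [apply (Cmod_fst (z * q)%C)|]. rewrite Cmod_mult, Hq; lra. }
  change (0 < 1 + - fst (z * q)%C). lra.
Qed.

(** The integrand is [c] divided by [RtoC 1 - z * expi (- t)], with primitive
    [c (t - i Log (1 - z e^(-it)))]. The logarithm stays in the right half plane and returns to its
    initial value, so only [t] contributes. *)
Lemma cint_cauchy_kernel c z : unit_disk z ->
  cint (fun t => c * (expi t * / (expi t - z)))%C 0 (2 * PI) = (c * RtoC (2 * PI))%C.
Proof.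
  intros Hz.
  set (F := fun t => (c * (RtoC t + - Ci * Log (RtoC 1 - z * expi (- t))))%C).
  rewrite (cint_derive F).
  - unfold F. rewrite Ropp_0.
    replace (expi (- (2 * PI))) with (expi 0); [ring|].
    unfold expi. now rewrite !cos_neg, !sin_neg, cos_2PI, sin_2PI, cos_0, sin_0, Ropp_0.
  - intros t. unfold F.
    assert (N := expi_minus_nz t z Hz). assert (Q := expi_opp t).
    assert (E1 := expi_nz t).
    assert (I : expi (- t) = (/ expi t)%C).
    { replace (/ expi t)%C with (/ expi t * (expi t * expi (- t)))%C; [field; auto|].
      rewrite Q. ring. }
    assert (R1 : rder (fun s => RtoC s) t (RtoC 1)).
    { apply (rder_RtoC (fun s => s)). apply @is_derive_id. }
    assert (R2 : rder (fun s => expi (- s)) t (Ci * expi (- t) * RtoC (- (1)))%C).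
    { apply rder_expi_comp. apply (is_derive_opp (fun s : R => s)). apply @is_derive_id. }
    assert (R3 : rder (fun s => RtoC 1 - z * expi (- s))%C t
                   (RtoC 0 + - RtoC 1 * (z * (Ci * expi (- t) * RtoC (- (1)))))%C).
    { apply cder_ext with (f := fun s => (RtoC 1 + - RtoC 1 * (z * expi (- fst s)))%C);
        [intros; ring|ring|].
      apply cder_plus; [apply cder_const|]. apply cder_scal, cder_scal. exact R2. }
    assert (H : forall s, right_half (RtoC 1 - z * expi (- s))%C).
    { intros s. apply one_minus_right_half; [exact Hz|apply Cmod_expi]. }
    assert (R4 := rder_comp right_half Log _ t _ _ H (cder_Log _ (H t)) R3).
    replace (c * (expi t * / (expi t - z)))%C with (c * (RtoC 1 + - Ci *
      (/ (RtoC 1 - z * expi (- t)) *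
        (RtoC 0 + - RtoC 1 * (z * (Ci * expi (- t) * RtoC (- (1))))))))%C.
    + apply (cder_scal Rline c (fun s => RtoC (fst s) + - Ci * Log (RtoC 1 - z * expi (- fst s)))%C).
      apply cder_plus; [exact R1|]. apply cder_scal. exact R4.
    + rewrite I, RtoC_opp.
      assert (M : (RtoC 1 - z * / expi t)%C <> RtoC 0).
      { rewrite <- I. apply right_half_nz, H. }
      assert (C2 : (Ci * Ci)%C = (- RtoC 1)%C) by (apply C_eq; simpl; ring).
      replace (- Ci * (/ (RtoC 1 - z * / expi t) * (RtoC 0 + - RtoC 1 * (z * (Ci * / expi t * - RtoC 1)))))%C
        with (- (Ci * Ci) * (/ (RtoC 1 - z * / expi t) * (z * / expi t)))%C by ring.
      rewrite C2. field. repeat split; auto.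
  - auto with curves.
Qed.

(** Stands in for a vanishing derivative of an integral in its parameter: the uniform estimate is
    telescoped over equal steps shorter than [d]. *)
Lemma small_increments_const (I : R -> C) :
  (forall e, 0 < e -> exists d, 0 < d /\ forall x y, 0 <= x <= 1 -> 0 <= y <= 1 ->
     Rabs (y - x) < d -> Cmod (I y - I x)%C <= e * Rabs (y - x)) ->
  I 1 = I 0.
Proof.
  intros H.
  assert (Z : Cmod (I 1 - I 0)%C = 0).
  { apply Rle_antisym; [|apply Cmod_ge_0]. apply Rnot_lt_le. intros P.
    destruct (H (Cmod (I 1 - I 0)%C / 2)) as [d [Hd K]]; [lra|].
    set (e := Cmod (I 1 - I 0)%C) in *.
    destruct (archimed_cor1 d Hd) as [n [Hn Pn]].
    assert (Qn : 0 < INR n) by now apply lt_0_INR.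
    assert (S : forall k, (k <= n)%nat -> Cmod (I (INR k / INR n)%R - I 0)%C <= e / 2 * (INR k / INR n)).
    { induction k as [|k IH]; intros Hk.
      - simpl. unfold Rdiv. rewrite !Rmult_0_l, Cmod_diag. lra.
      - specialize (IH ltac:(lia)).
        assert (B1 : 0 <= INR k / INR n) by (apply Rdiv_le_0_compat; [apply pos_INR|lra]).
        assert (B2 : INR (S k) / INR n <= 1).
        { apply Rmult_le_reg_r with (INR n); [lra|]. unfold Rdiv.
          rewrite Rmult_assoc, Rinv_l, Rmult_1_r, Rmult_1_l by lra. now apply le_INR. }
        assert (D : INR (S k) / INR n - INR k / INR n = / INR n).
        { rewrite S_INR. field. lra. }
        assert (0 < / INR n) by now apply Rinv_0_lt_compat.
        assert (L := K (INR k / INR n) (INR (S k) / INR n) ltac:(lra) ltac:(lra)).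
        rewrite D, Rabs_pos_eq in L by lra. specialize (L Hn).
        eapply Rle_trans; [apply (Cmod_sub_triangle _ (I (INR k / INR n)))|]. nra. }
    specialize (S n (le_n n)). replace (INR n / INR n) with 1 in S by (field; lra).
    fold e in S. lra. }
  apply Cmod_eq_0 in Z. replace (I 1) with (I 1 - I 0 + I 0)%C by ring. rewrite Z. ring.
Qed.

Lemma closed_disk_expi t : closed_unit_disk (expi t).
Proof. unfold closed_unit_disk. rewrite Cmod_expi. lra. Qed.

(** The circle is contracted to [z0] along the segments [p x t]. The derivative in [x] of the
    integral [I x] is the integral of [f1 (p x t) * expi t], which vanishes because its integrand
    has a periodic primitive. At [x = 0] the kernel integral remains. *)
Lemma cauchy_formula f f1 z0 :
  (forall p, closed_unit_disk p -> ccont closed_unit_disk f p) ->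
  (forall p, unit_disk p -> cder unit_disk f p (f1 p)) ->
  (forall p, closed_unit_disk p -> ccont closed_unit_disk f1 p) ->
  unit_disk z0 ->
  cint (fun t => f (expi t) * (expi t * / (expi t - z0)))%C 0 (2 * PI) = (f z0 * RtoC (2 * PI))%C.
Proof.
  intros Cf Hf Cf1 Hz.
  set (p := fun (x t : R) => (z0 + RtoC x * (expi t - z0))%C).
  set (k := fun t => (expi t * / (expi t - z0))%C).
  assert (Dp : forall x t, 0 <= x <= 1 -> closed_unit_disk (p x t)).
  { intros x t Hx. apply disk_convex; auto; [now apply disk_closed|apply closed_disk_expi]. }
  assert (Cp : forall x, curve_cont (p x)).
  { intros x. unfold p. auto with curves. }
  assert (Cfp : forall x, 0 <= x <= 1 -> curve_cont (fun t => f (p x t))).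
  { intros x Hx t. apply (rcont_comp closed_unit_disk f (p x)); auto. apply Cp. }
  assert (Cf1p : forall x, 0 <= x <= 1 -> curve_cont (fun t => f1 (p x t))).
  { intros x Hx t. apply (rcont_comp closed_unit_disk f1 (p x)); auto. apply Cp. }
  assert (Ck : curve_cont k) by (unfold k; auto with curves).
  assert (Zero : forall x, 0 <= x <= 1 -> cint (fun t => f1 (p x t) * expi t)%C 0 (2 * PI) = RtoC 0).
  { intros x Hx. assert (Cf1e : curve_cont (fun t => f1 (p x t) * expi t)%C).
    { auto with curves. }
    (* The primitive [- i f (p x t) / x] exists for nonzero [x]; at [x = 0] the integrand is a
       multiple of [expi]. *)
    destruct (Req_dec x 0) as [->|Nx].
    - rewrite (cint_derive (fun t => f1 z0 * (- Ci * expi t))%C); auto.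
      + rewrite expi_2PI, expi_0. ring.
      + intros t. replace (p 0 t) with z0 by (unfold p; ring).
        replace (f1 z0 * expi t)%C with (f1 z0 * (- Ci * (Ci * expi t)))%C.
        * apply (cder_scal Rline (f1 z0) (fun s => - Ci * expi (fst s))%C).
          apply cder_scal. exact (rder_expi t).
        * replace (- Ci * (Ci * expi t))%C with (- (Ci * Ci) * expi t)%C by ring.
          replace (Ci * Ci)%C with (- RtoC 1)%C by (apply C_eq; simpl; ring). ring.
    - rewrite (cint_derive (fun t => - Ci * / RtoC x * f (p x t))%C); auto.
      + unfold p. rewrite expi_2PI, expi_0. ring.
      + intros t.
        assert (Rp : rder (p x) t (RtoC 0 + RtoC x * (Ci * expi t + RtoC 0))%C).
        { apply (cder_plus Rline (fun _ => z0) (fun s => RtoC x * (expi (fst s) - z0))%C);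
            [apply cder_const|].
          apply cder_scal. apply (cder_plus Rline (fun s => expi (fst s))); [exact (rder_expi t)|].
          apply cder_const. }
        assert (Rf := rder_comp closed_unit_disk f (p x) t _ _ (fun s => Dp x s Hx)
                 (closed_disk_cder f f1 Cf Hf Cf1 _ (Dp x t Hx)) Rp).
        apply (cder_scal Rline (- Ci * / RtoC x)%C) in Rf.
        replace (- Ci * / RtoC x * (f1 (p x t) * (RtoC 0 + RtoC x * (Ci * expi t + RtoC 0))))%C
          with (f1 (p x t) * expi t)%C in Rf; [exact Rf|].
        assert (Nx' : RtoC x <> RtoC 0) by (intros E; apply Nx; now apply RtoC_inj).
        replace (- Ci * / RtoC x * (f1 (p x t) * (RtoC 0 + RtoC x * (Ci * expi t + RtoC 0))))%C
          with (f1 (p x t) * expi t * (- (Ci * Ci)))%C by (field; auto).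
        replace (Ci * Ci)%C with (- RtoC 1)%C by (apply C_eq; simpl; ring). ring. }
  set (I := fun x => cint (fun t => f (p x t) * k t)%C 0 (2 * PI)).
  assert (E : I 1 = I 0).
  { apply small_increments_const. intros e He.
    assert (Ppi := PI_RGT_0).
    (* The interval has length [2 * PI], and [cint_bound] costs another factor 2. *)
    assert (He' : 0 < e / (4 * PI)) by (apply Rdiv_lt_0_compat; lra).
    destruct (closed_disk_uniform_der f f1 Cf Hf Cf1 _ He') as [d [Hd K]].
    (* Halved because the points [p x t] and [p y t] are at distance up to [2 * Rabs (y - x)]. *)
    exists (d / 2). split; [lra|]. intros x y Hx Hy Hxy.
    set (r := fun t => ((f (p y t) - f (p x t) - f1 (p x t) * (p y t - p x t)) * k t)%C).
    assert (Cr : curve_cont r).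
    { unfold r. auto 7 with curves. }
    assert (Eq : I y = (I x + (cint r 0 (2 * PI)
                + RtoC (y - x) * cint (fun t => f1 (p x t) * expi t) 0 (2 * PI)))%C).
    { unfold I. rewrite <- cint_scal.
      2:{ auto with curves. }
      rewrite <- cint_plus, <- cint_plus by auto with curves.
      apply cint_ext. intros t. unfold r.
      replace (p y t - p x t)%C with (RtoC (y - x) * (expi t - z0))%C
        by (unfold p; rewrite RtoC_minus; ring).
      unfold k. field. now apply expi_minus_nz. }
    rewrite Eq, Zero by exact Hx.
    replace (I x + (cint r 0 (2 * PI) + RtoC (y - x) * RtoC 0) - I x)%C
      with (cint r 0 (2 * PI)) by ring.
    eapply Rle_trans; [apply (cint_bound r 0 (2 * PI) (e / (4 * PI) * Rabs (y - x)))|].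
    - lra.
    - exact Cr.
    - intros t. unfold r, k. rewrite !Cmod_mult, Cmod_expi, Cmod_inv by now apply expi_minus_nz.
      assert (N := proj1 (Cmod_gt_0 _) (expi_minus_nz t z0 Hz)).
      set (m := Cmod (expi t - z0)) in *.
      assert (Em : Cmod (p y t - p x t)%C = Rabs (y - x) * m).
      { replace (p y t - p x t)%C with (RtoC (y - x) * (expi t - z0))%C
          by (unfold p; rewrite RtoC_minus; ring). rewrite Cmod_mult, Cmod_R. reflexivity. }
      assert (m <= 2).
      { unfold m. eapply Rle_trans; [apply Cmod_triangle|]. rewrite Cmod_opp, Cmod_expi.
        unfold unit_disk in Hz. lra. }
      assert (B := K (p x t) (p y t) (Dp x t Hx) (Dp y t Hy)).
      rewrite Em in B. assert (Pxy := Rabs_pos (y - x)).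
      specialize (B ltac:(nra)).
      rewrite Rmult_1_l. apply Rmult_le_reg_r with m; [exact N|].
      rewrite (Rmult_assoc (Cmod _) (/ m)), Rinv_l, Rmult_1_r by lra.
      eapply Rle_trans; [apply B|]. lra.
    - right. field. lra. }
  unfold I in E.
  transitivity (cint (fun t => f (p 1 t) * k t)%C 0 (2 * PI)).
  { apply cint_ext. intros t. unfold p. now replace (z0 + RtoC 1 * (expi t - z0))%C with (expi t) by ring. }
  rewrite E, <- (cint_cauchy_kernel (f z0) z0 Hz).
  apply cint_ext. intros t. unfold p. now replace (z0 + RtoC 0 * (expi t - z0))%C with z0 by ring.
Qed.

(** With [b = 1/(q - z)] and [b' = 1/(q - z - h)] one has [b' - b = h b' b]. *)
Lemma inverse_power_remainder (beta : R) (n : nat) : 0 <= beta ->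
  exists K, 0 <= K /\ forall b b' h : C, Cmod b <= beta -> Cmod b' <= beta ->
    (b' - b = h * b' * b)%C ->
    Cmod (b' ^ n - b ^ n - RtoC (INR n) * b ^ (S n) * h)%C <= K * (Cmod h * Cmod h).
Proof.
  intros Pb. induction n as [|n [K [HK IH]]].
  - exists 0. split; [lra|]. intros b b' h _ _ _.
    replace (b' ^ 0 - b ^ 0 - RtoC (INR 0) * b ^ 1 * h)%C with (RtoC 0) by (simpl; ring).
    rewrite Cmod_0. lra.
  - exists (beta * K + (INR n + 1) * (beta * beta ^ (S (S n)))).
    assert (Pn := pos_INR n).
    assert (Q : 0 <= beta ^ (S (S n))) by now apply pow_le.
    split.
    { assert (0 <= beta * K) by now apply Rmult_le_pos.
      assert (0 <= beta * beta ^ S (S n)) by now apply Rmult_le_pos. nra. }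
    intros b b' h Hb Hb' E.
    (* Substituting [b + h b' b] for [b'] in [b' b^n] and in [b' b^(n+1)] gives this recursion for
       the remainder, which dictates the constant above. *)
    replace (b' ^ S n - b ^ S n - RtoC (INR (S n)) * b ^ (S (S n)) * h)%C
      with (b' * (b' ^ n - b ^ n - RtoC (INR n) * b ^ (S n) * h)
            + RtoC (INR n + 1) * (h * h) * (b' * b ^ (S (S n))))%C.
    + eapply Rle_trans; [apply Cmod_triangle|]. rewrite !Cmod_mult, Cmod_R, Cmod_pow.
      rewrite (Rabs_pos_eq (INR n + 1)) by lra.
      specialize (IH b b' h Hb Hb' E).
      assert (H1 := Cmod_ge_0 b). assert (H2 := Cmod_ge_0 b'). assert (H3 := Cmod_ge_0 h).
      set (r := Cmod (b' ^ n - b ^ n - RtoC (INR n) * b ^ (S n) * h)%C) in *.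
      assert (0 <= r) by apply Cmod_ge_0.
      assert (Cmod b ^ S (S n) <= beta ^ S (S n)) by (apply pow_incr; lra).
      assert (0 <= Cmod b ^ S (S n)) by now apply pow_le.
      assert (Cmod b' * r <= beta * (K * (Cmod h * Cmod h))).
      { apply Rmult_le_compat; auto. }
      assert (Cmod b' * Cmod b ^ S (S n) <= beta * beta ^ S (S n)).
      { apply Rmult_le_compat; auto. }
      assert (0 <= Cmod h * Cmod h) by nra.
      assert ((INR n + 1) * (Cmod h * Cmod h) * (Cmod b' * Cmod b ^ S (S n))
              <= (INR n + 1) * (Cmod h * Cmod h) * (beta * beta ^ S (S n))).
      { apply Rmult_le_compat_l; [apply Rmult_le_pos; lra|assumption]. }
      lra.
    + rewrite S_INR, RtoC_plus. simpl.
      assert (E' : b' = (b + h * b' * b)%C) by (rewrite <- E; ring).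
      set (bn := (b ^ n)%C). set (bn' := (b' ^ n)%C).
      replace (b' * bn' - b * bn - (RtoC (INR n) + 1) * (b * (b * bn)) * h)%C
        with (b' * bn' + ((b' - b) - h * b' * b) * (- bn + - RtoC (INR n + 1) * h * (b * bn))
              - b * bn - (RtoC (INR n) + 1) * (b * (b * bn)) * h)%C
        by (rewrite E; ring).
      rewrite RtoC_plus. ring.
Qed.

(** Differentiation in [z] multiplies by [n] and raises the power of the kernel by one, hence the
    parameter [n]. For [n = 1] and [u t = f (expi t) * expi t] this is [2 * PI] times [f]. *)
Definition cauchy_transform (u : R -> C) (n : nat) (z : C) : C :=
  cint (fun t => u t * (/ (expi t - z)) ^ n)%C 0 (2 * PI).

Lemma cauchy_transform_cont u n z : curve_cont u -> unit_disk z ->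
  curve_cont (fun t => u t * (/ (expi t - z)) ^ n)%C.
Proof. auto with curves. Qed.

Lemma cder_cauchy_transform u n z B : curve_cont u -> (forall t, Cmod (u t) <= B) ->
  unit_disk z ->
  cder unit_disk (cauchy_transform u n) z (RtoC (INR n) * cauchy_transform u (S n) z)%C.
Proof.
  intros Hu HB Hz. assert (Hz' := Hz). unfold unit_disk in Hz'.
  (* Half the distance to the circle: points of the disk within [m] of [z] stay at distance at least
     [m] from the circle, so their kernels are bounded by [/ m]. *)
  set (m := (1 - Cmod z) / 2). assert (Pm : 0 < m) by (unfold m; lra).
  assert (P0 : 0 <= / m) by (left; now apply Rinv_0_lt_compat).
  destruct (inverse_power_remainder (/ m) n P0) as [K [HK R]].
  assert (PB : 0 <= B) by (eapply Rle_trans; [apply Cmod_ge_0|apply (HB 0)]).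
  assert (Ppi := PI_RGT_0).
  set (M := 2 * (2 * PI * (B * K)) + 1).
  assert (PM : 0 < M).
  { unfold M. assert (0 <= B * K) by now apply Rmult_le_pos. nra. }
  apply cder_eps. intros e He. exists (Rmin m (e / M)).
  split; [apply Rmin_pos; [lra|]; now apply Rdiv_lt_0_compat|].
  intros w Hw Hwz.
  assert (L1 := Rlt_le_trans _ _ _ Hwz (Rmin_l _ _)).
  assert (L2 := Rlt_le_trans _ _ _ Hwz (Rmin_r _ _)).
  assert (Far : forall t v, Cmod (v - z)%C < m -> unit_disk v -> Cmod (/ (expi t - v))%C <= / m).
  { intros t v Hv Dv. rewrite Cmod_inv by now apply expi_minus_nz.
    apply Rinv_le_contravar; [exact Pm|].
    assert (T1 := Cmod_sub_lower (expi t) v). rewrite Cmod_expi in T1.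
    assert (T2 := Cmod_sub_lower v z). unfold m in *. lra. }
  set (r := fun t => (u t * ((/ (expi t - w)) ^ n - (/ (expi t - z)) ^ n
             - RtoC (INR n) * (/ (expi t - z)) ^ (S n) * (w - z)))%C).
  assert (Eq : (cauchy_transform u n w - cauchy_transform u n z
     - RtoC (INR n) * cauchy_transform u (S n) z * (w - z))%C = cint r 0 (2 * PI)).
  { unfold cauchy_transform.
    replace (cint (fun t => u t * (/ (expi t - w)) ^ n) 0 (2 * PI)
      - cint (fun t => u t * (/ (expi t - z)) ^ n) 0 (2 * PI)
      - RtoC (INR n) * cint (fun t => u t * (/ (expi t - z)) ^ S n) 0 (2 * PI) * (w - z))%C
     with (cint (fun t => u t * (/ (expi t - w)) ^ n) 0 (2 * PI)
      + (- RtoC 1 * cint (fun t => u t * (/ (expi t - z)) ^ n) 0 (2 * PI)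
      + (- (RtoC (INR n) * (w - z))) * cint (fun t => u t * (/ (expi t - z)) ^ S n) 0 (2 * PI)))%C by ring.
    assert (C1 := cauchy_transform_cont u n w Hu Hw).
    assert (C2 := cauchy_transform_cont u n z Hu Hz).
    assert (C3 := cauchy_transform_cont u (S n) z Hu Hz).
    rewrite <- !cint_scal by assumption.
    rewrite <- cint_plus, <- cint_plus by auto with curves.
    apply cint_ext. intros t. unfold r. ring. }
  rewrite Eq.
  eapply Rle_trans; [apply (cint_bound r 0 (2 * PI) (B * (K * (Cmod (w - z)%C * Cmod (w - z)%C))))|].
  - lra.
  - unfold r. auto 8 with curves.
  - intros t. unfold r. rewrite Cmod_mult.
    apply Rmult_le_compat; auto using Cmod_ge_0. apply R.
    + apply Far; auto. rewrite Cmod_diag. exact Pm.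
    + now apply Far.
    + field. split; now apply expi_minus_nz.
  - set (h := Cmod (w - z)%C) in *. assert (Ph : 0 <= h) by apply Cmod_ge_0.
    assert (h * M <= e).
    { apply Rmult_le_reg_r with (/ M); [now apply Rinv_0_lt_compat|].
      rewrite Rmult_assoc, Rinv_r, Rmult_1_r by lra. apply Rlt_le. exact L2. }
    apply Rle_trans with (h * M * h); [|now apply Rmult_le_compat_r].
    unfold M. assert (0 <= h * h) by nra. nra.
Qed.

Lemma holo_cauchy_transform u B k n : curve_cont u -> (forall t, Cmod (u t) <= B) ->
  holo unit_disk k (cauchy_transform u n).
Proof.
  intros Hu HB. revert n. induction k as [|k IH]; intros n.
  - intros z Hz. eapply cder_ccont, cder_cauchy_transform; eauto.
  - exists (fun z => RtoC (INR n) * cauchy_transform u (S n) z)%C. split.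
    + intros. eapply cder_cauchy_transform; eauto.
    + apply holo_mult; [apply holo_const|apply IH].
Qed.

(** Cauchy's formula is applied to [f], one order higher, since for [f1] it would presuppose a
    derivative of [f1]. Uniqueness of the derivative then transfers the order to [f1]. *)
Lemma closed_disk_holo f f1 k :
  (forall p, closed_unit_disk p -> ccont closed_unit_disk f p) ->
  (forall p, unit_disk p -> cder unit_disk f p (f1 p)) ->
  (forall p, closed_unit_disk p -> ccont closed_unit_disk f1 p) ->
  holo unit_disk k f1.
Proof.
  intros Cf Hf Cf1.
  destruct (compact_bounded _ _ compact_closed_disk Cf) as [B [PB HB]].
  set (u := fun t => (f (expi t) * expi t)%C).
  assert (Cu : curve_cont u).
  { apply curve_cont_mult; [|apply curve_cont_expi]. intros t.
    apply (rcont_comp closed_unit_disk); [apply closed_disk_expi| |apply curve_cont_expi].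
    apply Cf, closed_disk_expi. }
  assert (Bu : forall t, Cmod (u t) <= B).
  { intros t. unfold u. rewrite Cmod_mult, Cmod_expi, Rmult_1_r. apply HB, closed_disk_expi. }
  assert (H : holo unit_disk (S k) f).
  { apply holo_ext with (fun z => / RtoC (2 * PI) * cauchy_transform u 1 z)%C.
    - intros z Hz. unfold cauchy_transform, u.
      rewrite (cint_ext _ (fun t => f (expi t) * (expi t * / (expi t - z)))%C).
      + rewrite (cauchy_formula f f1) by assumption. field.
        intros E. apply RtoC_inj in E. generalize PI_RGT_0; lra.
      + intros t. simpl. ring.
    - apply holo_mult; [apply holo_const|]. now apply holo_cauchy_transform with B. }
  destruct H as [g1 [Hg1 H]]. apply holo_ext with g1; [|exact H].
  intros z Hz. apply (cder_unique unit_disk f z); auto. apply open_disk.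
Qed.

(** * Conformal maps of the closed disk *)

Definition Cdir (u : C) : C := (u / RtoC (Cmod u))%C.

Lemma RtoC_Cmod_nz u : u <> RtoC 0 -> RtoC (Cmod u) <> RtoC 0.
Proof. intros H E. apply RtoC_inj in E. apply Cmod_gt_0 in H. lra. Qed.

Lemma Cdir_mult u v : u <> RtoC 0 -> v <> RtoC 0 -> Cdir (u * v)%C = (Cdir u * Cdir v)%C.
Proof.
  intros Hu Hv. unfold Cdir. rewrite Cmod_mult, RtoC_mult. field.
  split; now apply RtoC_Cmod_nz.
Qed.

Lemma Cmod_Cdir u : u <> RtoC 0 -> Cmod (Cdir u) = 1.
Proof.
  intros H. unfold Cdir. rewrite Cmod_div by now apply RtoC_Cmod_nz.
  rewrite Cmod_R, Rabs_pos_eq by apply Cmod_ge_0. field.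
  apply Cmod_gt_0 in H. lra.
Qed.

Lemma carg_bound w : Rabs (carg w) <= PI / 2.
Proof.
  unfold carg. destruct (atan_bound (snd w / fst w)). apply Rabs_le. lra.
Qed.

Lemma near_one_right_half u : Cmod (u - RtoC 1)%C < 1 -> right_half u.
Proof.
  intros H. assert (B := Cmod_fst (u - RtoC 1)%C).
  assert (E : Rabs (fst (u - RtoC 1)%C) < 1) by lra. apply Rabs_def2 in E.
  unfold right_half. simpl in E. lra.
Qed.

(** The argument is lifted along radii: for [n] large the quotient of the values
    at consecutive points [k z / n] lies in the right half plane, and the
    principal logarithms of these quotients add up. *)
Lemma closed_disk_arg g : (forall z, closed_unit_disk z -> ccont closed_unit_disk g z) ->
  (forall z, closed_unit_disk z -> g z <> RtoC 0) -> holo unit_disk 2 g ->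
  exists G : C -> C, holo unit_disk 2 G /\
    (forall z, closed_unit_disk z -> expi (snd (G z)) = Cdir (g z)) /\
    (forall z, closed_unit_disk z -> contC_within closed_unit_disk (fun w => snd (G w)) z) /\
    exists B, forall z, Rabs (snd (G z)) <= B.
Proof.
  intros Cg Ng Hg.
  assert (Ig : forall z, closed_unit_disk z -> ccont closed_unit_disk (fun w => / g w)%C z)
    by (intros; apply ccont_inv; auto).
  destruct (compact_bounded _ _ compact_closed_disk Ig) as [B [PB HB]].
  (* As [/ g] is bounded by [B], increments of [g] below [/ B] put the quotients within 1 of 1. *)
  destruct (uniform_ccont _ _ compact_closed_disk Cg (/ B)) as [d [Hd K]];
    [now apply Rinv_0_lt_compat|].
  destruct (archimed_cor1 d Hd) as [n [Hn Pn]].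
  assert (Qn : 0 < INR n) by now apply lt_0_INR.
  assert (Qi : 0 < / INR n) by now apply Rinv_0_lt_compat.
  set (p := fun (k : nat) (z : C) => (RtoC (INR k * / INR n) * z)%C).
  assert (Bk : forall k, (k <= n)%nat -> 0 <= INR k * / INR n <= 1).
  { intros k Hk. split; [apply Rmult_le_pos; [apply pos_INR|lra]|].
    rewrite <- (Rinv_r (INR n)) by lra. apply Rmult_le_compat_r; [lra|now apply le_INR]. }
  assert (Mp : forall k z, (k <= n)%nat -> Cmod (p k z) <= Cmod z).
  { intros k z Hk. unfold p. specialize (Bk k Hk). rewrite Cmod_mult, Cmod_R, Rabs_pos_eq by lra.
    generalize (Cmod_ge_0 z). nra. }
  assert (Dp : forall k z, (k <= n)%nat -> closed_unit_disk z -> closed_unit_disk (p k z)).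
  { intros k z Hk Dz. eapply Rle_trans; [now apply Mp|exact Dz]. }
  assert (Up : forall k z, (k <= n)%nat -> unit_disk z -> unit_disk (p k z)).
  { intros k z Hk Dz. eapply Rle_lt_trans; [now apply Mp|exact Dz]. }
  set (q := fun k z => (g (p (S k) z) * / g (p k z))%C).
  assert (Hq : forall k z, (k < n)%nat -> closed_unit_disk z -> right_half (q k z)).
  { intros k z Hk Dz. apply near_one_right_half. unfold q.
    assert (D0 := Dp k z ltac:(lia) Dz). assert (D1 := Dp (S k) z ltac:(lia) Dz).
    assert (N := Ng _ D0). assert (PN := proj1 (Cmod_gt_0 _) N).
    replace (g (p (S k) z) * / g (p k z) - RtoC 1)%C
      with ((g (p (S k) z) - g (p k z)) * / g (p k z))%C by (field; auto).
    rewrite Cmod_mult. specialize (HB _ D0).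
    assert (L : Cmod (g (p (S k) z) - g (p k z)) < / B).
    { apply K; auto. unfold p.
      replace (RtoC (INR (S k) * / INR n) * z - RtoC (INR k * / INR n) * z)%C
        with (RtoC (/ INR n) * z)%C.
      - rewrite Cmod_mult, Cmod_R, Rabs_pos_eq by lra. unfold closed_unit_disk in Dz. nra.
      - rewrite S_INR, Rmult_plus_distr_r, Rmult_1_l, RtoC_plus. ring. }
    assert (P1 := Cmod_ge_0 (g (p (S k) z) - g (p k z))%C).
    assert (P2 : 0 < Cmod (/ g (p k z))%C).
    { rewrite Cmod_inv by exact N. now apply Rinv_0_lt_compat. }
    apply Rlt_le_trans with (/ B * Cmod (/ g (p k z))).
    - now apply Rmult_lt_compat_r.
    - rewrite <- (Rinv_l B) by lra. apply Rmult_le_compat_l; [|exact HB].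
      left. now apply Rinv_0_lt_compat. }
  assert (D00 : closed_unit_disk (RtoC 0)) by (unfold closed_unit_disk; rewrite Cmod_0; lra).
  destruct (expi_exists (Cdir (g (RtoC 0)))) as [t0 Ht0]; [now apply Cmod_Cdir, Ng|].
  (* [t0] is an argument of [g] at the centre, where every radius starts; only the imaginary part of
     [G] is prescribed. *)
  set (G := fun k z => ((0, t0) + Csum k (fun j => Log (q j z)))%C).
  assert (Hp : forall k, holo unit_disk 2 (p k)).
  { intros k. apply holo_mult; [apply holo_const|apply holo_id]. }
  exists (G n). repeat split.
  - apply holo_plus; [apply holo_const|]. apply holo_sum. intros j Hj.
    apply (holo_comp unit_disk right_half); [|apply holo_Log|].
    + intros z Dz. apply Hq; auto. now apply disk_closed.
    + apply holo_mult.
      * apply (holo_comp unit_disk unit_disk); auto.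
      * apply holo_inv.
        -- intros z Dz. apply Ng, Dp; [lia|now apply disk_closed].
        -- apply (holo_comp unit_disk unit_disk); auto. intros z Dz. apply Up; [lia|auto].
  - intros z Dz.
    assert (S : forall k, (k <= n)%nat -> expi (snd (G k z)) = Cdir (g (p k z))).
    { induction k as [|k IH]; intros Hk.
      - replace (snd (G 0%nat z)) with t0 by (unfold G; simpl; ring).
        rewrite <- Ht0. do 2 f_equal. unfold p. simpl. rewrite Rmult_0_l. ring.
      - replace (snd (G (S k) z)) with (snd (G k z) + carg (q k z)) by (unfold G; simpl; ring).
        rewrite expi_plus, IH, expi_carg by (try apply Hq; auto; lia).
        change (Cdir (g (p k z)) * Cdir (q k z) = Cdir (g (p (S k) z)))%C.
        rewrite <- Cdir_mult.
        + f_equal. unfold q. field. apply Ng, Dp; [lia|auto].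
        + apply Ng, Dp; [lia|auto].
        + apply right_half_nz, Hq; auto. }
    rewrite (S n (le_n n)). do 2 f_equal. unfold p. rewrite Rinv_r by lra. ring.
  - intros z Dz.
    assert (S : forall k, (k <= n)%nat -> contC_within closed_unit_disk (fun w => snd (G k w)) z).
    { induction k as [|k IH]; intros Hk.
      - exact (contC_const _ (t0 + 0) z).
      - intros e He.
        assert (A : contC_within closed_unit_disk (fun w => snd (G k w) + carg (q k w)) z).
        { assert (Cgp : forall j, (j <= n)%nat -> ccont closed_unit_disk (fun w => g (p j w)) z).
          { intros j Hj. apply (ccont_comp _ closed_unit_disk); auto.
            apply ccont_mult; [apply ccont_const|apply ccont_id]. }
          apply contC_plus; [apply IH; lia|]. apply contC_carg; [now apply Hq|].
          apply ccont_mult; [apply Cgp; lia|]. apply ccont_inv; [|apply Cgp; lia].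
          apply Ng, Dp; [lia|auto]. }
        destruct (A e He) as [dd [Hdd KK]]. exists dd; split; auto. intros w Dw Hw.
        specialize (KK w Dw Hw).
        replace (snd (G (S k) w)) with (snd (G k w) + carg (q k w)) by (unfold G; simpl; ring).
        replace (snd (G (S k) z)) with (snd (G k z) + carg (q k z)) by (unfold G; simpl; ring).
        exact KK. }
    now apply S.
  (* Each [carg] is an arc tangent, so the bound holds off the disk as well. *)
  - exists (Rabs t0 + INR n * (PI / 2)). intros z. generalize n.
    induction n0 as [|k IH].
    + replace (snd (G 0%nat z)) with t0 by (unfold G; simpl; ring). simpl. lra.
    + replace (snd (G (S k) z)) with (snd (G k z) + carg (q k z)) by (unfold G; simpl; ring).
      eapply Rle_trans; [apply Rabs_triang|]. rewrite S_INR.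
      assert (H := carg_bound (q k z)). lra.
Qed.

(** The derivative is relative to the closed disk. That circle and boundary correspond is derived:
    from openness of [Om] in one direction, from the boundary being a simple closed curve in the
    other. *)
Record conformal (Om : C -> Prop) (Phi dPhi Psi : C -> C) : Prop := {
  conf_open : open_set Om;
  conf_image : forall z, closed_unit_disk z -> closure_set Om (Phi z);
  conf_right : forall w, closure_set Om w -> closed_unit_disk (Psi w) /\ Phi (Psi w) = w;
  conf_left : forall z, closed_unit_disk z -> Psi (Phi z) = z;
  conf_cder : forall z, closed_unit_disk z -> cder closed_unit_disk Phi z (dPhi z);
  conf_dcont : forall z, closed_unit_disk z -> ccont closed_unit_disk dPhi z;
  conf_nz : forall z, closed_unit_disk z -> dPhi z <> RtoC 0 }.

Arguments conf_open {Om Phi dPhi Psi}.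
Arguments conf_image {Om Phi dPhi Psi}.
Arguments conf_right {Om Phi dPhi Psi}.
Arguments conf_left {Om Phi dPhi Psi}.
Arguments conf_cder {Om Phi dPhi Psi}.
Arguments conf_dcont {Om Phi dPhi Psi}.
Arguments conf_nz {Om Phi dPhi Psi}.

Lemma closure_of_mem (U : C -> Prop) z : U z -> closure_set U z.
Proof. intros Uz e He. exists z. split; [exact Uz|]. now rewrite Cmod_diag. Qed.

Lemma conformal_inv_cont {Om Phi dPhi Psi} w : conformal Om Phi dPhi Psi ->
  closure_set Om w -> ccont (closure_set Om) Psi w.
Proof.
  intros H Hw e He. destruct (conf_right H w Hw) as [Dw Ew].
  destruct (compact_inverse closed_unit_disk Phi (Psi w) compact_closed_disk) with (e := e)
    as [d [Hd K]]; auto.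
  - intros z Dz. eapply cder_ccont, (conf_cder H z Dz).
  - intros z Dz E. rewrite <- (conf_left H z Dz), E. now rewrite (conf_left H).
  - exists d; split; auto. intros v Hv Hvw.
    destruct (conf_right H v Hv) as [Dv Ev]. apply K; [exact Dv|]. now rewrite Ev, Ew.
Qed.

Lemma conformal_inv_cder {Om Phi dPhi Psi} w : conformal Om Phi dPhi Psi ->
  closure_set Om w -> cder (closure_set Om) Psi w (/ dPhi (Psi w))%C.
Proof.
  intros H Hw. destruct (conf_right H w Hw) as [Dw Ew].
  apply (cder_inverse (closure_set Om) closed_unit_disk Phi Psi).
  - intros v Hv. apply (conf_right H v Hv).
  - intros v Hv. apply (conf_right H v Hv).
  - exact Ew.
  - now apply (conf_nz H).
  - now apply (conformal_inv_cont _ H).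
  - now apply (conf_cder H).
Qed.

Definition Cdot (u v : C) : R := fst (u * Cconj v)%C.

(** A ray from a boundary point that enters the closure of [Om] is mapped by
    [Psi] to a curve that does not leave the closed unit disk. *)
Lemma conformal_ray {Om Phi dPhi Psi} w q : conformal Om Phi dPhi Psi ->
  closure_set Om w -> Cmod (Psi w) = 1 ->
  (exists e, 0 < e /\ forall t, 0 < t < e -> closure_set Om (w + RtoC t * q)%C) ->
  Cdot (/ dPhi (Psi w) * q)%C (Psi w) <= 0.
Proof.
  intros H Hw H1 [e [He Hray]]. apply Rnot_lt_le. intros P.
  assert (D := conformal_inv_cder w H Hw).
  set (z := Psi w) in *. set (v := (/ dPhi z * q)%C) in *. set (A := Cdot v z) in *.
  assert (Pq := Cmod_ge_0 q).
  (* With this precision the remainder along the ray is at most [A * t / 2], so the component of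
     [Psi] along [z] would be at least [1 + A * t / 2]. The summand 1 keeps the denominator
     positive. *)
  rewrite cder_eps in D. destruct (D (A / (2 * (1 + Cmod q)))) as [d [Hd K]].
  { apply Rdiv_lt_0_compat; lra. }
  set (t := Rmin (e / 2) (d / (2 * (1 + Cmod q)))).
  assert (Pt : 0 < t) by (apply Rmin_pos; [lra|apply Rdiv_lt_0_compat; lra]).
  assert (t <= e / 2) by apply Rmin_l.
  assert (T2 : t <= d / (2 * (1 + Cmod q))) by apply Rmin_r.
  assert (T3 : t * (1 + Cmod q) <= d / 2).
  { replace (d / 2) with (d / (2 * (1 + Cmod q)) * (1 + Cmod q)) by (field; lra).
    apply Rmult_le_compat_r; lra. }
  assert (Hx : closure_set Om (w + RtoC t * q)%C) by (apply Hray; lra).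
  specialize (K _ Hx). fold z in K.
  replace (w + RtoC t * q - w)%C with (RtoC t * q)%C in K by ring.
  rewrite Cmod_mult, Cmod_R, Rabs_pos_eq in K by lra.
  specialize (K ltac:(nra)).
  set (r := (Psi (w + RtoC t * q) - z - / dPhi z * (RtoC t * q))%C) in *.
  assert (Hr : Cmod r <= A * t / 2).
  { eapply Rle_trans; [apply K|].
    replace (A * t / 2) with (A / (2 * (1 + Cmod q)) * (t * (1 + Cmod q))) by (field; lra).
    apply Rmult_le_compat_l; [apply Rlt_le, Rdiv_lt_0_compat; lra|nra]. }
  assert (E : Psi (w + RtoC t * q)%C = (z + RtoC t * v + r)%C) by (unfold r, v; ring).
  assert (L := proj1 (conf_right H _ Hx)). unfold closed_unit_disk in L.
  assert (B : Cdot (Psi (w + RtoC t * q)%C) z <= 1).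
  { unfold Cdot. eapply Rle_trans; [apply Rle_abs|]. eapply Rle_trans; [apply Cmod_fst|].
    rewrite Cmod_mult, Cmod_conj, H1. lra. }
  assert (Br : Rabs (Cdot r z) <= Cmod r).
  { unfold Cdot. eapply Rle_trans; [apply Cmod_fst|]. rewrite Cmod_mult, Cmod_conj, H1. lra. }
  assert (Sz : Cdot z z = 1).
  { unfold Cdot. rewrite <- Cmod2_conj, H1. simpl. ring. }
  assert (Lin : Cdot (z + RtoC t * v + r)%C z = Cdot z z + t * A + Cdot r z).
  { unfold A, Cdot. simpl. ring. }
  rewrite E, Lin, Sz in B. apply Rabs_le_between in Br. nra.
Qed.

(** Were [Phi z] in the open set [Om], the ray in direction [dPhi z * z] would start inside it, but
    [Psi] maps that direction to the outward radius at [z]. *)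
Lemma conformal_circle_boundary {Om Phi dPhi Psi} z : conformal Om Phi dPhi Psi ->
  Cmod z = 1 -> ~ Om (Phi z).
Proof.
  intros H Hz Hin. assert (Dz : closed_unit_disk z) by (unfold closed_unit_disk; lra).
  assert (R := conformal_ray (Phi z) (dPhi z * z)%C H (closure_of_mem _ _ Hin)).
  rewrite (conf_left H z Dz) in R. specialize (R Hz).
  assert (N := conf_nz H z Dz).
  assert (E : Cdot (/ dPhi z * (dPhi z * z))%C z = 1).
  { replace (/ dPhi z * (dPhi z * z))%C with z by (field; auto).
    unfold Cdot. rewrite <- Cmod2_conj, Hz. simpl. ring. }
  rewrite E in R. enough (1 <= 0) by lra. apply R.
  destruct (conf_open H _ Hin) as [r [Hr K]].
  set (m := Cmod (dPhi z * z)%C). assert (0 <= m) by apply Cmod_ge_0.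
  exists (r / (1 + m)). split; [apply Rdiv_lt_0_compat; lra|].
  intros t [Ht1 Ht2]. apply closure_of_mem, K.
  replace (Phi z + RtoC t * (dPhi z * z) - Phi z)%C with (RtoC t * (dPhi z * z))%C by ring.
  rewrite Cmod_mult, Cmod_R, Rabs_pos_eq by lra. fold m.
  assert (t * (1 + m) < r).
  { replace r with (r / (1 + m) * (1 + m)) at 1 by (field; lra).
    apply Rmult_lt_compat_r; lra. }
  nra.
Qed.

Lemma conformal_inner {Om Phi dPhi Psi} w : conformal Om Phi dPhi Psi -> Om w -> unit_disk (Psi w).
Proof.
  intros H Hw. destruct (conf_right H w (closure_of_mem _ _ Hw)) as [D E].
  unfold closed_unit_disk in D. unfold unit_disk.
  destruct D as [D|D]; [exact D|]. exfalso.
  apply (conformal_circle_boundary _ H D). now rewrite E.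
Qed.

(** * The boundary curve *)

Lemma expi_inj a b : expi a = expi b -> exists k : Z, a = b + 2 * PI * IZR k.
Proof.
  intros E. assert (H : expi (a - b) = RtoC 1).
  { unfold Rminus. now rewrite expi_plus, E, <- expi_plus, Rplus_opp_r, expi_0. }
  assert (Hc : cos (a - b) = 1) by (apply (f_equal fst) in H; exact H).
  replace (a - b) with (2 * ((a - b) / 2)) in Hc by field.
  rewrite cos_2a_sin in Hc.
  assert (Hs : sin ((a - b) / 2) = 0) by nra.
  destruct (sin_eq_0_0 _ Hs) as [k Hk]. exists k. lra.
Qed.

Lemma rder_zero_const c : (forall s, rder c s (RtoC 0)) -> forall a b, c a = c b.
Proof.
  intros H.
  assert (Q : forall a b, a < b -> c a = c b).
  { intros a b L. apply C_eq.
    - apply (eq_is_derive (V := R_NormedModule) (fun s => fst (c s)) a b); auto.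
      intros t _. apply (proj1 (rder_parts c t _) (H t)).
    - apply (eq_is_derive (V := R_NormedModule) (fun s => snd (c s)) a b); auto.
      intros t _. apply (proj1 (rder_parts c t _) (H t)). }
  intros a b. destruct (Rtotal_order a b) as [L|[->|L]]; auto. symmetry. auto.
Qed.

Lemma is_derive_cont (f : R -> R) s l : is_derive f s l -> continuity_pt f s.
Proof.
  intros H. apply continuity_pt_filterlim.
  apply (ex_derive_continuous (V := R_NormedModule) f). now exists l.
Qed.

Lemma derive_pos_increasing (f f' : R -> R) :
  (forall s, is_derive f s (f' s)) -> (forall s, 0 < f' s) ->
  forall s t, s < t -> f s < f t.
Proof.
  intros H P s t L.
  destruct (MVT_gen f s t f') as [x [_ E]].
  - intros; apply H.
  - intros. eapply is_derive_cont, H.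
  - specialize (P x). nra.
Qed.

Lemma arc_param_rder {Om L gamma dgamma} s : arc_param Om L gamma dgamma -> rder gamma s (dgamma s).
Proof. intros H. apply rder_parts. apply H. Qed.

Lemma arc_param_closure {Om L gamma dgamma} s : arc_param Om L gamma dgamma ->
  closure_set Om (gamma s).
Proof. intros (_ & _ & _ & _ & _ & _ & H & _). apply H. eauto. Qed.

Lemma arc_param_period {Om L gamma dgamma} k s : arc_param Om L gamma dgamma ->
  gamma (s + IZR k * L) = gamma s.
Proof.
  intros (_ & H & _).
  assert (P : forall n s, gamma (s + INR n * L) = gamma s).
  { induction n as [|n IH]; intros u.
    - simpl. now rewrite Rmult_0_l, Rplus_0_r.
    - rewrite S_INR. replace (u + (INR n + 1) * L) with (u + INR n * L + L) by ring.
      now rewrite H. }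
  destruct (Z_le_gt_dec 0 k) as [Hk|Hk].
  - rewrite <- (Z2Nat.id k Hk), <- INR_IZR_INZ. apply P.
  - rewrite <- (P (Z.to_nat (- k)) (s + IZR k * L)). f_equal.
    rewrite INR_IZR_INZ, Z2Nat.id, opp_IZR by lia. ring.
Qed.

Lemma reduce_mod (L s0 s : R) : 0 < L -> exists k : Z, s0 <= s + IZR k * L < s0 + L.
Proof.
  intros HL. destruct (archimed ((s - s0) / L)) as [A B].
  set (j := up ((s - s0) / L)) in *. exists (1 - j)%Z. rewrite minus_IZR.
  assert (A' : s - s0 < IZR j * L).
  { replace (s - s0) with ((s - s0) / L * L) by (field; lra). apply Rmult_lt_compat_r; lra. }
  assert (B' : IZR j * L <= s - s0 + L).
  { replace (s - s0 + L) with (((s - s0) / L + 1) * L) by (field; lra).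
    apply Rmult_le_compat_r; lra. }
  lra.
Qed.

Lemma arc_param_inj {Om L gamma dgamma} s0 s t : arc_param Om L gamma dgamma ->
  s0 <= s < s0 + L -> s0 <= t < s0 + L -> gamma s = gamma t -> s = t.
Proof.
  intros H Hs Ht E. assert (PL : 0 < L) by apply H.
  destruct (reduce_mod L 0 s PL) as [k Hk]. destruct (reduce_mod L 0 t PL) as [j Hj].
  assert (Q : s + IZR k * L = t + IZR j * L).
  { apply (proj1 (proj2 (proj2 H))); try lra.
    rewrite !(arc_param_period _ _ H). exact E. }
  assert (D : s - t = IZR (j - k) * L) by (rewrite minus_IZR; lra).
  assert (J : (j - k = 0)%Z).
  { assert (- L < IZR (j - k) * L < L) by lra.
    assert (IZR (j - k) < 1) by nra. assert (-1 < IZR (j - k)) by nra.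
    apply lt_IZR in H1. apply lt_IZR in H2. lia. }
  rewrite J in D. lra.
Qed.

Lemma arc_param_reduce {Om L gamma dgamma} s0 s : arc_param Om L gamma dgamma ->
  exists t, s0 <= t < s0 + L /\ gamma t = gamma s.
Proof.
  intros H. destruct (reduce_mod L s0 s) as [k Hk]; [apply H|].
  exists (s + IZR k * L). split; [exact Hk|]. apply (arc_param_period _ _ H).
Qed.

Lemma conformal_circle_param {Om Phi dPhi Psi L gamma dgamma} s0 z :
  conformal Om Phi dPhi Psi -> arc_param Om L gamma dgamma -> Cmod z = 1 ->
  exists s, s0 <= s < s0 + L /\ gamma s = Phi z.
Proof.
  intros H A Hz. assert (B : boundary_set Om (Phi z)).
  { split.
    - apply (conf_image H). unfold closed_unit_disk; lra.
    - now apply (conformal_circle_boundary _ H). }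
  assert (A7 := A). destruct A7 as (_ & _ & _ & _ & _ & _ & A7 & _).
  destruct (proj1 (A7 _) B) as [s <-].
  apply (arc_param_reduce _ _ A).
Qed.

Lemma compact_segment a b : compact_set (fun z : C => snd z = 0 /\ a <= fst z <= b).
Proof.
  split.
  - exists (Rabs a + Rabs b). intros z [Hz1 Hz2].
    eapply Rle_trans; [apply Cmod_le_parts|]. rewrite Hz1, Rabs_R0, Rplus_0_r.
    unfold Rabs; repeat destruct Rcase_abs; lra.
  - intros z Hz.
    assert (K : exists r, 0 < r /\ forall w : C,
      Rabs (fst w - fst z) < r -> Rabs (snd w - snd z) < r -> ~ (snd w = 0 /\ a <= fst w <= b)).
    { destruct (Req_dec (snd z) 0) as [E|N].
      - destruct (Rlt_dec (fst z) a).
        + exists (a - fst z). split; [lra|]. intros w H1 _ [_ H2]. apply Rabs_def2 in H1. lra.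
        + destruct (Rlt_dec b (fst z)).
          * exists (fst z - b). split; [lra|]. intros w H1 _ [_ H2]. apply Rabs_def2 in H1. lra.
          * exfalso. apply Hz. split; lra.
      - exists (Rabs (snd z)). split; [now apply Rabs_pos_lt|]. intros w _ H1 [H2 _].
        rewrite H2, Rminus_0_l, Rabs_Ropp in H1. lra. }
    destruct K as [r [Hr K]]. exists r; split; auto. intros w Hw.
    apply K; (eapply Rle_lt_trans; [|apply Hw]).
    + apply (Cmod_fst (w - z)%C).
    + apply (Cmod_snd (w - z)%C).
Qed.

(** If the boundary curve met [Phi] of the open disk at [gamma s0], the circle
    would embed continuously in the open arc of parameters [(s0, s0 + L)], which
    the intermediate value theorem excludes by comparing antipodal points. *)
Lemma conformal_boundary_circle {Om Phi dPhi Psi L gamma dgamma} s :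
  conformal Om Phi dPhi Psi -> arc_param Om L gamma dgamma -> Cmod (Psi (gamma s)) = 1.
Proof.
  intros H A. assert (Hc := arc_param_closure s A).
  destruct (conf_right H _ Hc) as [D E].
  destruct D as [D|D]; [|exact D]. exfalso.
  assert (PL : 0 < L) by apply A.
  (* The parameter [s] itself is excluded because [Psi (gamma s)] is inside the disk; the circle
     therefore uses only the open interval, where the parameter cannot wrap around. *)
  assert (X : forall t, {x : R | s < x < s + L /\ gamma x = Phi (expi t)}).
  { intros t. apply constructive_indefinite_description.
    destruct (conformal_circle_param s (expi t) H A (Cmod_expi t))
      as [x [Hx Ex]].
    exists x. split; [|exact Ex]. destruct Hx as [[Hx|Hx] Hx']; [lra|].
    subst x. rewrite Ex, (conf_left H) in D by apply closed_disk_expi.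
    rewrite Cmod_expi in D. lra. }
  set (tau := fun t => proj1_sig (X t)).
  assert (T : forall t, s < tau t < s + L /\ gamma (tau t) = Phi (expi t))
    by (intros t; exact (proj2_sig (X t))).
  assert (Ctau : forall t, continuity_pt tau t).
  { intros t0. apply continuity_pt_eps. intros e He.
    destruct (T t0) as [B0 E0].
    destruct (compact_inverse (fun z : C => snd z = 0 /\ s <= fst z <= s + L)
      (fun z => gamma (fst z)) (RtoC (tau t0)) (compact_segment s (s + L))) with (e := e)
      as [d [Hd K]]; auto.
    - intros z [Hz1 Hz2]. replace z with (RtoC (fst z)) by (apply C_eq; simpl; auto).
      apply ccont_mono with Rline; [now intros w [Hw _]|].
      apply (rder_rcont gamma (fst z) (dgamma (fst z))). now apply (arc_param_rder _ A).
    - intros z [Hz1 Hz2] Eg. simpl in Eg. apply C_eq; [|exact Hz1]. simpl.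
      destruct (Rlt_dec (fst z) (s + L)).
      + apply (arc_param_inj s _ _ A); auto; lra.
      (* The end [s + L] has the same image as [s], which is not a value of [tau]. *)
      + exfalso. assert (fst z = s + L) by lra. rewrite H0 in Eg.
        rewrite (proj1 (proj2 A)) in Eg.
        assert (s = tau t0) by (apply (arc_param_inj s _ _ A); auto; lra). lra.
    - assert (CP : rcont (fun t => Phi (expi t)) t0).
      { apply (rcont_comp closed_unit_disk); [apply closed_disk_expi| |apply curve_cont_expi].
        eapply cder_ccont, (conf_cder H), closed_disk_expi. }
      apply rcont_eps with (eps := d) in CP; [|exact Hd].
      destruct CP as [r [Hr Kr]]. exists r; split; auto. intros t Ht.
      destruct (T t) as [B1 E1]. specialize (Kr t Ht). rewrite <- E1, <- E0 in Kr.
      specialize (K (RtoC (tau t))). simpl in K.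
      rewrite <- RtoC_minus, Cmod_R in K. apply K; auto. lra. }
  set (k := fun t => tau t - tau (t + PI)).
  assert (Ck : continuity k).
  { intros t. apply continuity_pt_minus; [apply Ctau|].
    apply (continuity_pt_comp (fun t => t + PI) tau); [|apply Ctau].
    apply derivable_continuous_pt. apply derivable_pt_plus; [apply derivable_pt_id|apply derivable_pt_const]. }
  assert (P2 : tau (PI + PI) = tau 0).
  { destruct (T (PI + PI)) as [B1 E1], (T 0) as [B0 E0].
    apply (arc_param_inj s _ _ A); auto; try lra.
    rewrite E1, E0. f_equal. replace (PI + PI) with (2 * PI) by ring.
    now rewrite expi_2PI, expi_0. }
  destruct (IVT_gen k 0 PI 0 Ck) as [t [_ Et]].
  { unfold k. rewrite P2, Rplus_0_l. unfold Rmin, Rmax; repeat destruct Rle_dec; lra. }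
  assert (Q : expi t = expi (t + PI)).
  { rewrite <- (conf_left H (expi t)) by apply closed_disk_expi.
    rewrite <- (conf_left H (expi (t + PI))) by apply closed_disk_expi.
    rewrite <- (proj2 (T t)), <- (proj2 (T (t + PI))). do 2 f_equal. unfold k in Et. lra. }
  apply (expi_nz t). unfold expi in *. rewrite neg_cos, neg_sin in Q.
  injection Q. intros. apply C_eq; simpl; lra.
Qed.

Lemma conformal_boundary_der {Om Phi dPhi Psi L gamma dgamma} s :
  conformal Om Phi dPhi Psi -> arc_param Om L gamma dgamma ->
  rder (fun t => Psi (gamma t)) s (/ dPhi (Psi (gamma s)) * dgamma s)%C.
Proof.
  intros H A. apply (rder_comp (closure_set Om)).
  - intros t. now apply (arc_param_closure _ A).
  - apply (conformal_inv_cder _ H), (arc_param_closure _ A).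
  - now apply (arc_param_rder _ A).
Qed.

(** The velocity of [Psi (gamma t)] is orthogonal to its position because the curve stays on the
    circle. The inner normal [Ci * dgamma s] enters [Om], so its image, [Ci] times the velocity,
    cannot point out of the disk; this fixes the sign. The modulus follows from
    [Cmod (dgamma s) = 1]. *)
Lemma conformal_boundary_speed {Om Phi dPhi Psi L gamma dgamma} s :
  conformal Om Phi dPhi Psi -> arc_param Om L gamma dgamma ->
  (/ dPhi (Psi (gamma s)) * dgamma s)%C
  = (Ci * Psi (gamma s) * RtoC (/ Cmod (dPhi (Psi (gamma s)))))%C.
Proof.
  intros H A. assert (Z1 : forall s, Cmod (Psi (gamma s)) = 1)
    by (intros; eapply conformal_boundary_circle; eauto).
  assert (Hc := arc_param_closure s A).
  destruct (conf_right H _ Hc) as [D E].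
  assert (N := conf_nz H _ D).
  assert (R := conformal_boundary_der s H A).
  set (zeta := fun t => Psi (gamma t)) in *.
  change (Psi (gamma s)) with (zeta s) in *.
  set (v := (/ dPhi (zeta s) * dgamma s)%C) in *.
  assert (O : Cdot v (zeta s) = 0).
  { apply rder_parts in R. destruct R as [R1 R2].
    assert (Q : is_derive (fun t => fst (zeta t) * fst (zeta t) + snd (zeta t) * snd (zeta t)) s
       (fst v * fst (zeta s) + fst (zeta s) * fst v + (snd v * snd (zeta s) + snd (zeta s) * snd v))).
    { apply (is_derive_plus (V := R_NormedModule) (fun t => fst (zeta t) * fst (zeta t))
        (fun t => snd (zeta t) * snd (zeta t))).
      - apply (is_derive_mult (fun t => fst (zeta t)) (fun t => fst (zeta t))); auto.
        intros; apply Rmult_comm.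
      - apply (is_derive_mult (fun t => snd (zeta t)) (fun t => snd (zeta t))); auto.
        intros; apply Rmult_comm. }
    apply is_derive_unique in Q.
    rewrite (Derive_ext _ (fun _ => 1)) in Q.
    - rewrite Derive_const in Q. clearbody v. unfold Cdot. simpl. lra.
    - intros t. rewrite <- Cmod_sqr. unfold zeta. rewrite Z1. ring. }
  assert (Ray : Cdot (/ dPhi (zeta s) * (Ci * dgamma s))%C (zeta s) <= 0).
  { apply (conformal_ray (gamma s) _ H); auto.
    destruct A as (_ & _ & _ & _ & _ & _ & _ & A8).
    destruct (A8 s) as [e [He K]]. exists e; split; auto. intros t Ht. apply closure_of_mem, K, Ht. }
  set (p := snd (v * Cconj (zeta s))%C).
  assert (Pp : 0 <= p).
  { replace (/ dPhi (zeta s) * (Ci * dgamma s))%C with (Ci * v)%C in Ray by (unfold v; ring).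
    replace (Cdot (Ci * v)%C (zeta s)) with (- p) in Ray; [lra|].
    unfold p, Cdot. clearbody v. simpl. ring. }
  assert (Ev : v = (Ci * zeta s * RtoC p)%C).
  { replace v with (v * Cconj (zeta s) * zeta s)%C.
    - replace (v * Cconj (zeta s))%C with (Ci * RtoC p)%C; [ring|].
      apply C_eq.
      + transitivity 0; [simpl; ring|]. symmetry. exact O.
      + transitivity p; [simpl; ring|]. reflexivity.
    - replace (v * Cconj (zeta s) * zeta s)%C with (v * (zeta s * Cconj (zeta s)))%C by ring.
      assert (Z2 : Cmod (zeta s) = 1) by apply Z1.
      rewrite <- Cmod2_conj, Z2. simpl. rewrite !Rmult_1_r. ring. }
  assert (Mv : Cmod v = p).
  { rewrite Ev, !Cmod_mult, Cmod_Ci, Cmod_R, Rabs_pos_eq by exact Pp.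
    assert (Z2 : Cmod (zeta s) = 1) by apply Z1. rewrite Z2. ring. }
  assert (Mv' : Cmod v = / Cmod (dPhi (zeta s))).
  { unfold v. rewrite Cmod_mult, Cmod_inv by exact N.
    rewrite (proj1 (proj2 (proj2 (proj2 (proj2 A))))). ring. }
  rewrite <- Mv', Mv. exact Ev.
Qed.

(** The angle is the integral of the positive speed found above; its derivative and monotonicity are
    then available without choosing branches. *)
Lemma conformal_arc_angle {Om Phi dPhi Psi L gamma dgamma} :
  conformal Om Phi dPhi Psi -> arc_param Om L gamma dgamma ->
  exists sigma : R -> R,
    (forall s, Psi (gamma s) = expi (sigma s)) /\
    (forall s, is_derive sigma s (/ Cmod (dPhi (expi (sigma s))))) /\
    (forall s, sigma (s + L) = sigma s + 2 * PI) /\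
    (forall s, dgamma s = (Ci * expi (sigma s) * Cdir (dPhi (expi (sigma s))))%C).
Proof.
  intros H A. assert (PL : 0 < L) by apply A.
  assert (Z1 : forall s, Cmod (Psi (gamma s)) = 1)
    by (intros; eapply conformal_boundary_circle; eauto).
  set (zeta := fun t => Psi (gamma t)).
  assert (Dz : forall s, closed_unit_disk (zeta s)) by (intros; right; apply Z1).
  assert (Nz : forall s, dPhi (zeta s) <> RtoC 0) by (intros; apply (conf_nz H); auto).
  set (p := fun s => / Cmod (dPhi (zeta s))).
  assert (Pp : forall s, 0 < p s) by (intros; apply Rinv_0_lt_compat, Cmod_gt_0, Nz).
  assert (Rz : forall s, rder zeta s (Ci * zeta s * RtoC (p s))%C).
  { intros s. unfold p, zeta.
    rewrite <- (conformal_boundary_speed s H A).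
    apply (conformal_boundary_der s H A). }
  assert (Cp : forall s, continuous p s).
  { intros s. apply continuity_continuous.
    apply (rcont_parts (fun t => RtoC (p t))).
    assert (Cd : rcont (fun t => dPhi (zeta t)) s).
    { apply (rcont_comp closed_unit_disk); auto.
      - now apply (conf_dcont H).
      - eapply rder_rcont, Rz. }
    apply (ccont_RtoC Rline (fun z => p (fst z))).
    apply contC_inv; [apply Rgt_not_eq, Cmod_gt_0, Nz|]. now apply contC_Cmod. }
  destruct (expi_exists (zeta 0) (Z1 0)) as [t0 Ht0].
  set (sigma := fun s => t0 + RInt p 0 s).
  assert (Ds : forall s, is_derive sigma s (p s)).
  { intros s. replace (p s) with (0 + p s) by ring.
    apply (is_derive_plus (V := R_NormedModule) (fun _ => t0) (fun s => RInt p 0 s)).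
    - apply @is_derive_const.
    - apply (is_derive_RInt (V := R_NormedModule) p (fun s => RInt p 0 s) 0 s); [|apply Cp].
      apply filter_forall. intros x. apply (RInt_correct (V := R_CompleteNormedModule)).
      apply (ex_RInt_continuous (V := R_CompleteNormedModule)). intros; apply Cp. }
  assert (Ez : forall s, zeta s = expi (sigma s)).
  { assert (K : forall a b, (zeta a * expi (- sigma a))%C = (zeta b * expi (- sigma b))%C).
    { apply (rder_zero_const (fun s => zeta s * expi (- sigma s))%C). intros s.
      assert (R : rder (fun s => expi (- sigma s)) s (Ci * expi (- sigma s) * RtoC (- p s))%C).
      { apply (rder_expi_comp (fun s => - sigma s)). apply (is_derive_opp sigma). apply Ds. }
      replace (RtoC 0) with (Ci * zeta s * RtoC (p s) * expi (- sigma s)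
         + zeta s * (Ci * expi (- sigma s) * RtoC (- p s)))%C by (rewrite RtoC_opp; ring).
      apply (cder_mult Rline (fun z => zeta (fst z)) (fun z => expi (- sigma (fst z)))).
      - apply Rz.
      - exact R. }
    intros s. specialize (K s 0).
    assert (E0 : sigma 0 = t0) by (unfold sigma; rewrite RInt_point; unfold zero; simpl; ring).
    rewrite E0, Ht0, expi_opp in K.
    replace (zeta s) with (zeta s * (expi (sigma s) * expi (- sigma s)))%C by (rewrite expi_opp; ring).
    replace (zeta s * (expi (sigma s) * expi (- sigma s)))%C
      with (zeta s * expi (- sigma s) * expi (sigma s))%C by ring.
    rewrite K. ring. }
  assert (Per : forall s, zeta (s + L) = zeta s).
  { intros s. unfold zeta. f_equal. apply A. }
  assert (Inc := derive_pos_increasing sigma p Ds Pp).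
  assert (Cst : forall s, sigma (s + L) = sigma s + (sigma L - sigma 0)).
  { assert (K : forall a b, RtoC (sigma (a + L) - sigma a) = RtoC (sigma (b + L) - sigma b)).
    { apply (rder_zero_const (fun s => RtoC (sigma (s + L) - sigma s))). intros s.
      apply (rder_RtoC (fun s => sigma (s + L) - sigma s)).
      replace 0 with (1 * p (s + L) - p s) by (unfold p; rewrite Per; ring).
      apply (is_derive_minus (V := R_NormedModule) (fun s => sigma (s + L)) sigma); [|apply Ds].
      apply (is_derive_comp (V := R_NormedModule) sigma (fun s => s + L)); [apply Ds|].
      replace 1 with (1 + 0) by ring.
      apply (is_derive_plus (V := R_NormedModule) (fun s => s) (fun _ => L));
        [apply @is_derive_id|apply @is_derive_const]. }
    intros s. specialize (K s 0). apply RtoC_inj in K. rewrite Rplus_0_l in K. lra. }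
  (* The increment is a positive multiple of [2 * PI]. With two turns or more, [sigma] would reach
     [sigma 0 + 2 * PI] before [L], and [gamma] would come back to [gamma 0] too early. *)
  assert (T : sigma L - sigma 0 = 2 * PI).
  { assert (E : expi (sigma L) = expi (sigma 0)).
    { rewrite <- !Ez. rewrite <- (Per 0), Rplus_0_l. reflexivity. }
    destruct (expi_inj _ _ E) as [k Hk]. assert (L0 := Inc 0 L PL). assert (Ppi := PI_RGT_0).
    assert (Pk : (0 < k)%Z) by (apply lt_IZR; nra).
    destruct (Z.eq_dec k 1) as [->|Nk]; [lra|]. exfalso.
    assert (K2 : 2 <= IZR k) by (apply IZR_le; lia).
    destruct (IVT_gen sigma 0 L (sigma 0 + 2 * PI)) as [x [Hx Ex]].
    - intros s. eapply is_derive_cont, Ds.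
    - unfold Rmin, Rmax; destruct Rle_dec; nra.
    - rewrite Rmin_left, Rmax_right in Hx by lra.
      assert (Lx : x < L).
      { destruct Hx as [_ [Hx|Hx]]; [exact Hx|]. subst x. nra. }
      assert (x = 0); [|subst x; lra].
      apply (arc_param_inj 0 _ _ A); auto; try lra.
      rewrite <- (proj2 (conf_right H _ (arc_param_closure x A))).
      rewrite <- (proj2 (conf_right H _ (arc_param_closure 0 A))).
      f_equal. change (zeta x = zeta 0). rewrite !Ez, Ex, expi_plus, expi_2PI. ring. }
  exists sigma. split; [|split; [|split]].
  - exact Ez.
  - intros s. rewrite <- Ez. apply Ds.
  - intros s. rewrite Cst, T. reflexivity.
  - intros s. assert (V := conformal_boundary_speed s H A).
    change (Psi (gamma s)) with (zeta s) in V. rewrite <- Ez.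
    replace (dgamma s) with (dPhi (zeta s) * (/ dPhi (zeta s) * dgamma s))%C by (field; apply Nz).
    rewrite V. unfold Cdir, Cdiv. rewrite <- RtoC_inv by (apply Rgt_not_eq, Cmod_gt_0, Nz). ring.
Qed.

(** * Vortices on the circle *)

(** [1 - e^(ix)] equals [2 sin (x/2) e^(i (x - PI)/2)], and the sine is positive here. *)
Lemma carg_circle_pos x : 0 < x < 2 * PI -> carg (RtoC 1 - expi x)%C = (x - PI) / 2.
Proof.
  intros Hx. unfold carg. rewrite <- (atan_tan ((x - PI) / 2)) by lra. f_equal.
  assert (S : 0 < sin (x / 2)) by (apply sin_gt_0; lra).
  replace ((x - PI) / 2) with (- (PI / 2 - x / 2)) by field.
  unfold tan. rewrite sin_neg, cos_neg, sin_shift, cos_shift.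
  simpl. replace x with (2 * (x / 2)) at 1 2 by field.
  rewrite cos_2a_sin, sin_2a. field. repeat split; nra.
Qed.

Lemma carg_circle_neg x : - (2 * PI) < x < 0 -> carg (RtoC 1 - expi x)%C = (x + PI) / 2.
Proof.
  intros Hx. replace (expi x) with (expi (x + 2 * PI)).
  - rewrite carg_circle_pos by lra. field.
  - rewrite expi_plus, expi_2PI. ring.
Qed.

Lemma is_RInt_const_derive (F g g' : R -> R) a b c : a <= b ->
  (forall s, a < s < b -> F s = c) ->
  (forall s, is_derive g s (g' s)) -> (forall s, continuous g' s) ->
  is_RInt (fun s => F s * g' s) a b (c * (g b - g a)).
Proof.
  intros Hab HF Hg Cg.
  apply (is_RInt_ext (V := R_NormedModule) (fun s => scal c (g' s))).
  - rewrite Rmin_left, Rmax_right by lra. intros s Hs. now rewrite HF.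
  - apply (is_RInt_scal (V := R_NormedModule) g' a b c (g b - g a)).
    apply (is_RInt_derive (V := R_CompleteNormedModule) g g'); auto.
Qed.

(** Holds both for arc length on the circle and for the angle of [Psi (gamma s)], so the jump
    computations serve both halves of the theorem. *)
Definition angle_lift (sigma : R -> R) (L : R) : Prop :=
  0 < L /\ (forall s t, s < t -> sigma s < sigma t) /\ sigma L = sigma 0 + 2 * PI.

(** Without half the polar angle, the argument of a vortex factor is a step: one value before [x],
    and [PI] less after it. *)
Lemma step_left sigma L x s : angle_lift sigma L -> 0 <= x < L -> 0 <= s < x ->
  carg (RtoC 1 - expi (sigma s - sigma x))%C - sigma s / 2 = (PI - sigma x) / 2.
Proof.
  intros [PL [Inc Per]] Hx Hs.
  assert (sigma s < sigma x) by (apply Inc; lra).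
  assert (sigma x < sigma L) by (apply Inc; lra).
  assert (sigma 0 <= sigma s) by (destruct (Req_dec s 0); [subst; lra|left; apply Inc; lra]).
  rewrite carg_circle_neg by lra. field.
Qed.

(** The disjunction excludes [x = 0] with [s = L], where the angle is back at the vortex. *)
Lemma step_right sigma L x s : angle_lift sigma L -> 0 <= x < L -> x < s <= L -> 0 < x \/ s < L ->
  carg (RtoC 1 - expi (sigma s - sigma x))%C - sigma s / 2 = (- PI - sigma x) / 2.
Proof.
  intros [PL [Inc Per]] Hx Hs Hor.
  assert (sigma x < sigma s) by (apply Inc; lra).
  assert (sigma s < sigma x + 2 * PI).
  { destruct Hor as [H1|H1].
    - assert (sigma 0 < sigma x) by now apply Inc.
      assert (sigma s <= sigma L) by (destruct (Req_dec s L); [subst; lra|left; apply Inc; lra]). lra.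
    - assert (sigma s < sigma L) by now apply Inc.
      assert (sigma 0 <= sigma x) by (destruct (Req_dec x 0); [subst; lra|left; apply Inc; lra]). lra. }
  rewrite carg_circle_pos by lra. field.
Qed.

(** The jump [- PI] yields [PI * g x]. The term in [g 0] appears because [sigma s / 2] is not
    periodic: the step differs by [PI] between the two ends of the period. *)
Lemma is_RInt_step sigma L x (g g' : R -> R) : angle_lift sigma L -> 0 <= x < L ->
  (forall s, is_derive g s (g' s)) -> (forall s, continuous g' s) -> g L = g 0 ->
  is_RInt (fun s => (carg (RtoC 1 - expi (sigma s - sigma x))%C - sigma s / 2) * g' s)
    0 L (PI * (g x - g 0)).
Proof.
  intros A Hx Hg Cg E.
  replace (PI * (g x - g 0)) with ((PI - sigma x) / 2 * (g x - g 0)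
    + (- PI - sigma x) / 2 * (g L - g x)) by (rewrite E; field).
  apply (is_RInt_Chasles (V := R_NormedModule)) with x.
  - apply (is_RInt_const_derive (fun s => carg (RtoC 1 - expi (sigma s - sigma x))%C - sigma s / 2));
      auto; [lra|].
    intros s Hs. apply step_left with L; auto; lra.
  - apply (is_RInt_const_derive (fun s => carg (RtoC 1 - expi (sigma s - sigma x))%C - sigma s / 2));
      auto; [lra|].
    intros s Hs. apply step_right with L; auto; lra.
Qed.

Lemma Rsumn_ext n f g : (forall k, (k < n)%nat -> f k = g k) -> Rsumn n f = Rsumn n g.
Proof.
  intros H. induction n as [|n IH]; simpl; [reflexivity|].
  rewrite IH, H by (intros; try apply H; lia). reflexivity.
Qed.

Definition vortex_log (N : nat) (a : nat -> C) (d : nat -> Z) (z : C) : C :=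
  Csum N (fun j => RtoC (IZR (d j)) * Log (RtoC 1 - z * Cconj (a j)))%C.

Definition vortex_angle (N : nat) (a : nat -> C) (d : nat -> Z) (z : C) : R :=
  Rsumn N (fun j => IZR (d j) * carg (RtoC 1 - z * Cconj (a j))%C).

Lemma snd_vortex_log N a d z : snd (vortex_log N a d z) = vortex_angle N a d z.
Proof.
  unfold vortex_log, vortex_angle. rewrite snd_Csum.
  apply Rsumn_ext. intros j _. simpl. ring.
Qed.

Lemma expi_conj x y : (expi x * Cconj (expi y))%C = expi (x - y).
Proof.
  replace (Cconj (expi y)) with (expi (- y)).
  - unfold Rminus. now rewrite expi_plus.
  - unfold expi, Cconj. simpl. now rewrite cos_neg, sin_neg.
Qed.

(** The total multiplicity is kept general for the induction on [N]. When it is 2, the subtracted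
    function is [sigma] itself, and the term in [g 0] matches one full turn of the tangent. *)
Lemma is_RInt_vortex_angle sigma L N a d (x : nat -> R) (g g' : R -> R) :
  angle_lift sigma L ->
  (forall j, (j < N)%nat -> 0 <= x j < L /\ a j = expi (sigma (x j))) ->
  (forall s, is_derive g s (g' s)) -> (forall s, continuous g' s) -> g L = g 0 ->
  is_RInt (fun s => (vortex_angle N a d (expi (sigma s)) - IZR (Zsumn N d) / 2 * sigma s) * g' s) 0 L
    (PI * Rsumn N (fun j => IZR (d j) * g (x j)) - IZR (Zsumn N d) * PI * g 0).
Proof.
  intros A Hx Hg Cg E. induction N as [|N IH].
  - apply (is_RInt_ext (V := R_NormedModule) (fun _ => zero)).
    + intros s _. unfold vortex_angle, zero. simpl. field.
    + replace (PI * Rsumn 0 (fun j => IZR (d j) * g (x j)) - IZR (Zsumn 0 d) * PI * g 0)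
        with (scal (L - 0) (zero : R)) by (unfold scal, zero; simpl; unfold mult; simpl; ring).
      apply (is_RInt_const (V := R_NormedModule)).
  - destruct (Hx N (Nat.lt_succ_diag_r N)) as [HxN Ea].
    specialize (IH (fun j Hj => Hx j (Nat.lt_lt_succ_r _ _ Hj))).
    assert (S := is_RInt_step sigma L (x N) g g' A HxN Hg Cg E).
    apply (is_RInt_scal (V := R_NormedModule) _ _ _ (IZR (d N))) in S.
    assert (P := is_RInt_plus (V := R_NormedModule) _ _ _ _ _ _ IH S).
    evar_last.
    + apply (is_RInt_ext (V := R_NormedModule)) with (2 := P).
      intros s _. unfold plus, scal; simpl. unfold mult; simpl.
      unfold vortex_angle. simpl. rewrite Ea, expi_conj, plus_IZR. field.
    + simpl. unfold plus, scal; simpl. unfold mult; simpl.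
      rewrite plus_IZR. ring.
Qed.

(** * Functions with finitely many jumps *)

Definition locally_const (F : R -> R) (s : R) : Prop :=
  exists e, 0 < e /\ forall t, Rabs (t - s) < e -> F t = F s.

Lemma locally_const_interval F a b : a < b ->
  (forall s, a < s < b -> locally_const F s) ->
  exists c, forall s, a < s < b -> F s = c.
Proof.
  intros Hab H. exists (F ((a + b) / 2)).
  assert (D : forall s, a < s < b -> is_derive F s 0).
  { intros s Hs. destruct (H s Hs) as [e [He K]].
    apply is_derive_ext_loc with (fun _ => F s); [|apply @is_derive_const].
    exists (mkposreal e He). intros t Ht. symmetry. now apply K. }
  assert (Q : forall x y, a < x < b -> a < y < b -> x < y -> F x = F y).
  { intros x y Hx Hy L. apply (eq_is_derive (V := R_NormedModule) F x y); auto.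
    intros t Ht. apply D. lra. }
  intros s Hs. destruct (Rtotal_order s ((a + b) / 2)) as [L|[->|L]]; auto.
  - apply Q; lra.
  - symmetry. apply Q; lra.
Qed.

Lemma avoid_succ n (p : nat -> R) s : s <> p n -> (forall k, (k < n)%nat -> s <> p k) ->
  forall k, (k < S n)%nat -> s <> p k.
Proof. intros H1 H2 k Hk. destruct (Nat.eq_dec k n); [now subst|]. apply H2; lia. Qed.

(** Integration by parts for a function with finitely many jumps: the jumps
    sit at points where the test function vanishes. *)
Lemma piecewise_const_integral n (p : nat -> R) F : forall a b, a < b ->
  (forall s, a < s < b -> (forall k, (k < n)%nat -> s <> p k) -> locally_const F s) ->
  exists fa fb e, 0 < e /\ (forall t, a < t < a + e -> F t = fa) /\
    (forall t, b - e < t < b -> F t = fb) /\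
    forall g g' : R -> R, (forall s, is_derive g s (g' s)) -> (forall s, continuous g' s) ->
      (forall k, (k < n)%nat -> g (p k) = 0) ->
      is_RInt (fun s => F s * g' s) a b (fb * g b - fa * g a).
Proof.
  induction n as [|n IH]; intros a b Hab H.
  - destruct (locally_const_interval F a b Hab) as [c Hc].
    { intros s Hs. apply H; [exact Hs|]. intros; lia. }
    exists c, c, (b - a). split; [lra|]. split; [intros; apply Hc; lra|].
    split; [intros; apply Hc; lra|]. intros g g' Hg Cg _.
    replace (c * g b - c * g a) with (c * (g b - g a)) by ring.
    apply is_RInt_const_derive; auto. lra.
  - destruct (classic (a < p n < b)) as [Hin|Hout].
    + destruct (IH a (p n)) as [fa [f1 [e1 [He1 [A1 [B1 I1]]]]]]; [lra| |].
      { intros s Hs Hk. apply H; [lra|]. apply avoid_succ; [lra|exact Hk]. }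
      destruct (IH (p n) b) as [f2 [fb [e2 [He2 [A2 [B2 I2]]]]]]; [lra| |].
      { intros s Hs Hk. apply H; [lra|]. apply avoid_succ; [lra|exact Hk]. }
      assert (M1 := Rmin_l e1 e2). assert (M2 := Rmin_r e1 e2).
      exists fa, fb, (Rmin e1 e2). split; [now apply Rmin_pos|].
      split; [intros; apply A1; lra|]. split; [intros; apply B2; lra|].
      intros g g' Hg Cg Z.
      specialize (I1 g g' Hg Cg (fun k Hk => Z k (Nat.lt_lt_succ_r _ _ Hk))).
      specialize (I2 g g' Hg Cg (fun k Hk => Z k (Nat.lt_lt_succ_r _ _ Hk))).
      assert (I := is_RInt_Chasles (V := R_NormedModule) _ _ _ _ _ _ I1 I2).
      evar_last; [exact I|]. unfold plus; simpl. rewrite (Z n) by lia. ring.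
    + destruct (IH a b Hab) as [fa [fb [e [He [A [B I]]]]]].
      { intros s Hs Hk. apply H; [exact Hs|]. apply avoid_succ; [|exact Hk]. intros ->. tauto. }
      exists fa, fb, e. repeat (split; [assumption|]). intros g g' Hg Cg Z. apply I; auto.
Qed.

(** Nothing is claimed at the points [p k] themselves, since the boundary phase is unconstrained at
    a vortex. The one-sided values at the ends are what the induction glues at [p n]. *)
Lemma removable_jumps_const n (p : nat -> R) F : forall a b, a < b ->
  (forall s, a < s < b -> (forall k, (k < n)%nat -> s <> p k) -> locally_const F s) ->
  (forall k, (k < n)%nat -> a < p k < b -> exists c e, 0 < e /\
     forall t, 0 < Rabs (t - p k) < e -> F t = c) ->
  exists c e, 0 < e /\ (forall t, a < t < a + e -> F t = c) /\
    (forall t, b - e < t < b -> F t = c) /\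
    forall s, a < s < b -> (forall k, (k < n)%nat -> s <> p k) -> F s = c.
Proof.
  induction n as [|n IH]; intros a b Hab H J.
  - destruct (locally_const_interval F a b Hab) as [c Hc].
    { intros s Hs. apply H; [exact Hs|]. intros; lia. }
    exists c, (b - a). split; [lra|]. repeat split; intros; apply Hc; lra.
  - destruct (classic (a < p n < b)) as [Hin|Hout].
    + destruct (IH a (p n)) as [c1 [e1 [He1 [A1 [B1 C1]]]]]; [lra| | |].
      { intros s Hs Hk. apply H; [lra|]. apply avoid_succ; [lra|exact Hk]. }
      { intros k Hk Hp. apply J; [lia|lra]. }
      destruct (IH (p n) b) as [c2 [e2 [He2 [A2 [B2 C2]]]]]; [lra| | |].
      { intros s Hs Hk. apply H; [lra|]. apply avoid_succ; [lra|exact Hk]. }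
      { intros k Hk Hp. apply J; [lia|lra]. }
      destruct (J n (Nat.lt_succ_diag_r n) Hin) as [c [e [He K]]].
      assert (M1 := Rmin_l e1 e2). assert (M2 := Rmin_r e1 e2).
      assert (Pm : 0 < Rmin e1 e2) by now apply Rmin_pos.
      assert (Q1 := Rmin_l e (Rmin e1 e2)). assert (Q2 := Rmin_r e (Rmin e1 e2)).
      assert (Pq : 0 < Rmin e (Rmin e1 e2)) by now apply Rmin_pos.
      set (q := Rmin e (Rmin e1 e2)) in *.
      assert (E1 : c1 = c).
      { rewrite <- (B1 (p n - q / 2)) by lra. apply K.
        replace (p n - q / 2 - p n) with (- (q / 2)) by ring.
        rewrite Rabs_Ropp, Rabs_pos_eq; lra. }
      assert (E2 : c2 = c).
      { rewrite <- (A2 (p n + q / 2)) by lra. apply K.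
        replace (p n + q / 2 - p n) with (q / 2) by ring. rewrite Rabs_pos_eq; lra. }
      subst c1 c2. exists c, (Rmin e1 e2). split; [exact Pm|].
      split; [intros; apply A1; lra|]. split; [intros; apply B2; lra|].
      intros s Hs Hk. destruct (Rtotal_order s (p n)) as [L|[Es|L]].
      * apply C1; [lra|]. intros; apply Hk; lia.
      * exfalso. apply (Hk n); [lia|exact Es].
      * apply C2; [lra|]. intros; apply Hk; lia.
    + destruct (IH a b Hab) as [c [e [He [A [B K]]]]].
      { intros s Hs Hk. apply H; [exact Hs|]. apply avoid_succ; [|exact Hk]. intros ->. tauto. }
      { intros k Hk Hp. apply J; [lia|exact Hp]. }
      exists c, e. repeat (split; [assumption|]). intros s Hs Hk. apply K; auto.
Qed.

(** * Smooth test functions *)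

(** Carries a derivative at each order, which makes the product rule an induction;
    [smooth_ex_derive_n] returns to the form that [smooth_periodic] asks for. *)
Fixpoint smooth (n : nat) (f : R -> R) : Prop :=
  match n with
  | O => True
  | S k => exists f1, (forall s, is_derive f s (f1 s)) /\ smooth k f1
  end.

Lemma smooth_pred n f : smooth (S n) f -> smooth n f.
Proof.
  revert f. induction n as [|n IH]; intros f [f1 [H H1]]; [exact I|].
  exists f1; split; auto.
Qed.

Lemma smooth_const n c : smooth n (fun _ => c).
Proof.
  revert c. induction n as [|n IH]; intros c; [exact I|].
  exists (fun _ => 0). split; [intros; apply @is_derive_const|apply IH].
Qed.

Lemma smooth_plus n f g : smooth n f -> smooth n g -> smooth n (fun s => f s + g s).
Proof.
  revert f g. induction n as [|n IH]; intros f g; [easy|].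
  intros [f1 [Hf Hf1]] [g1 [Hg Hg1]]. exists (fun s => f1 s + g1 s). split; auto.
  intros s. now apply (is_derive_plus (V := R_NormedModule) f g).
Qed.

Lemma smooth_mult n f g : smooth n f -> smooth n g -> smooth n (fun s => f s * g s).
Proof.
  revert f g. induction n as [|n IH]; intros f g Hf Hg; [exact I|].
  assert (Pf := smooth_pred _ _ Hf). assert (Pg := smooth_pred _ _ Hg).
  destruct Hf as [f1 [Hf Hf1]], Hg as [g1 [Hg Hg1]].
  exists (fun s => f1 s * g s + f s * g1 s). split.
  - intros s. apply (is_derive_mult f g); auto. intros; apply Rmult_comm.
  - apply smooth_plus; auto.
Qed.

Lemma smooth_trig n c : smooth n (fun s => cos (c + s)) /\ smooth n (fun s => sin (c + s)).
Proof.
  induction n as [|n [IH1 IH2]]; [split; exact I|].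
  assert (D : forall s, rder (fun t => expi (c + t)) s (Ci * expi (c + s) * RtoC 1)%C).
  { intros s. apply (rder_expi_comp (fun t => c + t)).
    replace 1 with (0 + 1) by ring.
    apply (is_derive_plus (V := R_NormedModule) (fun _ => c) (fun t => t));
      [apply @is_derive_const|apply @is_derive_id]. }
  split.
  - exists (fun s => -1 * sin (c + s)). split; [|apply smooth_mult; [apply smooth_const|exact IH2]].
    intros s. specialize (D s). apply rder_parts in D. destruct D as [D _].
    evar_last; [exact D|]. simpl. ring.
  - exists (fun s => cos (c + s)). split; [|exact IH1].
    intros s. specialize (D s). apply rder_parts in D. destruct D as [_ D].
    evar_last; [exact D|]. simpl. ring.
Qed.

Lemma smooth_ex_derive_n n f s : smooth n f -> ex_derive_n f n s.
Proof.
  revert f s. induction n as [|n IH]; intros f s Hf; [exact I|].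
  destruct Hf as [f1 [Hf Hf1]].
  destruct n as [|n].
  - exists (f1 s). apply Hf.
  - specialize (IH f1 s Hf1). simpl in *.
    apply ex_derive_ext with (Derive_n f1 n); [|exact IH].
    intros t. clear IH. symmetry.
    transitivity (Derive_n (Derive_n f 1) n t).
    + rewrite Derive_n_comp, Nat.add_1_r. reflexivity.
    + apply Derive_n_ext. intros u. apply is_derive_unique, Hf.
Qed.

Fixpoint Rprod (n : nat) (f : nat -> R) : R :=
  match n with O => 1 | S k => Rprod k f * f k end.

Lemma smooth_Rprod m n (f : nat -> R -> R) : (forall k, smooth m (f k)) ->
  smooth m (fun s => Rprod n (fun k => f k s)).
Proof.
  intros H. induction n as [|n IH]; simpl; [apply smooth_const|now apply smooth_mult].
Qed.

Lemma Rprod_zero n f k : (k < n)%nat -> f k = 0 -> Rprod n f = 0.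
Proof.
  intros Hk E. induction n as [|n IH]; [lia|]. simpl.
  destruct (Nat.eq_dec k n) as [->|Nk]; [rewrite E; ring|]. rewrite IH by lia. ring.
Qed.

Lemma Rprod_nz n f : (forall k, (k < n)%nat -> f k <> 0) -> Rprod n f <> 0.
Proof.
  intros H. induction n as [|n IH]; simpl; [lra|].
  apply Rmult_integral_contrapositive_currified; auto.
Qed.

(** * Maximum principle *)

(** If [c] were positive, [f' t] would be at least [c / 2 * (t - x)] to the right of [x]. This bound
    vanishes at [x], so the interval is halved: [f] does not fall on the first half and rises
    strictly on the second. *)
Lemma local_max_second_derivative (f f' : R -> R) x c :
  locally x (fun t => is_derive f t (f' t)) -> is_derive f' x c ->
  locally x (fun t => f t <= f x) -> c <= 0.
Proof.
  intros [r1 H1] H2 [r2 H3].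
  assert (Z : f' x = 0).
  { assert (D := proj1 (is_derive_Reals _ _ _) (H1 x (ball_center x r1))).
    assert (Pr := cond_pos r2).
    assert (pr : derivable_pt f x) by (exists (f' x); exact D).
    rewrite <- (derive_pt_eq_0 f x (f' x) pr D).
    apply (deriv_maximum f (x - r2) (x + r2)); try lra.
    intros y Hy1 Hy2. apply H3. apply Rabs_def1; unfold minus, plus, opp; simpl; lra. }
  apply Rnot_lt_le. intros Pc. rewrite is_derive_eps in H2.
  destruct (H2 (c / 2)) as [d [Hd K]]; [lra|].
  set (e := Rmin (d / 2) (Rmin (r1 / 2) (r2 / 2))).
  assert (P1 := cond_pos r1). assert (P2 := cond_pos r2).
  assert (Pe : 0 < e) by (repeat apply Rmin_pos; lra).
  assert (e <= d / 2) by apply Rmin_l.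
  assert (E2 : e <= Rmin (r1 / 2) (r2 / 2)) by apply Rmin_r.
  assert (L1 := Rmin_l (r1 / 2) (r2 / 2)). assert (L2 := Rmin_r (r1 / 2) (r2 / 2)).
  assert (B : forall t, x <= t <= x + e -> ball x r1 t).
  { intros t Ht. change (Rabs (t - x) < r1). rewrite Rabs_pos_eq; lra. }
  assert (Le : f (x + e) <= f x).
  { apply H3. change (Rabs (x + e - x) < r2). rewrite Rabs_pos_eq; lra. }
  destruct (MVT_gen f (x + e / 2) (x + e) f') as [t [Ht Et]].
  { rewrite Rmin_left, Rmax_right by lra. intros t Ht. apply H1, B. lra. }
  { rewrite Rmin_left, Rmax_right by lra. intros t Ht. eapply is_derive_cont, H1, B. lra. }
  destruct (MVT_gen f x (x + e / 2) f') as [s [Hs Es]].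
  { rewrite Rmin_left, Rmax_right by lra. intros s Hs. apply H1, B. lra. }
  { rewrite Rmin_left, Rmax_right by lra. intros s Hs. eapply is_derive_cont, H1, B. lra. }
  rewrite Rmin_left, Rmax_right in Ht, Hs by lra.
  assert (Q : forall t, x <= t <= x + e -> c / 2 * (t - x) <= f' t).
  { intros y Hy. specialize (K y). rewrite Rabs_pos_eq, Z in K by lra.
    specialize (K ltac:(lra)). apply Rabs_le_between in K. lra. }
  assert (Q1 := Q t ltac:(lra)). assert (Q2 := Q s ltac:(lra)).
  assert (0 < c / 2 * (t - x)) by (apply Rmult_lt_0_compat; lra).
  assert (0 <= c / 2 * (s - x)) by (apply Rmult_le_pos; lra).
  nra.
Qed.

(** The partial derivatives are witnesses, so sums are taken termwise; the constant [l] leaves room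
    for the strictly subharmonic perturbation by the squared modulus. *)
Definition has_laplacian (U : C -> Prop) (u : C -> R) (l : R) : Prop :=
  exists ux uy : C -> R, forall z, U z ->
    is_derive (fun t => u (t, snd z)) (fst z) (ux z) /\
    is_derive (fun t => u (fst z, t)) (snd z) (uy z) /\
    exists p q, is_derive (fun t => ux (t, snd z)) (fst z) p /\
      is_derive (fun t => uy (fst z, t)) (snd z) q /\ p + q = l.

Lemma harmonic_laplacian U u : harmonic_on U u -> has_laplacian U u 0.
Proof.
  intros [[H1 _] [[H2 _] [[H3 _] H4]]]. exists (pdx u), (pdy u). intros z Uz.
  destruct (H1 z Uz) as [A B]. split; [now apply Derive_correct|].
  split; [now apply Derive_correct|].
  exists (pdx (pdx u) z), (pdy (pdy u) z). split; [|split; [|now apply H4]].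
  - apply Derive_correct. now apply H2.
  - apply Derive_correct. now apply H3.
Qed.

Lemma has_laplacian_plus U u v l k : has_laplacian U u l -> has_laplacian U v k ->
  has_laplacian U (fun z => u z + v z) (l + k).
Proof.
  intros [ux [uy H]] [vx [vy K]]. exists (fun z => ux z + vx z), (fun z => uy z + vy z).
  intros z Uz. destruct (H z Uz) as [H1 [H2 [p [q [H3 [H4 H5]]]]]].
  destruct (K z Uz) as [K1 [K2 [p' [q' [K3 [K4 K5]]]]]].
  split; [now apply (is_derive_plus (V := R_NormedModule) (fun t => u (t, snd z)) (fun t => v (t, snd z)))|].
  split; [now apply (is_derive_plus (V := R_NormedModule) (fun t => u (fst z, t)) (fun t => v (fst z, t)))|].
  exists (p + p'), (q + q').
  split; [now apply (is_derive_plus (V := R_NormedModule) (fun t => ux (t, snd z)) (fun t => vx (t, snd z)))|].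
  split; [now apply (is_derive_plus (V := R_NormedModule) (fun t => uy (fst z, t)) (fun t => vy (fst z, t)))|].
  lra.
Qed.

Lemma has_laplacian_scal U u l c : has_laplacian U u l -> has_laplacian U (fun z => c * u z) (c * l).
Proof.
  intros [ux [uy H]]. exists (fun z => c * ux z), (fun z => c * uy z).
  intros z Uz. destruct (H z Uz) as [H1 [H2 [p [q [H3 [H4 H5]]]]]].
  split; [now apply (is_derive_scal (fun t => u (t, snd z)))|].
  split; [now apply (is_derive_scal (fun t => u (fst z, t)))|].
  exists (c * p), (c * q).
  split; [now apply (is_derive_scal (fun t => ux (t, snd z)))|].
  split; [now apply (is_derive_scal (fun t => uy (fst z, t)))|].
  rewrite <- H5. ring.
Qed.

Lemma has_laplacian_const U c : has_laplacian U (fun _ => c) 0.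
Proof.
  exists (fun _ => 0), (fun _ => 0). intros z _.
  split; [apply @is_derive_const|]. split; [apply @is_derive_const|].
  exists 0, 0. split; [apply @is_derive_const|]. split; [apply @is_derive_const|]. ring.
Qed.

Lemma has_laplacian_sqr U : has_laplacian U (fun z => fst z * fst z + snd z * snd z) 4.
Proof.
  exists (fun z => 2 * fst z), (fun z => 2 * snd z). intros z _. simpl.
  assert (H : forall x c, is_derive (fun t => t * t + c) x (2 * x)).
  { intros x c. auto_derive; [exact I|ring]. }
  split; [apply H|]. split.
  - apply is_derive_ext with (fun t => t * t + fst z * fst z); [intros; apply Rplus_comm|apply H].
  - exists 2, 2. split; [|split; [|ring]]; auto_derive; auto; ring.
Qed.

Lemma maximum_principle u :
  has_laplacian unit_disk u 0 -> (forall z, unit_disk z -> contC_within unit_disk u z) ->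
  (exists M, forall z, unit_disk z -> u z <= M) ->
  (forall z, Cmod z = 1 -> forall e, 0 < e -> exists d, 0 < d /\
     forall w, unit_disk w -> Cmod (w - z)%C < d -> u w <= e) ->
  forall z, unit_disk z -> u z <= 0.
Proof.
  intros HL HC [M HM] HB z0 D0. apply Rnot_lt_le. intros P.
  (* The perturbed function [w] has Laplacian [4 * de > 0], lies below [u] in the disk, and is still
     positive at [z0], because it loses at most [de] there. *)
  set (de := u z0 / 2). assert (Pd : 0 < de) by (unfold de; lra).
  set (w := fun z : C => u z + (de * (fst z * fst z + snd z * snd z) + - de)).
  assert (Lw : has_laplacian unit_disk w (0 + (de * 4 + 0))).
  { apply has_laplacian_plus; [exact HL|]. apply has_laplacian_plus; [|apply has_laplacian_const].
    apply has_laplacian_scal, has_laplacian_sqr. }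
  assert (Sq : forall z, unit_disk z -> 0 <= fst z * fst z + snd z * snd z <= 1).
  { intros z Dz. rewrite <- Cmod_sqr. unfold unit_disk in Dz. generalize (Cmod_ge_0 z). nra. }
  assert (Wu : forall z, unit_disk z -> w z <= u z).
  { intros z Dz. specialize (Sq z Dz). unfold w. nra. }
  assert (W0 : 0 < w z0).
  { specialize (Sq z0 D0). assert (de = u z0 / 2) by reflexivity. unfold w. nra. }
  assert (Cw : forall z, unit_disk z -> contC_within unit_disk w z).
  { intros z Dz. apply contC_plus; [now apply HC|]. apply contC_plus; [|apply contC_const].
    apply contC_mult; [apply contC_const|].
    apply contC_plus; apply contC_mult; try (apply (ccont_fst _ (fun z => z)), ccont_id);
      apply (ccont_snd _ (fun z => z)), ccont_id. }
  destruct (completeness (fun y => exists z, unit_disk z /\ y = w z)) as [S [HS1 HS2]].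
  { exists M. intros y [z [Dz ->]]. eapply Rle_trans; [now apply Wu|now apply HM]. }
  { exists (w z0), z0. auto. }
  assert (HS : forall z, unit_disk z -> w z <= S) by (intros z Dz; apply HS1; eauto).
  assert (PS : 0 < S) by (eapply Rlt_le_trans; [exact W0|now apply HS]).
  destruct (classic (exists z, unit_disk z /\ w z = S)) as [[z [Dz Ez]]|Nz].
  - destruct Lw as [wx [wy H]]. destruct (H z Dz) as [_ [_ [p [q [H3 [H4 H5]]]]]].
    assert (p <= 0).
    { apply (local_max_second_derivative (fun t => w (t, snd z)) (fun t => wx (t, snd z)) (fst z)).
      - apply filter_imp with (2 := open_near_fst _ z open_disk Dz). intros t Ht.
        apply (H (t, snd z) Ht).
      - exact H3.
      - apply filter_imp with (2 := open_near_fst _ z open_disk Dz). intros t Ht.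
        replace (fst z, snd z) with z by now destruct z. rewrite Ez. now apply HS. }
    assert (q <= 0).
    { apply (local_max_second_derivative (fun t => w (fst z, t)) (fun t => wy (fst z, t)) (snd z)).
      - apply filter_imp with (2 := open_near_snd _ z open_disk Dz). intros t Ht.
        apply (H (fst z, t) Ht).
      - exact H4.
      - apply filter_imp with (2 := open_near_snd _ z open_disk Dz). intros t Ht.
        replace (fst z, snd z) with z by now destruct z. rewrite Ez. now apply HS. }
    lra.
  (* An unattained supremum is excluded by covering: [w] stays below [S] by a margin near interior
     points by continuity, and near the circle by the boundary hypothesis. A uniform margin
     contradicts the least upper bound. *)
  - destruct (lebesgue_number 1 (fun v r => forall z, unit_disk z -> Cmod (z - v)%C < r -> w z <= S - r))
      as [d [Hd K]].
    { intros v. destruct (Rtotal_order (Cmod v) 1) as [Lv|[Ev|Gv]].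
      - assert (m0 : 0 < (S - w v) / 2).
        { assert (w v <= S) by now apply HS. assert (w v <> S) by (intros E; apply Nz; eauto). lra. }
        destruct (Cw v Lv _ m0) as [r [Hr Kr]].
        exists (Rmin r ((S - w v) / 2)). split; [now apply Rmin_pos|]. intros z Dz Hz.
        specialize (Kr z Dz (Rlt_le_trans _ _ _ Hz (Rmin_l _ _))). apply Rabs_def2 in Kr.
        assert (X := Rmin_r r ((S - w v) / 2)). lra.
      - destruct (HB v Ev (S / 2)) as [r [Hr Kr]]; [lra|].
        exists (Rmin r (S / 2)). split; [apply Rmin_pos; lra|]. intros z Dz Hz.
        specialize (Kr z Dz (Rlt_le_trans _ _ _ Hz (Rmin_l _ _))).
        assert (X := Rmin_r r (S / 2)). specialize (Wu z Dz). lra.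
      - exists (Cmod v - 1). split; [lra|]. intros z Dz Hz. exfalso. unfold unit_disk in Dz.
        assert (T := Cmod_sub_lower v z). rewrite Cmod_sub_sym in T. lra. }
    assert (S <= S - d); [|lra].
    apply HS2. intros y [z [Dz ->]].
    destruct (K z) as [v [r [Hv [Hz Hr]]]]; [now apply disk_closed|].
    specialize (Hv z Dz Hz). lra.
Qed.

(** * Exceptional boundary points *)

(** Each factor has modulus [Cmod (z - a j) < 2] in the disk, so the shift by [ln 2] makes every
    term nonpositive. *)
Definition log_barrier (N : nat) (a : nat -> C) (z : C) : R :=
  Rsumn N (fun j => ln (Cmod (RtoC 1 - z * Cconj (a j))%C) - ln 2).

Lemma vortex_right_half z a : unit_disk z -> Cmod a = 1 -> right_half (RtoC 1 - z * Cconj a)%C.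
Proof. intros Dz Ha. apply one_minus_right_half; [exact Dz|]. now rewrite Cmod_conj. Qed.

Lemma holo_vortex_factor a n : Cmod a = 1 -> holo unit_disk n (fun z => Log (RtoC 1 - z * Cconj a)%C).
Proof.
  intros Ha. apply (holo_comp unit_disk right_half).
  - intros z Dz. now apply vortex_right_half.
  - apply holo_Log.
  - apply holo_plus; [apply holo_const|]. apply holo_opp.
    apply holo_mult; [apply holo_id|apply holo_const].
Qed.

Lemma vortex_factor_abs z a : Cmod a = 1 -> Cmod (RtoC 1 - z * Cconj a)%C = Cmod (z - a)%C.
Proof.
  intros Ha. assert (E : (a * Cconj a)%C = RtoC 1).
  { rewrite <- Cmod2_conj, Ha. simpl. now rewrite !Rmult_1_r. }
  replace (RtoC 1 - z * Cconj a)%C with ((a - z) * Cconj a)%C.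
  - rewrite Cmod_mult, Cmod_conj, Ha, Cmod_sub_sym. ring.
  - rewrite <- E. ring.
Qed.

Lemma log_barrier_term_neg z a : unit_disk z -> Cmod a = 1 ->
  ln (Cmod (RtoC 1 - z * Cconj a)%C) - ln 2 <= 0.
Proof.
  intros Dz Ha.
  assert (P := proj1 (Cmod_gt_0 _) (right_half_nz _ (vortex_right_half z a Dz Ha))).
  assert (ln (Cmod (RtoC 1 - z * Cconj a)%C) <= ln 2); [|lra].
  apply ln_le; [exact P|]. rewrite vortex_factor_abs by exact Ha.
  eapply Rle_trans; [apply Cmod_triangle|]. rewrite Cmod_opp, Ha. unfold unit_disk in Dz. lra.
Qed.

Lemma Rsumn_nonpos n f : (forall k, (k < n)%nat -> f k <= 0) -> Rsumn n f <= 0.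
Proof.
  intros H. induction n as [|n IH]; simpl; [lra|].
  assert (Rsumn n f <= 0) by (apply IH; intros; apply H; lia).
  assert (f n <= 0) by (apply H; lia). lra.
Qed.

Lemma Rsumn_le_term n f j : (forall k, (k < n)%nat -> f k <= 0) -> (j < n)%nat -> Rsumn n f <= f j.
Proof.
  intros H Hj. induction n as [|n IH]; [lia|]. simpl.
  assert (f n <= 0) by (apply H; lia).
  destruct (Nat.eq_dec j n) as [->|Nj].
  - assert (Rsumn n f <= 0) by (apply Rsumn_nonpos; intros; apply H; lia). lra.
  - assert (Rsumn n f <= f j) by (apply IH; [intros; apply H; lia|lia]). lra.
Qed.

Lemma log_barrier_harmonic N a : (forall j, (j < N)%nat -> Cmod (a j) = 1) ->
  harmonic_on unit_disk (log_barrier N a).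
Proof.
  intros Ha.
  (* The factor [Ci] moves the logarithm of the modulus into the imaginary part, the form that
     [harmonic_Im] takes. *)
  set (f := fun z => (Ci * Csum N (fun j => Log (RtoC 1 - z * Cconj (a j))%C + RtoC (- ln 2)))%C).
  replace (log_barrier N a) with (fun z => snd (f z)).
  - apply harmonic_Im; [apply open_disk|]. apply holo_mult; [apply holo_const|].
    apply holo_sum. intros j Hj. apply holo_plus; [now apply holo_vortex_factor, Ha|apply holo_const].
  - apply functional_extensionality. intros z. unfold f, log_barrier.
    transitivity (fst (Csum N (fun j => Log (RtoC 1 - z * Cconj (a j)) + RtoC (- ln 2))%C)).
    + simpl. ring.
    + rewrite fst_Csum. apply Rsumn_ext. intros j _. reflexivity.
Qed.

Lemma harmonic_contC U u z : harmonic_on U u -> U z -> contC_within U u z.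
Proof.
  intros [[_ H] _] Uz e He. destruct (H z Uz) as [K _].
  destruct (K e He) as [d [Hd Kd]]. exists d; split; auto.
Qed.

(** Adding a small multiple of the logarithmic barrier, which tends to [-oo] at
    the exceptional points, reduces to the maximum principle. *)
Lemma lindelof_nonpos N a u M : (forall j, (j < N)%nat -> Cmod (a j) = 1) ->
  has_laplacian unit_disk u 0 -> (forall z, unit_disk z -> contC_within unit_disk u z) ->
  (forall z, unit_disk z -> u z <= M) ->
  (forall z, Cmod z = 1 -> (forall j, (j < N)%nat -> z <> a j) ->
     forall e, 0 < e -> exists d, 0 < d /\
     forall w, unit_disk w -> Cmod (w - z)%C < d -> u w <= e) ->
  forall z, unit_disk z -> u z <= 0.
Proof.
  intros Ha HL HC HM HB.
  assert (Bneg : forall z, unit_disk z -> forall j, (j < N)%nat ->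
     ln (Cmod (RtoC 1 - z * Cconj (a j))%C) - ln 2 <= 0).
  { intros. apply log_barrier_term_neg; auto. }
  assert (B0 : forall z, unit_disk z -> log_barrier N a z <= 0).
  { intros z Dz. apply Rsumn_nonpos. auto. }
  assert (HH := log_barrier_harmonic N a Ha).
  assert (Main : forall ep, 0 < ep -> forall z, unit_disk z -> u z + ep * log_barrier N a z <= 0).
  { intros ep Hep. apply maximum_principle.
    - replace 0 with (0 + ep * 0) by ring. apply has_laplacian_plus; [exact HL|].
      apply has_laplacian_scal. now apply harmonic_laplacian.
    - intros z Dz. apply contC_plus; [now apply HC|]. apply contC_mult; [apply contC_const|].
      now apply harmonic_contC.
    - exists M. intros z Dz. specialize (HM z Dz). specialize (B0 z Dz). nra.
    - intros z Hz e He.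
      destruct (classic (exists j, (j < N)%nat /\ z = a j)) as [[j [Hj ->]]|Nv].
      (* Within [exp T] of the vortex the barrier is at most [- Rabs M / ep], so [ep] times it
         cancels the bound [M] of [u]. *)
      + set (T := ln 2 - Rabs M / ep). exists (exp T). split; [apply exp_pos|].
        intros w Dw Hw.
        assert (P := proj1 (Cmod_gt_0 _) (right_half_nz _ (vortex_right_half w (a j) Dw (Ha j Hj)))).
        assert (L : ln (Cmod (RtoC 1 - w * Cconj (a j))%C) < T).
        { rewrite <- (ln_exp T). apply ln_increasing; [exact P|].
          now rewrite vortex_factor_abs by auto. }
        assert (LB : log_barrier N a w <= ln (Cmod (RtoC 1 - w * Cconj (a j))%C) - ln 2).
        { apply (Rsumn_le_term N (fun j => ln (Cmod (RtoC 1 - w * Cconj (a j))%C) - ln 2) j); auto. }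
        assert (LC : log_barrier N a w <= - (Rabs M / ep)) by (unfold T in L; lra).
        assert (ep * log_barrier N a w <= - Rabs M).
        { replace (- Rabs M) with (ep * - (Rabs M / ep)) by (field; lra).
          apply Rmult_le_compat_l; lra. }
        specialize (HM w Dw). generalize (Rle_abs M). lra.
      + destruct (HB z Hz) with (e := e) as [d [Hd K]]; auto.
        { intros j Hj E. apply Nv. eauto. }
        exists d; split; auto. intros w Dw Hw. specialize (K w Dw Hw). specialize (B0 w Dw). nra. }
  intros z Dz. apply Rnot_lt_le. intros P.
  assert (Q := B0 z Dz).
  (* This value makes [u z + ep * log_barrier N a z] equal to [u z / 2 + ep], which is positive. *)
  set (ep := u z / (2 * (1 - log_barrier N a z))).
  assert (Pe : 0 < ep) by (apply Rdiv_lt_0_compat; lra).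
  specialize (Main ep Pe z Dz).
  assert (E : ep * (1 - log_barrier N a z) = u z / 2) by (unfold ep; field; lra).
  nra.
Qed.

Lemma lindelof_uniqueness N a u M : (forall j, (j < N)%nat -> Cmod (a j) = 1) ->
  has_laplacian unit_disk u 0 -> (forall z, unit_disk z -> contC_within unit_disk u z) ->
  (forall z, unit_disk z -> Rabs (u z) <= M) ->
  (forall z, Cmod z = 1 -> (forall j, (j < N)%nat -> z <> a j) ->
     forall e, 0 < e -> exists d, 0 < d /\
     forall w, unit_disk w -> Cmod (w - z)%C < d -> Rabs (u w) < e) ->
  forall z, unit_disk z -> u z = 0.
Proof.
  intros Ha HL HC HM HB z Dz. apply Rle_antisym.
  - apply (lindelof_nonpos N a u M); auto.
    + intros w Dw. specialize (HM w Dw). generalize (Rle_abs (u w)). lra.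
    + intros v Hv Nv e He. destruct (HB v Hv Nv e He) as [d [Hd K]]. exists d; split; auto.
      intros w Dw Hw. specialize (K w Dw Hw). generalize (Rle_abs (u w)). lra.
  - assert (H : -1 * u z <= 0); [|lra].
    apply (lindelof_nonpos N a (fun w => -1 * u w) M); auto.
    + replace 0 with (-1 * 0) by ring. now apply has_laplacian_scal.
    + intros w Dw. apply contC_mult; [apply contC_const|auto].
    + intros w Dw. specialize (HM w Dw). apply Rabs_le_between in HM. lra.
    + intros v Hv Nv e He. destruct (HB v Hv Nv e He) as [d [Hd K]]. exists d; split; auto.
      intros w Dw Hw. specialize (K w Dw Hw). apply Rabs_def2 in K. lra.
Qed.

(** * Canonical maps of the disk *)

(** Twice the real part of the factor is the squared distance of [z] and [a] plus one minus the
    squared modulus of [z]. *)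
Lemma closed_right_half z a : closed_unit_disk z -> Cmod a = 1 -> z <> a ->
  right_half (RtoC 1 - z * Cconj a)%C.
Proof.
  unfold closed_unit_disk, right_half. intros Dz Ha N. assert (P := Cmod_pos_sub _ _ N).
  assert (E1 := Cmod_sqr (z - a)%C). assert (E2 := Cmod_sqr z). assert (E3 := Cmod_sqr a).
  rewrite Ha in E3. assert (P2 := Cmod_ge_0 z).
  destruct z as [x y], a as [p q]. simpl in *. nra.
Qed.

Lemma contC_Rsumn D n (f : nat -> C -> R) z :
  (forall k, (k < n)%nat -> contC_within D (f k) z) ->
  contC_within D (fun w => Rsumn n (fun k => f k w)) z.
Proof.
  intros H. induction n as [|n IH]; simpl; [apply contC_const|].
  apply contC_plus; [apply IH; intros; apply H; lia|apply H; lia].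
Qed.

Lemma vortex_angle_contC N a d z : (forall j, (j < N)%nat -> Cmod (a j) = 1) ->
  closed_unit_disk z -> (forall j, (j < N)%nat -> z <> a j) ->
  contC_within closed_unit_disk (vortex_angle N a d) z.
Proof.
  intros Ha Dz Nz. apply contC_Rsumn. intros j Hj.
  apply contC_mult; [apply contC_const|].
  apply contC_carg; [apply closed_right_half; auto|].
  apply ccont_minus; [apply ccont_const|]. apply ccont_mult; [apply ccont_id|apply ccont_const].
Qed.

Lemma vortex_angle_bound N a d : exists B, forall z, Rabs (vortex_angle N a d z) <= B.
Proof.
  induction N as [|N [B IH]].
  - exists 0. intros z. unfold vortex_angle. simpl. rewrite Rabs_R0. lra.
  - exists (B + Rabs (IZR (d N)) * (PI / 2)). intros z. unfold vortex_angle in *. simpl.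
    eapply Rle_trans; [apply Rabs_triang|]. apply Rplus_le_compat; [apply IH|].
    rewrite Rabs_mult. apply Rmult_le_compat_l; [apply Rabs_pos|apply carg_bound].
Qed.

Lemma vortex_log_holo N a d n : (forall j, (j < N)%nat -> Cmod (a j) = 1) ->
  holo unit_disk n (vortex_log N a d).
Proof.
  intros Ha. apply holo_sum. intros j Hj. apply holo_mult; [apply holo_const|].
  now apply holo_vortex_factor, Ha.
Qed.

Lemma vortex_angle_harmonic N a d : (forall j, (j < N)%nat -> Cmod (a j) = 1) ->
  harmonic_on unit_disk (vortex_angle N a d).
Proof.
  intros Ha. replace (vortex_angle N a d) with (fun z => snd (vortex_log N a d z)).
  - apply harmonic_Im; [apply open_disk|]. now apply vortex_log_holo.
  - apply functional_extensionality. intros z. apply snd_vortex_log.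
Qed.

Lemma closure_disk z : closure_set unit_disk z <-> closed_unit_disk z.
Proof.
  unfold closed_unit_disk. split.
  - intros H. apply Rnot_lt_le. intros P. destruct (H (Cmod z - 1)) as [w [Dw Hw]]; [lra|].
    unfold unit_disk in Dw. assert (T := Cmod_sub_lower z w). rewrite Cmod_sub_sym in T. lra.
  - intros H e He. assert (Pz := Cmod_ge_0 z).
    set (t := Rmin (1/2) (e / 2)). assert (Pt : 0 < t) by (apply Rmin_pos; lra).
    assert (t <= 1/2) by apply Rmin_l. assert (t <= e / 2) by apply Rmin_r.
    exists (RtoC (1 - t) * z)%C. split.
    + unfold unit_disk. rewrite Cmod_mult, Cmod_R, Rabs_pos_eq by lra. nra.
    + replace (RtoC (1 - t) * z - z)%C with (- (RtoC t * z))%C by (rewrite RtoC_minus; ring).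
      rewrite Cmod_opp, Cmod_mult, Cmod_R, Rabs_pos_eq by lra. nra.
Qed.

Lemma conformal_id : conformal unit_disk (fun z => z) (fun _ => RtoC 1) (fun z => z).
Proof.
  split.
  - apply open_disk.
  - intros z. apply closure_disk.
  - intros w Hw. split; [now apply closure_disk|reflexivity].
  - reflexivity.
  - intros z _. apply cder_id.
  - intros z _. apply ccont_const.
  - intros z _ E. apply RtoC_inj in E. lra.
Qed.

(** For the identity map the angle has derivative 1, so every [arc_param] of the disk is the
    standard one up to rotation. *)
Lemma disk_arc_angle L gamma dgamma : arc_param unit_disk L gamma dgamma ->
  exists s0, L = 2 * PI /\ forall s, gamma s = expi (s0 + s) /\ dgamma s = (Ci * expi (s0 + s))%C.
Proof.
  intros A. destruct (conformal_arc_angle conformal_id A) as [sigma [H1 [H2 [H3 H4]]]].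
  assert (E : forall s, sigma s = sigma 0 + s).
  { assert (K : forall a b, RtoC (sigma a - a) = RtoC (sigma b - b)).
    { apply (rder_zero_const (fun s => RtoC (sigma s - s))). intros s.
      apply (rder_RtoC (fun s => sigma s - s)). specialize (H2 s).
      rewrite Cmod_1, Rinv_1 in H2. replace 0 with (1 - 1) by ring.
      apply (is_derive_minus (V := R_NormedModule) sigma (fun s => s)); [exact H2|apply @is_derive_id]. }
    intros s. specialize (K s 0). apply RtoC_inj in K. lra. }
  exists (sigma 0). split.
  - specialize (H3 0). rewrite Rplus_0_l, E in H3. lra.
  - intros s. rewrite <- E. split; [apply H1|]. rewrite H4. unfold Cdir. rewrite Cmod_1. field.
Qed.

(** Zeros of the cosine are [PI] apart, while continuity keeps [f t] within 1 of [f s]. *)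
Lemma continuity_pt_locally_const_cos (f : R -> R) s : continuity_pt f s ->
  (exists e, 0 < e /\ forall t, Rabs (t - s) < e -> cos (f t) = 0) -> locally_const f s.
Proof.
  rewrite continuity_pt_eps. intros Hf [e [He Hc]].
  destruct (Hf 1 Rlt_0_1) as [d [Hd K]].
  exists (Rmin e d). split; [now apply Rmin_pos|]. intros t Ht.
  assert (Ct := Hc t (Rlt_le_trans _ _ _ Ht (Rmin_l _ _))).
  specialize (K t (Rlt_le_trans _ _ _ Ht (Rmin_r _ _))).
  assert (Cs : cos (f s) = 0) by (apply Hc; rewrite Rminus_diag, Rabs_R0; exact He).
  assert (S : sin (f t - f s) = 0) by (rewrite sin_minus, Ct, Cs; ring).
  apply Rabs_def2 in K. assert (P := PI2_1).
  destruct (Rtotal_order (f t - f s) 0) as [L|[E|L]].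
  - assert (0 < sin (- (f t - f s))) by (apply sin_gt_0; lra). rewrite sin_neg in H. lra.
  - lra.
  - assert (0 < sin (f t - f s)) by (apply sin_gt_0; lra). lra.
Qed.

Lemma locally_const_plus f g s : locally_const f s -> locally_const g s ->
  locally_const (fun t => f t + g t) s.
Proof.
  intros [e [He H]] [d [Hd K]]. exists (Rmin e d). split; [now apply Rmin_pos|]. intros t Ht.
  rewrite H, K; [reflexivity| |].
  - eapply Rlt_le_trans; [apply Ht|apply Rmin_r].
  - eapply Rlt_le_trans; [apply Ht|apply Rmin_l].
Qed.

Lemma locally_const_interior f s a b c : a < s < b -> (forall t, a < t < b -> f t = c) ->
  locally_const f s.
Proof.
  intros Hs H. exists (Rmin (s - a) (b - s)). split; [apply Rmin_pos; lra|]. intros t Ht.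
  assert (M1 := Rmin_l (s - a) (b - s)). assert (M2 := Rmin_r (s - a) (b - s)).
  apply Rabs_def2 in Ht. rewrite !H by lra. reflexivity.
Qed.

Lemma vortex_angle_locally_const sigma L N a d (x : nat -> R) s : angle_lift sigma L ->
  (forall j, (j < N)%nat -> 0 <= x j < L /\ a j = expi (sigma (x j))) ->
  0 < s < L -> (forall j, (j < N)%nat -> s <> x j) ->
  locally_const (fun t => vortex_angle N a d (expi (sigma t)) - IZR (Zsumn N d) / 2 * sigma t) s.
Proof.
  intros A Hx Hs Ns. induction N as [|N IH].
  - exists 1. split; [lra|]. intros t _. unfold vortex_angle. simpl. field.
  - destruct (Hx N (Nat.lt_succ_diag_r N)) as [HxN Ea].
    specialize (IH (fun j Hj => Hx j (Nat.lt_lt_succ_r _ _ Hj))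
                   (fun j Hj => Ns j (Nat.lt_lt_succ_r _ _ Hj))).
    assert (St : locally_const (fun t => carg (RtoC 1 - expi (sigma t - sigma (x N)))%C - sigma t / 2) s).
    { assert (N1 := Ns N (Nat.lt_succ_diag_r N)).
      destruct (Rlt_dec s (x N)) as [L1|L1].
      - apply locally_const_interior with 0 (x N) ((PI - sigma (x N)) / 2); [lra|].
        intros t Ht. apply step_left with L; auto; lra.
      - apply locally_const_interior with (x N) L ((- PI - sigma (x N)) / 2); [lra|].
        intros t Ht. apply step_right with L; auto; lra. }
    destruct (locally_const_plus _ (fun t => IZR (d N) * (carg (RtoC 1 - expi (sigma t - sigma (x N)))%C - sigma t / 2)) s IH)
      as [e [He K]].
    { destruct St as [e [He K]]. exists e; split; auto. intros t Ht. now rewrite K. }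
    exists e; split; auto. intros t Ht. specialize (K t Ht).
    assert (R : forall t, vortex_angle (S N) a d (expi (sigma t)) - IZR (Zsumn (S N) d) / 2 * sigma t
      = vortex_angle N a d (expi (sigma t)) - IZR (Zsumn N d) / 2 * sigma t
        + IZR (d N) * (carg (RtoC 1 - expi (sigma t - sigma (x N)))%C - sigma t / 2)).
    { intros u. unfold vortex_angle. simpl. rewrite Ea, expi_conj, plus_IZR. field. }
    rewrite !R. exact K.
Qed.

(** Polynomial in the coordinates, hence smooth along the circle, and zero only at [w]: products of
    such factors are the test functions. *)
Definition sqdist (z w : C) : R :=
  (fst z - fst w) * (fst z - fst w) + (snd z - snd w) * (snd z - snd w).

Lemma sqdist_nz z w : z <> w -> sqdist z w <> 0.
Proof.
  intros N E. apply N. unfold sqdist in E.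
  assert (Q1 := Rle_0_sqr (fst z - fst w)). assert (Q2 := Rle_0_sqr (snd z - snd w)).
  unfold Rsqr in *. apply C_eq; nra.
Qed.

Lemma sqdist_diag z : sqdist z z = 0.
Proof. unfold sqdist. ring. Qed.

Lemma smooth_sqdist n s0 w : smooth n (fun s => sqdist (expi (s0 + s)) w).
Proof.
  destruct (smooth_trig n s0) as [H1 H2].
  apply smooth_plus; apply smooth_mult; apply smooth_plus; auto; apply smooth_const.
Qed.

Lemma smooth_periodic_C1 g L : smooth_periodic g L ->
  (forall s, is_derive g s (Derive g s)) /\ (forall s, continuous (Derive g) s).
Proof.
  intros [_ H]. split.
  - intros s. apply Derive_correct. exact (H 1%nat s).
  - intros s. apply (ex_derive_continuous (V := R_NormedModule) (Derive g)). exact (H 2%nat s).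
Qed.

Lemma dotC_expi x y : dotC (expi x) (expi y) = cos (x - y).
Proof. unfold dotC, expi. simpl. now rewrite cos_minus. Qed.

Lemma lifts_differ_const (f g : R -> R) : continuity f -> continuity g ->
  (forall s, expi (f s) = expi (g s)) -> forall s t, f s - g s = f t - g t.
Proof.
  intros Cf Cg E.
  assert (Lc : forall s, locally_const (fun s => f s - g s) s).
  (* The shift by [PI / 2] turns a multiple of [2 * PI] into a zero of the cosine. *)
  { intros s. assert (H : continuity_pt (fun s => f s - g s + PI / 2) s).
    { apply continuity_pt_plus; [now apply continuity_pt_minus|].
      apply continuity_pt_const. now intros x y. }
    apply continuity_pt_locally_const_cos in H.
    - destruct H as [e [He K]]. exists e; split; auto. intros t Ht. specialize (K t Ht). lra.
    - exists 1. split; [lra|]. intros t _. rewrite cos_plus, cos_PI2, sin_PI2, sin_minus.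
      specialize (E t). unfold expi in E. injection E as E1 E2. rewrite E1, E2. ring. }
  intros s t.
  destruct (locally_const_interval (fun s => f s - g s) (Rmin s t - 1) (Rmax s t + 1)) as [c Hc].
  - assert (Rmin s t <= Rmax s t) by (eapply Rle_trans; [apply Rmin_l|apply Rmax_l]). lra.
  - intros; apply Lc.
  - assert (A1 := Rmin_l s t). assert (A2 := Rmin_r s t).
    assert (B1 := Rmax_l s t). assert (B2 := Rmax_r s t).
    rewrite (Hc s) by lra. rewrite (Hc t) by lra. reflexivity.
Qed.

(** Off the vortices [phi - vortex_angle] is locally constant on the circle, since
    both are determined modulo [PI] by the tangent; testing the measure equation with a function that vanishes at all vortices
    but one shows that it does not jump there. *)
Lemma boundary_phase_const N a d L gamma dgamma theta phi :
  (forall j, (j < N)%nat -> Cmod (a j) = 1) ->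
  (forall i j, (i < N)%nat -> (j < N)%nat -> a i = a j -> i = j) ->
  Zsumn N d = 2%Z ->
  arc_param unit_disk L gamma dgamma ->
  (forall s, continuity_pt theta s /\ dgamma s = expi (theta s)) ->
  (forall s, (forall j, (j < N)%nat -> gamma s <> a j) ->
     continuity_pt (fun t => phi (gamma t)) s) ->
  (forall s, (forall j, (j < N)%nat -> gamma s <> a j) ->
     dotC (expi (phi (gamma s))) (outer_normal dgamma s) = 0) ->
  (forall psi : C -> R, smooth_periodic (fun s => psi (gamma s)) L ->
     RInt (fun s => phi (gamma s) * Derive (fun t => psi (gamma t)) s) 0 L
     = RInt (fun s => theta s * Derive (fun t => psi (gamma t)) s) 0 L
       - (theta L - theta 0) * psi (gamma 0)
       + PI * Rsumn N (fun j => IZR (d j) * psi (a j))) ->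
  exists c, forall z, Cmod z = 1 -> (forall j, (j < N)%nat -> z <> a j) ->
    phi z = vortex_angle N a d z + c.
Proof.
  intros Ha Hinj Hsum A Hth Hphic Hphi Hweak.
  destruct (disk_arc_angle L gamma dgamma A) as [s0 [EL Hg]].
  assert (PL : 0 < L) by apply A. assert (Ppi := PI_RGT_0).
  set (sigma := fun s => s0 + s).
  assert (AL : angle_lift sigma L).
  { unfold sigma. split; [exact PL|]. split; [intros; lra|]. rewrite EL. ring. }
  assert (X : forall j, exists x, (j < N)%nat -> 0 <= x < L /\ a j = gamma x).
  { intros j. destruct (Nat.lt_ge_cases j N) as [Hj|Hj].
    - destruct (conformal_circle_param 0 (a j) conformal_id A (Ha j Hj)) as [x [Hx E]].
      exists x. intros _. split; [lra|now symmetry].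
    - exists 0. intros; lia. }
  destruct (choice _ X) as [x Hx]. clear X.
  assert (Hx' : forall j, (j < N)%nat -> 0 <= x j < L /\ a j = expi (sigma (x j))).
  { intros j Hj. destruct (Hx j Hj) as [B E]. split; [exact B|]. rewrite E. apply Hg. }
  assert (Ginj : forall s t, 0 <= s < L -> 0 <= t < L -> gamma s = gamma t -> s = t).
  { intros s t Hs Ht. apply (arc_param_inj 0 s t A); lra. }
  assert (G0L : gamma L = gamma 0).
  { rewrite <- (proj1 (proj2 A) 0). f_equal. ring. }
  assert (Nv : forall s, 0 < s < L -> (forall k, (k < N)%nat -> s <> x k) ->
     forall j, (j < N)%nat -> gamma s <> a j).
  { intros s Hs Hk j Hj E. destruct (Hx j Hj) as [B E']. apply (Hk j Hj).
    apply Ginj; [lra|lra|congruence]. }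
  set (F := fun s => phi (gamma s) - vortex_angle N a d (gamma s)).
  assert (Vsig : forall s, vortex_angle N a d (gamma s) - sigma s
     = vortex_angle N a d (expi (sigma s)) - IZR (Zsumn N d) / 2 * sigma s).
  { intros s. rewrite Hsum. rewrite (proj1 (Hg s)). fold (sigma s). field. }
  assert (Lc : forall s, 0 < s < L -> (forall k, (k < N)%nat -> s <> x k) -> locally_const F s).
  { intros s Hs Hk. assert (Ns := Nv s Hs Hk).
    assert (V := vortex_angle_locally_const sigma L N a d x s AL Hx' Hs Hk).
    assert (Near : exists e, 0 < e /\ forall t, Rabs (t - s) < e ->
              forall j, (j < N)%nat -> gamma t <> a j).
    { assert (Q : forall n, (n <= N)%nat -> exists e, 0 < e /\ forall t, Rabs (t - s) < e ->
              forall j, (j < n)%nat -> t <> x j).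
      { induction n as [|n IH]; intros Hn.
        - exists 1. split; [lra|]. intros; lia.
        - destruct IH as [e [He K]]; [lia|]. assert (D : s - x n <> 0) by (specialize (Hk n Hn); lra).
          exists (Rmin e (Rabs (s - x n))). split; [apply Rmin_pos; [lra|now apply Rabs_pos_lt]|].
          intros t Ht j Hj. destruct (Nat.eq_dec j n) as [->|Nj].
          + intros ->. rewrite Rabs_minus_sym in Ht.
            assert (B := Rmin_r e (Rabs (s - x n))). lra.
          + apply K; [|lia]. eapply Rlt_le_trans; [apply Ht|apply Rmin_l]. }
      destruct (Q N (le_n N)) as [e [He K]].
      exists (Rmin e (Rmin s (L - s))). split; [repeat apply Rmin_pos; lra|].
      intros t Ht. assert (M1 := Rmin_l e (Rmin s (L - s))). assert (M2 := Rmin_r e (Rmin s (L - s))).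
      assert (M3 := Rmin_l s (L - s)). assert (M4 := Rmin_r s (L - s)).
      apply Nv.
      - apply Rabs_def2 in Ht. lra.
      - apply K. lra. }
    (* On the circle the outer normal is [expi (sigma t)], so tangency says that the cosine of this
       difference vanishes. *)
    assert (P : locally_const (fun t => phi (gamma t) - sigma t) s).
    { apply continuity_pt_locally_const_cos.
      - apply continuity_pt_minus; [now apply Hphic|].
        apply continuity_pt_plus; [apply continuity_pt_const; now intros u v|apply continuity_pt_id].
      - destruct Near as [e [He K]]. exists e; split; auto. intros t Ht.
        specialize (Hphi t (K t Ht)).
        replace (outer_normal dgamma t) with (expi (sigma t)) in Hphi.
        + now rewrite dotC_expi in Hphi.
        + unfold outer_normal. rewrite (proj2 (Hg t)). fold (sigma t).
          apply C_eq; simpl; ring. }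
    destruct P as [e1 [He1 K1]], V as [e2 [He2 K2]].
    exists (Rmin e1 e2). split; [now apply Rmin_pos|]. intros t Ht.
    specialize (K1 t (Rlt_le_trans _ _ _ Ht (Rmin_l _ _))).
    specialize (K2 t (Rlt_le_trans _ _ _ Ht (Rmin_r _ _))).
    rewrite <- !Vsig in K2. unfold F. lra. }
  (* The identity for [vortex_angle] is subtracted from the measure equation. Test functions
     vanishing at [gamma 0] remove the terms at the base point. *)
  assert (Zero : forall psi : C -> R, smooth_periodic (fun s => psi (gamma s)) L -> psi (gamma 0) = 0 ->
     forall v, is_RInt (fun s => F s * Derive (fun t => psi (gamma t)) s) 0 L v -> v = 0).
  { intros psi Hs Z0 v Hv. specialize (Hweak psi Hs).
    destruct (smooth_periodic_C1 _ _ Hs) as [Dg Cg].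
    set (g := fun s => psi (gamma s)) in *. set (g' := Derive g) in *.
    assert (GL : g L = g 0) by (unfold g; now rewrite G0L).
    assert (I1 := is_RInt_vortex_angle sigma L N a d x g g' AL Hx' Dg Cg GL).
    assert (Csig : forall s, continuous (fun s => sigma s * g' s) s).
    { intros s. apply (continuous_mult (K := R_AbsRing) sigma g'); [|apply Cg].
      apply continuity_continuous. apply continuity_pt_plus;
        [apply continuity_pt_const; now intros u w|apply continuity_pt_id]. }
    assert (I2 : is_RInt (fun s => sigma s * g' s) 0 L (RInt (fun s => sigma s * g' s) 0 L)).
    { apply (RInt_correct (V := R_CompleteNormedModule)).
      apply (ex_RInt_continuous (V := R_CompleteNormedModule)). intros; apply Csig. }
    assert (Cth : exists k, forall s, theta s = sigma s + k).
    { exists (theta 0 - sigma 0). intros s.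
      assert (Q := lifts_differ_const theta (fun s => sigma s + PI / 2)).
      assert (Q1 : theta s - (sigma s + PI / 2) = theta 0 - (sigma 0 + PI / 2)); [|lra].
      apply Q.
      - intros t. apply Hth.
      - intros t. apply continuity_pt_plus; [|apply continuity_pt_const; now intros u w].
        apply continuity_pt_plus; [apply continuity_pt_const; now intros u w|apply continuity_pt_id].
      - intros t. rewrite <- (proj2 (Hth t)), (proj2 (Hg t)), (expi_plus (sigma t)), expi_PI2. unfold sigma. ring. }
    destruct Cth as [k Hk].
    assert (I3 : is_RInt (fun s => theta s * g' s) 0 L (RInt (fun s => sigma s * g' s) 0 L)).
    { assert (I4 := is_RInt_const_derive (fun _ => k) g g' 0 L k (Rlt_le _ _ PL) (fun _ _ => eq_refl) Dg Cg).
      assert (I5 := is_RInt_plus (V := R_NormedModule) _ _ _ _ _ _ I2 I4).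
      evar_last.
      - apply (is_RInt_ext (V := R_NormedModule)) with (2 := I5).
        intros s _. rewrite Hk. unfold plus; simpl. ring.
      - unfold plus; simpl. rewrite GL. ring. }
    assert (I6 := is_RInt_plus (V := R_NormedModule) _ _ _ _ _ _ Hv
               (is_RInt_plus (V := R_NormedModule) _ _ _ _ _ _ I1 I2)).
    assert (I7 : is_RInt (fun s => phi (gamma s) * g' s) 0 L
      (v + (PI * Rsumn N (fun j => IZR (d j) * g (x j)) - IZR (Zsumn N d) * PI * g 0
            + RInt (fun s => sigma s * g' s) 0 L))).
    { evar_last.
      - apply (is_RInt_ext (V := R_NormedModule)) with (2 := I6).
        intros s _. unfold plus; simpl. unfold F. rewrite <- Vsig. ring.
      - reflexivity. }
    rewrite (is_RInt_unique _ _ _ _ I7), (is_RInt_unique _ _ _ _ I3) in Hweak.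
    change (psi (gamma 0)) with (g 0) in Hweak, Z0.
    rewrite Z0 in Hweak.
    replace (Rsumn N (fun j => IZR (d j) * psi (a j)))
      with (Rsumn N (fun j => IZR (d j) * g (x j))) in Hweak.
    - lra.
    - apply Rsumn_ext. intros j Hj. unfold g. now rewrite (proj2 (Hx j Hj)). }
  assert (Jump : forall k, (k < N)%nat -> 0 < x k < L -> exists c e, 0 < e /\
     forall t, 0 < Rabs (t - x k) < e -> F t = c).
  { intros j Hj Bj.
    (* The index [j] is redirected to 0, where the test function vanishes too; thus all listed jump
       points are zeros of it, and [x j] is left as the common end of two intervals. *)
    set (p := fun k => if Nat.eq_dec k j then 0 else x k).
    destruct (piecewise_const_integral N p F 0 (x j)) as [fa [f1 [e1 [He1 [_ [B1 I1]]]]]]; [lra| |].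
    { intros s Hs Hk. apply Lc; [lra|]. intros k Hk'. destruct (Nat.eq_dec k j) as [->|Nk]; [lra|].
      specialize (Hk k Hk'). unfold p in Hk. now destruct Nat.eq_dec. }
    destruct (piecewise_const_integral N p F (x j) L) as [f2 [fb [e2 [He2 [A2 [_ I2]]]]]]; [lra| |].
    { intros s Hs Hk. apply Lc; [lra|]. intros k Hk'. destruct (Nat.eq_dec k j) as [->|Nk]; [lra|].
      specialize (Hk k Hk'). unfold p in Hk. now destruct Nat.eq_dec. }
    set (psi := fun z => sqdist z (gamma 0) *
       Rprod N (fun k => if Nat.eq_dec k j then 1 else sqdist z (a k))).
    assert (Hs : smooth_periodic (fun s => psi (gamma s)) L).
    { split; [intros s; now rewrite (proj1 (proj2 A))|]. intros n s. apply smooth_ex_derive_n.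
      assert (Sm : forall m w, smooth m (fun s => sqdist (gamma s) w)).
      { intros m w. replace (fun s => sqdist (gamma s) w) with (fun s => sqdist (expi (s0 + s)) w).
        - apply smooth_sqdist.
        - apply functional_extensionality. intros t. now rewrite (proj1 (Hg t)). }
      apply smooth_mult; [apply Sm|].
      apply (smooth_Rprod n N (fun k s => if Nat.eq_dec k j then 1 else sqdist (gamma s) (a k))).
      intros k. destruct (Nat.eq_dec k j); [apply smooth_const|apply Sm]. }
    destruct (smooth_periodic_C1 _ _ Hs) as [Dg Cg].
    set (g := fun s => psi (gamma s)) in *.
    assert (g0 : g 0 = 0) by (unfold g, psi; rewrite sqdist_diag; ring).
    assert (gL : g L = 0) by (unfold g; rewrite G0L; exact g0).
    assert (gk : forall k, (k < N)%nat -> g (p k) = 0).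
    { intros k Hk. unfold p. destruct (Nat.eq_dec k j) as [E|Nk]; [exact g0|].
      unfold g, psi. rewrite (Rprod_zero _ _ k Hk); [ring|].
      destruct Nat.eq_dec; [easy|]. rewrite (proj2 (Hx k Hk)). apply sqdist_diag. }
    assert (gj : g (x j) <> 0).
    { unfold g, psi. apply Rmult_integral_contrapositive_currified.
      - apply sqdist_nz. intros E. assert (x j = 0); [|lra]. apply Ginj; auto; lra.
      - apply Rprod_nz. intros k Hk. destruct (Nat.eq_dec k j) as [E|Nk]; [lra|].
        apply sqdist_nz. rewrite <- (proj2 (Hx j Hj)). intros E. apply Nk. symmetry. now apply Hinj. }
    specialize (I1 g (Derive g) Dg Cg gk). specialize (I2 g (Derive g) Dg Cg gk).
    assert (V := Zero psi Hs g0 _ (is_RInt_Chasles (V := R_NormedModule) _ _ _ _ _ _ I1 I2)).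
    unfold plus in V; simpl in V. rewrite g0, gL in V.
    assert (E : f1 = f2) by nra.
    exists f1, (Rmin e1 e2). split; [now apply Rmin_pos|]. intros t [Ht1 Ht2].
    assert (M1 := Rmin_l e1 e2). assert (M2 := Rmin_r e1 e2). apply Rabs_def2 in Ht2.
    destruct (Rtotal_order t (x j)) as [Lt|[Et|Gt]].
    - apply B1. lra.
    - exfalso. subst t. rewrite Rminus_diag, Rabs_R0 in Ht1. lra.
    - rewrite E. apply A2. lra. }
  destruct (removable_jumps_const N x F 0 L PL Lc Jump) as [c [e [He [Near0 [_ Hc]]]]].
  exists c. intros z Hz Nz.
  destruct (conformal_circle_param 0 z conformal_id A Hz) as [s [Hs Es]].
  rewrite Rplus_0_l in Hs. subst z.
  enough (F s = c) by (unfold F in H; lra).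
  (* The base point is an end of the parameter interval. In this case it is not a vortex, and
     continuity extends the constant to it. *)
  destruct (Req_dec s 0) as [->|Ns].
  - assert (CF : continuity_pt F 0).
    { apply continuity_pt_minus; [now apply Hphic|].
      apply (rcont_parts (fun t => RtoC (vortex_angle N a d (gamma t)))).
      apply (ccont_RtoC Rline (fun w => vortex_angle N a d (gamma (fst w)))).
      intros ep Hep. destruct (vortex_angle_contC N a d (gamma 0) Ha) with (eps := ep) as [d1 [Hd1 K1]]; auto.
      { unfold closed_unit_disk. lra. }
      destruct (rder_rcont _ _ _ (arc_param_rder 0 A) d1 Hd1) as [d2 [Hd2 K2]].
      exists d2; split; auto. intros w Dw Hw. apply K1; [|now apply K2].
      rewrite (proj1 (Hg (fst w))). apply closed_disk_expi. }
    rewrite continuity_pt_eps in CF. apply NNPP. intros NE.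
    destruct (CF (Rabs (F 0 - c))) as [d1 [Hd1 K]]; [apply Rabs_pos_lt; lra|].
    set (t := Rmin (d1 / 2) (e / 2)). assert (Pt : 0 < t) by (apply Rmin_pos; lra).
    assert (t <= d1 / 2) by apply Rmin_l. assert (t <= e / 2) by apply Rmin_r.
    specialize (K t). rewrite Rminus_0_r, (Rabs_pos_eq t) in K by lra. specialize (K ltac:(lra)).
    rewrite (Near0 t) in K by lra. rewrite Rabs_minus_sym in K. lra.
  - apply Hc; [lra|]. intros k Hk E. apply (Nz k Hk). rewrite E. symmetry. apply Hx, Hk.
Qed.

(** The boundary values identify the interior phase through [lindelof_uniqueness]. Tangency is
    retained as a second conclusion: it fixes the sign at [b] and yields tangency on the boundary of
    [Om]. *)
Lemma canonical_disk_phase N a d m :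
  (forall j, (j < N)%nat -> Cmod (a j) = 1) ->
  (forall i j, (i < N)%nat -> (j < N)%nat -> a i = a j -> i = j) ->
  Zsumn N d = 2%Z -> canonical_harmonic unit_disk N a d m ->
  exists c, (forall z, unit_disk z -> m z = expi (vortex_angle N a d z + c)) /\
    forall z, Cmod z = 1 -> (forall j, (j < N)%nat -> z <> a j) ->
      dotC (expi (vortex_angle N a d z + c)) z = 0.
Proof.
  intros Ha Hinj Hsum (L & gamma & dgamma & theta & phi & phis & A & Hv & Hth & _ & Hphic & Hphi
    & Hweak & Hharm & [M HM] & Hbd & Hm).
  destruct (boundary_phase_const N a d L gamma dgamma theta phi) as [c Hc]; auto.
  exists c.
  destruct (disk_arc_angle L gamma dgamma A) as [s0 [EL Hg]].
  assert (Circ : forall z, Cmod z = 1 -> exists s, gamma s = z).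
  { intros z Hz. destruct (conformal_circle_param 0 z conformal_id A Hz) as [s [_ Es]].
    now exists s. }
  assert (Hh := vortex_angle_harmonic N a d Ha).
  assert (E : forall z, unit_disk z -> phis z + (-1 * vortex_angle N a d z + - c) = 0).
  { destruct (vortex_angle_bound N a d) as [B HB].
    apply (lindelof_uniqueness N a (fun z => phis z + (-1 * vortex_angle N a d z + - c)) (M + (B + Rabs c))); auto.
    - replace 0 with (0 + (-1 * 0 + 0)) by ring.
      apply has_laplacian_plus; [now apply harmonic_laplacian|].
      apply has_laplacian_plus; [|apply has_laplacian_const].
      apply has_laplacian_scal. now apply harmonic_laplacian.
    - intros z Dz. apply contC_plus; [now apply harmonic_contC|].
      apply contC_plus; [|apply contC_const]. apply contC_mult; [apply contC_const|].
      now apply harmonic_contC.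
    - intros z Dz. eapply Rle_trans; [apply Rabs_triang|]. apply Rplus_le_compat; [now apply HM|].
      eapply Rle_trans; [apply Rabs_triang|]. rewrite Rabs_Ropp. apply Rplus_le_compat; [|lra].
      rewrite Rabs_mult. replace (Rabs (-1)) with 1 by (rewrite Rabs_left; lra).
      rewrite Rmult_1_l. apply HB.
    - intros z Hz Nz e He. destruct (Circ z Hz) as [s <-].
      destruct (Hbd s Nz (e / 2)) as [d1 [Hd1 K1]]; [lra|].
      destruct (vortex_angle_contC N a d (gamma s) Ha) with (eps := e / 2) as [d2 [Hd2 K2]]; auto; [|lra|].
      { unfold closed_unit_disk. lra. }
      exists (Rmin d1 d2). split; [now apply Rmin_pos|]. intros w Dw Hw.
      specialize (K1 w Dw (Rlt_le_trans _ _ _ Hw (Rmin_l _ _))).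
      specialize (K2 w (disk_closed w Dw) (Rlt_le_trans _ _ _ Hw (Rmin_r _ _))).
      rewrite (Hc _ Hz Nz) in K1.
      apply Rabs_def1; apply Rabs_def2 in K1; apply Rabs_def2 in K2; lra. }
  split.
  - intros z Dz. rewrite (Hm z Dz). f_equal. specialize (E z Dz). lra.
  - intros z Hz Nz. destruct (Circ z Hz) as [s <-].
    specialize (Hphi s Nz). rewrite (Hc _ Hz Nz) in Hphi.
    replace (outer_normal dgamma s) with (gamma s) in Hphi; [exact Hphi|].
    unfold outer_normal. destruct (Hg s) as [-> ->]. apply C_eq; simpl; ring.
Qed.

Lemma expi_Rsumn n f : expi (Rsumn n f) = Cprod n (fun j => expi (f j)).
Proof.
  induction n as [|n IH]; simpl; [apply expi_0|]. now rewrite expi_plus, IH.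
Qed.

Lemma Cprod_ext n f g : (forall k, (k < n)%nat -> f k = g k) -> Cprod n f = Cprod n g.
Proof.
  intros H. induction n as [|n IH]; simpl; [reflexivity|].
  rewrite IH, H by (intros; try apply H; lia). reflexivity.
Qed.

Lemma Cpown_expi t n : Cpown (expi t) n = expi (INR n * t).
Proof.
  induction n as [|n IH].
  - simpl. now rewrite Rmult_0_l, expi_0.
  - simpl Cpown. rewrite IH, S_INR, <- expi_plus. f_equal. ring.
Qed.

Lemma expi_inv t : (/ expi t)%C = expi (- t).
Proof.
  replace (expi (- t)) with (/ expi t * (expi t * expi (- t)))%C by (field; apply expi_nz).
  rewrite expi_opp. ring.
Qed.

Lemma Cpowz_expi t k : Cpowz (expi t) k = expi (IZR k * t).
Proof.
  unfold Cpowz. destruct (Z.leb_spec 0 k) as [H|H].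
  - rewrite Cpown_expi, INR_IZR_INZ, Z2Nat.id by exact H. reflexivity.
  - rewrite expi_inv, Cpown_expi, INR_IZR_INZ, Z2Nat.id, opp_IZR by lia. f_equal. ring.
Qed.

(** For [a] on the circle, [z - a] is [- a] times [RtoC 1 - z * Cconj a]. *)
Lemma vortex_factor_expi z a : closed_unit_disk z -> Cmod a = 1 -> z <> a ->
  Cdir (z - a)%C = (- a * expi (carg (RtoC 1 - z * Cconj a)%C))%C.
Proof.
  intros Dz Ha N. assert (H := closed_right_half z a Dz Ha N).
  rewrite (expi_carg _ H), vortex_factor_abs by exact Ha.
  assert (E : (a * Cconj a)%C = RtoC 1).
  { rewrite <- Cmod2_conj, Ha. simpl. now rewrite !Rmult_1_r. }
  unfold Cdir, Cdiv.
  replace (- a * ((RtoC 1 - z * Cconj a) * / RtoC (Cmod (z - a))))%C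
    with (- (a - z * (a * Cconj a)) * / RtoC (Cmod (z - a)))%C by ring.
  rewrite E. ring.
Qed.

(** In each factor the constants [- a j] of numerator and denominator cancel, and what remains is
    the exponential of a difference of arguments, whose integer power multiplies the angle. *)
Lemma disk_map_expi N a d b z : (forall j, (j < N)%nat -> Cmod (a j) = 1) ->
  Cmod b = 1 -> (forall j, (j < N)%nat -> b <> a j) -> unit_disk z ->
  disk_map N a d b z = (Ci * b * expi (vortex_angle N a d z - vortex_angle N a d b))%C.
Proof.
  intros Ha Hb Nb Dz. unfold disk_map. f_equal.
  replace (vortex_angle N a d z - vortex_angle N a d b)
    with (Rsumn N (fun j => IZR (d j) * (carg (RtoC 1 - z * Cconj (a j))%C - carg (RtoC 1 - b * Cconj (a j))%C))).
  2:{ unfold vortex_angle. clear. induction N as [|N IH]; simpl; [ring|]. rewrite IH. ring. }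
  rewrite expi_Rsumn. apply Cprod_ext. intros j Hj.
  rewrite <- Cpowz_expi. f_equal.
  assert (Nz : z <> a j) by (intros ->; unfold unit_disk in Dz; rewrite Ha in Dz by exact Hj; lra).
  assert (V1 := vortex_factor_expi z (a j) (disk_closed z Dz) (Ha j Hj) Nz).
  assert (V2 := vortex_factor_expi b (a j)).
  specialize (V2 ltac:(unfold closed_unit_disk; lra) (Ha j Hj) (Nb j Hj)).
  assert (Nba : (b - a j)%C <> RtoC 0) by (apply Cmod_gt_0, Cmod_pos_sub, Nb, Hj).
  change (Cdiv (z - a j)%C (RtoC (Cmod (z - a j)))) with (Cdir (z - a j)).
  replace (Cdiv (RtoC (Cmod (b - a j))) (b - a j)%C) with (/ Cdir (b - a j))%C.
  - rewrite V1, V2. unfold Rminus. rewrite expi_plus, <- expi_inv. field.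
    split; [apply expi_nz|]. apply Cmod_gt_0. rewrite Ha by exact Hj. lra.
  - unfold Cdir. field. split; [exact Nba|now apply RtoC_Cmod_nz].
Qed.

Lemma tangent_phase_sign t b : Cmod b = 1 -> dotC (expi t) b = 0 ->
  expi t = (Ci * b)%C \/ expi t = (- (Ci * b))%C.
Proof.
  intros Hb H. destruct (expi_exists b Hb) as [y ->]. rewrite dotC_expi in H.
  assert (S : sin (t - y) * sin (t - y) = 1).
  { assert (Q := sin2_cos2 (t - y)). unfold Rsqr in Q. rewrite H in Q. lra. }
  assert (E : expi t = (expi (t - y) * expi y)%C) by (rewrite <- expi_plus; f_equal; ring).
  destruct (Req_dec (sin (t - y)) 1) as [S1|S1].
  - left. rewrite E. f_equal. unfold expi. now rewrite H, S1.
  - right. assert (S2 : sin (t - y) = -1) by nra.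
    rewrite E. replace (- (Ci * expi y))%C with (- Ci * expi y)%C by ring. f_equal.
    apply C_eq; unfold expi; simpl; lra.
Qed.

Lemma canonical_disk_formula N a d b m :
  (forall j, (j < N)%nat -> Cmod (a j) = 1) ->
  (forall i j, (i < N)%nat -> (j < N)%nat -> a i = a j -> i = j) ->
  Zsumn N d = 2%Z -> Cmod b = 1 -> (forall j, (j < N)%nat -> b <> a j) ->
  canonical_harmonic unit_disk N a d m ->
  (forall z, unit_disk z -> m z = disk_map N a d b z) \/
  (forall z, unit_disk z -> m z = Copp (disk_map N a d b z)).
Proof.
  intros Ha Hinj Hsum Hb Nb Hm.
  destruct (canonical_disk_phase N a d m Ha Hinj Hsum Hm) as [c [Hc Hn]].
  assert (Sg := tangent_phase_sign _ b Hb (Hn b Hb Nb)).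
  assert (Split : forall z, expi (vortex_angle N a d z + c)
     = (expi (vortex_angle N a d b + c) * expi (vortex_angle N a d z - vortex_angle N a d b))%C).
  { intros z. rewrite <- expi_plus. f_equal. ring. }
  destruct Sg as [S|S]; [left|right]; intros z Dz;
    rewrite (Hc z Dz), Split, S, disk_map_expi by auto; ring.
Qed.

(** * Canonical maps of conformal images *)

Lemma Rsumn_plus n f g : Rsumn n (fun k => f k + g k) = Rsumn n f + Rsumn n g.
Proof. induction n as [|n IH]; simpl; [ring|]. rewrite IH. ring. Qed.

Lemma Rsumn_scal n c f : Rsumn n (fun k => c * f k) = c * Rsumn n f.
Proof. induction n as [|n IH]; simpl; [ring|]. rewrite IH. ring. Qed.

Lemma Rsumn_le n f g : (forall k, (k < n)%nat -> f k <= g k) -> Rsumn n f <= Rsumn n g.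
Proof.
  intros H. induction n as [|n IH]; simpl; [lra|].
  apply Rplus_le_compat; [apply IH; intros; apply H; lia|apply H; lia].
Qed.

Lemma partition_monotone n (t : nat -> R) : (forall i, (i < n)%nat -> t i <= t (S i)) ->
  forall i j, (i <= j)%nat -> (j <= n)%nat -> t i <= t j.
Proof.
  intros H i j Hij. induction Hij as [|j Hij IH]; intros Hj; [lra|].
  eapply Rle_trans; [apply IH; lia|apply H; lia].
Qed.

Lemma bounded_variation_plus f g L : bounded_variation f L -> bounded_variation g L ->
  bounded_variation (fun s => f s + g s) L.
Proof.
  intros [M HM] [K HK]. exists (M + K). intros n t H0 H1 H2.
  apply Rle_trans with (Rsumn n (fun i => Rabs (f (t (S i)) - f (t i)) + Rabs (g (t (S i)) - g (t i)))).
  - apply Rsumn_le. intros k _.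
    replace (f (t (S k)) + g (t (S k)) - (f (t k) + g (t k)))
      with ((f (t (S k)) - f (t k)) + (g (t (S k)) - g (t k))) by ring. apply Rabs_triang.
  - rewrite Rsumn_plus. apply Rplus_le_compat; auto.
Qed.

Lemma bounded_variation_scal c f L : bounded_variation f L -> bounded_variation (fun s => c * f s) L.
Proof.
  intros [M HM]. exists (Rabs c * M). intros n t H0 H1 H2.
  replace (Rsumn n (fun i => Rabs (c * f (t (S i)) - c * f (t i))))
    with (Rabs c * Rsumn n (fun i => Rabs (f (t (S i)) - f (t i)))).
  - apply Rmult_le_compat_l; [apply Rabs_pos|auto].
  - rewrite <- Rsumn_scal. apply Rsumn_ext. intros k _. rewrite <- Rabs_mult. f_equal. ring.
Qed.

Lemma bounded_variation_lipschitz f L K :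
  (forall s t, 0 <= s <= L -> 0 <= t <= L -> Rabs (f t - f s) <= K * Rabs (t - s)) ->
  0 <= K -> bounded_variation f L.
Proof.
  intros H PK. exists (K * L). intros n t H0 H1 H2.
  assert (Mon := partition_monotone n t H2).
  assert (Q : forall k, (k <= n)%nat ->
    Rsumn k (fun i => Rabs (f (t (S i)) - f (t i))) <= K * (t k - t 0%nat)).
  { induction k as [|k IH]; intros Hk; simpl; [lra|].
    specialize (IH ltac:(lia)).
    assert (A1 := Mon 0%nat k ltac:(lia) ltac:(lia)). assert (A2 := Mon k (S k) ltac:(lia) Hk).
    assert (A3 := Mon (S k) n Hk (le_n n)).
    assert (B := H (t k) (t (S k)) ltac:(lra) ltac:(lra)).
    rewrite (Rabs_pos_eq (t (S k) - t k)) in B by lra. lra. }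
  eapply Rle_trans; [apply Q, le_n|]. apply Rmult_le_compat_l; lra.
Qed.

Lemma bounded_variation_antitone f L :
  (forall s t, 0 <= s -> s <= t -> t <= L -> f t <= f s) -> bounded_variation f L.
Proof.
  intros H. exists (f 0 - f L). intros n t H0 H1 H2.
  assert (Mon := partition_monotone n t H2).
  assert (Q : forall k, (k <= n)%nat ->
    Rsumn k (fun i => Rabs (f (t (S i)) - f (t i))) = f (t 0%nat) - f (t k)).
  { induction k as [|k IH]; intros Hk; simpl; [ring|].
    rewrite IH by lia.
    assert (A1 := Mon 0%nat k ltac:(lia) ltac:(lia)). assert (A2 := Mon k (S k) ltac:(lia) Hk).
    assert (A3 := Mon (S k) n Hk (le_n n)).
    assert (B := H (t k) (t (S k)) ltac:(lra) A2 ltac:(lra)).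
    rewrite Rabs_left1 by lra. ring. }
  rewrite (Q n (le_n n)). assert (A := Mon 0%nat n ltac:(lia) (le_n n)).
  assert (f (t 0%nat) <= f 0) by (apply H; lra).
  assert (f L <= f (t n)) by (apply H; lra). lra.
Qed.

Lemma carg_vortex_value : carg (RtoC 1 - RtoC 1)%C = 0.
Proof.
  unfold carg. replace (snd (RtoC 1 - RtoC 1)%C) with 0 by (simpl; ring).
  unfold Rdiv. rewrite Rmult_0_l. apply atan_0.
Qed.

(* At the vortex itself [carg] takes the junk value [0], which lies between the
   two one-sided limits, so that the step stays monotone. *)
Lemma bounded_variation_step sigma L x : angle_lift sigma L -> 0 <= x < L ->
  bounded_variation (fun s => carg (RtoC 1 - expi (sigma s - sigma x))%C - sigma s / 2) L.
Proof.
  intros A Hx. assert (Ppi := PI_RGT_0). assert (A' := A). destruct A' as [PL [Inc Per]].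
  assert (Mid : carg (RtoC 1 - expi (sigma x - sigma x))%C - sigma x / 2 = - sigma x / 2).
  { rewrite Rminus_diag, expi_0, carg_vortex_value. field. }
  (* With the vortex at the base point, [s = L] meets it again. The value there is lower than the
     one before it, so monotonicity survives. *)
  assert (Last : x = 0 -> carg (RtoC 1 - expi (sigma L - sigma x))%C - sigma L / 2 = - sigma x / 2 - PI).
  { intros ->. rewrite Per. replace (sigma 0 + 2 * PI - sigma 0) with (2 * PI) by ring.
    rewrite expi_2PI, carg_vortex_value. field. }
  apply bounded_variation_antitone. intros s t Hs Hst Ht.
  destruct (Req_dec s t) as [->|Nst]; [lra|].
  assert (Gt : forall u, x < u <= L -> carg (RtoC 1 - expi (sigma u - sigma x))%C - sigma u / 2
      = (- PI - sigma x) / 2 \/ (x = 0 /\ u = L)).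
  { intros u Hu. destruct (classic (x = 0 /\ u = L)) as [E|E]; [now right|left].
    apply step_right with L; auto. destruct (Rlt_dec 0 x); [now left|right].
    assert (x = 0) by lra. destruct (Req_dec u L); [exfalso; tauto|lra]. }
  destruct (Rtotal_order s x) as [L1|[->|L1]].
  - rewrite (step_left sigma L x s) by (auto; lra).
    destruct (Rtotal_order t x) as [L2|[->|L2]].
    + rewrite (step_left sigma L x t) by (auto; lra). lra.
    + rewrite Mid. lra.
    + destruct (Gt t) as [->|[E1 E2]]; lra.
  - rewrite Mid. destruct (Gt t) as [->|[E1 ->]]; [lra|lra|]. rewrite Last by exact E1. lra.
  - destruct (Gt s) as [->|[E1 E2]]; [lra| |lra].
    destruct (Gt t) as [->|[E1 ->]]; [lra|lra|]. rewrite Last by exact E1. lra.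
Qed.

Lemma bounded_variation_vortex_angle sigma L N a d (x : nat -> R) : angle_lift sigma L ->
  (forall j, (j < N)%nat -> 0 <= x j < L /\ a j = expi (sigma (x j))) ->
  bounded_variation (fun s => vortex_angle N a d (expi (sigma s)) - IZR (Zsumn N d) / 2 * sigma s) L.
Proof.
  intros A Hx. induction N as [|N IH].
  - apply bounded_variation_antitone. intros s t _ _ _. unfold vortex_angle. simpl. lra.
  - destruct (Hx N (Nat.lt_succ_diag_r N)) as [HxN Ea].
    specialize (IH (fun j Hj => Hx j (Nat.lt_lt_succ_r _ _ Hj))).
    assert (H := bounded_variation_plus _ _ L IH
      (bounded_variation_scal (IZR (d N)) _ L (bounded_variation_step sigma L (x N) A HxN))).
    destruct H as [M HM]. exists M. intros n t H0 H1 H2.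
    rewrite <- (Rsumn_ext n (fun i => Rabs
      (vortex_angle N a d (expi (sigma (t (S i)))) - IZR (Zsumn N d) / 2 * sigma (t (S i))
       + IZR (d N) * (carg (RtoC 1 - expi (sigma (t (S i)) - sigma (x N)))%C - sigma (t (S i)) / 2)
       - (vortex_angle N a d (expi (sigma (t i))) - IZR (Zsumn N d) / 2 * sigma (t i)
       + IZR (d N) * (carg (RtoC 1 - expi (sigma (t i) - sigma (x N)))%C - sigma (t i) / 2))))).
    + now apply HM.
    + intros k _. f_equal. unfold vortex_angle. simpl. rewrite Ea, !expi_conj, plus_IZR. field.
Qed.

(** With [u = x - y], [sin u] is [u cos v] for some [v] between 0 and [u], and [cos v] is at least
    1/2 because [1 < PI / 3]. *)
Lemma expi_chord_lower x y : Rabs (x - y) <= 1 -> Rabs (x - y) <= 2 * Cmod (expi x - expi y)%C.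
Proof.
  intros H.
  assert (E : Cmod (expi x - expi y)%C = Cmod (expi (x - y) - RtoC 1)%C).
  { replace (expi x - expi y)%C with (expi y * (expi (x - y) - RtoC 1))%C.
    - rewrite Cmod_mult, Cmod_expi. ring.
    - replace x with (y + (x - y)) at 2 by ring. rewrite expi_plus. ring. }
  rewrite E. set (u := x - y) in *.
  assert (B : Rabs (sin u) <= Cmod (expi u - RtoC 1)%C).
  { eapply Rle_trans; [|apply Cmod_snd]. right. f_equal. simpl. ring. }
  destruct (MVT_gen sin 0 u cos) as [v [Hv Ev]].
  - intros t _. apply is_derive_Reals, derivable_pt_lim_sin.
  - intros t _. apply derivable_continuous_pt, derivable_pt_sin.
  - rewrite sin_0, !Rminus_0_r in Ev.
    assert (Bv : -1 <= v <= 1).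
    { apply Rabs_le_between in H. unfold Rmin, Rmax in Hv. destruct Rle_dec; lra. }
    assert (Cv : 1 / 2 <= cos v).
    { assert (P := PI2_3_2). rewrite <- cos_PI3.
      destruct (Rle_dec 0 v).
      - apply cos_decr_1; lra.
      - rewrite <- (cos_neg v). apply cos_decr_1; lra. }
    rewrite Ev, Rabs_mult, (Rabs_pos_eq (cos v)) in B by lra.
    assert (Pu := Rabs_pos u). nra.
Qed.

(** Chords control angles only when the angles differ by at most 1, which uniform continuity ensures
    for close parameters. Subdivision carries the bound to the whole interval with the same
    constant. *)
Lemma angle_lipschitz theta L K : continuity theta -> 0 <= K ->
  (forall s t, Cmod (expi (theta s) - expi (theta t))%C <= K * Rabs (s - t)) ->
  forall s t, 0 <= s <= L -> 0 <= t <= L -> Rabs (theta t - theta s) <= 2 * K * Rabs (t - s).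
Proof.
  intros Cth PK HK.
  destruct (Heine theta (fun x => 0 <= x <= L) (compact_P3 0 L) (fun x _ => Cth x)
             (mkposreal 1 Rlt_0_1)) as [[d Hd] Hu]. simpl in Hu.
  assert (Loc : forall s t, 0 <= s <= L -> 0 <= t <= L -> Rabs (t - s) < d ->
     Rabs (theta t - theta s) <= 2 * K * Rabs (t - s)).
  { intros s t Hs Ht Hst. eapply Rle_trans; [apply expi_chord_lower; left; now apply Hu|].
    specialize (HK t s). lra. }
  assert (Q : forall n s t, 0 <= s <= L -> 0 <= t <= L -> Rabs (t - s) <= INR n * (d / 2) ->
     Rabs (theta t - theta s) <= 2 * K * Rabs (t - s)).
  { induction n as [|n IH]; intros s t Hs Ht Hst.
    - simpl in Hst. apply Loc; auto. generalize (Rabs_pos (t - s)). lra.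
    - rewrite S_INR in Hst. assert (Pn := pos_INR n).
      (* Splits off the last of [n + 1] equal pieces, whose length is at most [d / 2]. *)
      set (r := INR n / (INR n + 1)).
      assert (Er : r * (INR n + 1) = INR n) by (unfold r; field; lra).
      assert (Br : 0 <= r < 1).
      { split; [apply Rdiv_le_0_compat; lra|]. apply Rmult_lt_reg_r with (INR n + 1); lra. }
      set (u := s + r * (t - s)).
      assert (Hu1 : 0 <= u <= L) by (unfold u; nra).
      assert (E1 : Rabs (u - s) = r * Rabs (t - s)).
      { replace (u - s) with (r * (t - s)) by (unfold u; ring). rewrite Rabs_mult, (Rabs_pos_eq r); lra. }
      assert (E2 : Rabs (t - u) = (1 - r) * Rabs (t - s)).
      { replace (t - u) with ((1 - r) * (t - s)) by (unfold u; ring).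
        rewrite Rabs_mult, (Rabs_pos_eq (1 - r)); lra. }
      assert (A1 := IH s u Hs Hu1). rewrite E1 in A1.
      assert (A2 := Loc u t Hu1 Ht). rewrite E2 in A2.
      assert (B1 : r * Rabs (t - s) <= INR n * (d / 2)).
      { replace (INR n * (d / 2)) with (r * ((INR n + 1) * (d / 2))) by (rewrite <- Er at 2; ring).
        apply Rmult_le_compat_l; lra. }
      assert (B2 : (1 - r) * Rabs (t - s) < d).
      { assert ((1 - r) * (INR n + 1) = 1) by lra.
        apply Rle_lt_trans with ((1 - r) * ((INR n + 1) * (d / 2))).
        - apply Rmult_le_compat_l; lra.
        - rewrite <- Rmult_assoc, H. lra. }
      specialize (A1 B1). specialize (A2 B2).
      replace (theta t - theta s) with ((theta t - theta u) + (theta u - theta s)) by ring.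
      eapply Rle_trans; [apply Rabs_triang|]. lra. }
  intros s t Hs Ht.
  destruct (INR_unbounded (Rabs (t - s) / (d / 2))) as [n Hn].
  apply (Q n); auto.
  replace (Rabs (t - s)) with (Rabs (t - s) / (d / 2) * (d / 2)) by (field; lra).
  apply Rmult_le_compat_r; lra.
Qed.

Lemma contC_curve D u c s : contC_within D u (c s) -> (forall t, D (c t)) -> rcont c s ->
  continuity_pt (fun t => u (c t)) s.
Proof.
  intros Hu HD Hc. apply continuity_pt_eps. intros e He.
  destruct (Hu e He) as [d1 [Hd1 K1]].
  destruct (proj1 (rcont_eps c s) Hc d1 Hd1) as [d2 [Hd2 K2]].
  exists d2; split; auto.
Qed.

Lemma is_derive_C_cder (f : C -> C) z l :
  @is_derive C_AbsRing C_NormedModule f z l -> cder everywhere f z l.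
Proof.
  intros [_ H]. apply cder_eps. intros e He.
  destruct (H z (fun P HP => HP) (mkposreal e He)) as [d Hd].
  exists d. split; [apply cond_pos|]. intros w _ Hw. specialize (Hd w Hw).
  replace (f w - f z - l * (w - z))%C with (f w - f z - (w - z) * l)%C by ring.
  exact Hd.
Qed.

(** The derivative of [Psi] is the reciprocal of [dPhi] composed with [Psi], so each order of [Psi]
    yields the next. *)
Lemma conformal_inv_holo {Om Phi dPhi Psi} n : conformal Om Phi dPhi Psi ->
  (forall k, holo unit_disk k dPhi) -> holo Om n Psi.
Proof.
  intros H Hd.
  assert (Mem : forall w, Om w -> closed_unit_disk (Psi w)).
  { intros w Hw. apply disk_closed. now apply (conformal_inner _ H). }
  induction n as [|n IH].
  - intros w Hw. apply ccont_mono with (closure_set Om); [apply closure_of_mem|].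
    apply (conformal_inv_cont _ H), closure_of_mem, Hw.
  - exists (fun w => / dPhi (Psi w))%C. split.
    + intros w Hw. apply cder_mono with (closure_set Om); [apply closure_of_mem|].
      apply (conformal_inv_cder _ H), closure_of_mem, Hw.
    + apply holo_inv.
      * intros w Hw. now apply (conf_nz H), Mem.
      * apply (holo_comp Om unit_disk); auto. intros w Hw. now apply (conformal_inner _ H).
Qed.

Lemma canonical_harmonic_transport Om Phi dPhi Psi N a d m c :
  (forall j, (j < N)%nat -> Cmod (a j) = 1) -> Zsumn N d = 2%Z ->
  C11_domain Om -> conformal Om Phi dPhi Psi -> (forall k, holo unit_disk k dPhi) ->
  (forall z, unit_disk z -> m z = expi (vortex_angle N a d z + c)) ->
  (forall z, Cmod z = 1 -> (forall j, (j < N)%nat -> z <> a j) ->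
     dotC (expi (vortex_angle N a d z + c)) z = 0) ->
  canonical_harmonic Om N (fun j => Phi (a j)) d (fun w => m (Psi w) * Cdir (dPhi (Psi w)))%C.
Proof.
  intros Ha Hsum [_ [_ [_ [L [gamma [dgamma A]]]]]] H Hd Hm Hn.
  assert (Ppi := PI_RGT_0). assert (PL : 0 < L) by apply A.
  destruct (conformal_arc_angle H A) as [sigma [S1 [S2 [S3 S4]]]].
  destruct (closed_disk_arg dPhi (conf_dcont H) (conf_nz H) (Hd 2%nat))
    as [G [HG [GE [GC [B HB]]]]].
  assert (AL : angle_lift sigma L).
  { split; [exact PL|]. split.
    - apply derive_pos_increasing with (1 := S2). intros s.
      apply Rinv_0_lt_compat, Cmod_gt_0, (conf_nz H), closed_disk_expi.
    - specialize (S3 0). rewrite Rplus_0_l in S3. exact S3. }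
  assert (Csig : forall s, continuity_pt sigma s) by (intros; eapply is_derive_cont, S2).
  assert (Clo : forall s, closure_set Om (gamma s)) by (intros; now apply (arc_param_closure _ A)).
  assert (Gz : forall s, gamma s = Phi (expi (sigma s))).
  { intros s. rewrite <- S1. symmetry. apply (conf_right H), Clo. }
  assert (X : forall j, exists x, (j < N)%nat -> 0 <= x < L /\ gamma x = Phi (a j)).
  { intros j. destruct (Nat.lt_ge_cases j N) as [Hj|Hj].
    - destruct (conformal_circle_param 0 (a j) H A (Ha j Hj)) as [x [Hx E]].
      exists x. intros _. split; [lra|exact E].
    - exists 0. intros; lia. }
  destruct (choice _ X) as [x Hx]. clear X.
  assert (Hx' : forall j, (j < N)%nat -> 0 <= x j < L /\ a j = expi (sigma (x j))).
  { intros j Hj. destruct (Hx j Hj) as [Bx E]. split; [exact Bx|].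
    rewrite <- S1, E, (conf_left H); [reflexivity|]. right. now apply Ha. }
  (* The angle of [Ci * expi (sigma s) * Cdir (dPhi (expi (sigma s)))], which is the tangent. *)
  set (theta := fun s => snd (G (expi (sigma s))) + (sigma s + PI / 2)).
  set (phi := fun w => vortex_angle N a d (Psi w) + (c + snd (G (Psi w)))).
  assert (Cth : continuity theta).
  { intros s. apply continuity_pt_plus.
    - apply (contC_curve closed_unit_disk (fun w => snd (G w)) (fun t => expi (sigma t))).
      + apply GC, closed_disk_expi.
      + intros; apply closed_disk_expi.
      + eapply rder_rcont, rder_expi_comp, S2.
    - apply continuity_pt_plus; [apply Csig|]. apply continuity_pt_const. now intros u v. }
  assert (Eth : forall s, dgamma s = expi (theta s)).
  { intros s. unfold theta. rewrite !expi_plus, expi_PI2, S4, GE by apply closed_disk_expi. ring. }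
  assert (Nv : forall s, (forall j, (j < N)%nat -> gamma s <> Phi (a j)) ->
     forall j, (j < N)%nat -> expi (sigma s) <> a j).
  { intros s Hs j Hj E. apply (Hs j Hj). now rewrite Gz, E. }
  assert (Cphi : forall s, (forall j, (j < N)%nat -> gamma s <> Phi (a j)) ->
     contC_within (closure_set Om) phi (gamma s)).
  { intros s Hs e He.
    assert (K : contC_within closed_unit_disk
       (fun z => vortex_angle N a d z + (c + snd (G z))) (Psi (gamma s))).
    { rewrite S1. apply contC_plus.
      - apply vortex_angle_contC; auto. apply closed_disk_expi.
      - apply contC_plus; [apply contC_const|]. apply GC, closed_disk_expi. }
    destruct (K e He) as [d1 [Hd1 K1]].
    destruct (conformal_inv_cont (gamma s) H (Clo s) d1 Hd1) as [d2 [Hd2 K2]].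
    exists d2; split; auto. intros w Dw Hw. apply K1; [|now apply K2].
    apply (conf_right H), Dw. }
  (* The boundary phase is a combination of steps plus the tangent angle plus a constant. Bounded
     variation and the measure equation are both read off from this splitting, where the total
     multiplicity 2 is used. *)
  assert (Ephi : forall s, phi (gamma s)
     = (vortex_angle N a d (expi (sigma s)) - IZR (Zsumn N d) / 2 * sigma s)
       + (theta s + (c - PI / 2))).
  { intros s. unfold phi, theta. rewrite S1, Hsum. field. }
  (* One formula on the closure serves both as the boundary phase and as its harmonic extension. *)
  exists L, gamma, dgamma, theta, phi, phi.
  split; [exact A|]. split.
  { intros j Hj. exists (x j). now apply Hx. }
  split; [intros s; split; [apply Cth|apply Eth]|]. split.
  { assert (BVth : bounded_variation theta L).
    { destruct A as (_ & _ & _ & _ & _ & [K HK] & _).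
      apply bounded_variation_lipschitz with (2 * Rabs K); [|generalize (Rabs_pos K); lra].
      apply angle_lipschitz; [exact Cth|apply Rabs_pos|].
      intros s t. rewrite <- !Eth. eapply Rle_trans; [apply HK|].
      apply Rmult_le_compat_r; [apply Rabs_pos|apply Rle_abs]. }
    assert (BV := bounded_variation_plus _ _ L
       (bounded_variation_vortex_angle sigma L N a d x AL Hx') BVth).
    destruct BV as [M HM]. exists M. intros n t H0 H1 H2.
    eapply Rle_trans; [|apply (HM n t H0 H1 H2)]. right. apply Rsumn_ext. intros k _.
    f_equal. rewrite !Ephi. ring. }
  split.
  { intros s Hs. apply (contC_curve (closure_set Om) phi gamma); auto.
    eapply rder_rcont, (arc_param_rder s A). }
  split.
  (* Phase and normal are both turned by the argument of [dPhi], which cancels and leaves the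
     tangency on the circle. *)
  { intros s Hs. specialize (Hn (expi (sigma s)) (Cmod_expi _) (Nv s Hs)).
    rewrite dotC_expi in Hn.
    replace (outer_normal dgamma s) with (expi (sigma s + snd (G (expi (sigma s))))).
    - rewrite dotC_expi. rewrite <- Hn. f_equal. unfold phi. rewrite S1. ring.
    - unfold outer_normal. rewrite Eth. unfold theta.
      replace (snd (G (expi (sigma s))) + (sigma s + PI / 2))
        with (PI / 2 + (sigma s + snd (G (expi (sigma s))))) by ring.
      rewrite (expi_plus (PI / 2)), expi_PI2. apply C_eq; simpl; ring. }
  split.
  { intros psi Hpsi. destruct (smooth_periodic_C1 _ _ Hpsi) as [Dg Cg].
    set (g := fun s => psi (gamma s)) in *. set (g' := Derive g) in *.
    assert (GL : g L = g 0).
    { unfold g. f_equal. rewrite <- (proj1 (proj2 A) 0). f_equal. ring. }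
    assert (I1 := is_RInt_vortex_angle sigma L N a d x g g' AL Hx' Dg Cg GL).
    assert (I2 : is_RInt (fun s => theta s * g' s) 0 L (RInt (fun s => theta s * g' s) 0 L)).
    { apply (RInt_correct (V := R_CompleteNormedModule)).
      apply (ex_RInt_continuous (V := R_CompleteNormedModule)). intros s _.
      apply (continuous_mult (K := R_AbsRing) theta g'); [|apply Cg].
      apply continuity_continuous, Cth. }
    assert (I3 := is_RInt_const_derive (fun _ => c - PI / 2) g g' 0 L _ (Rlt_le _ _ PL)
                    (fun _ _ => eq_refl) Dg Cg).
    assert (I4 := is_RInt_plus (V := R_NormedModule) _ _ _ _ _ _ I1
                    (is_RInt_plus (V := R_NormedModule) _ _ _ _ _ _ I2 I3)).
    assert (I5 : is_RInt (fun s => phi (gamma s) * g' s) 0 L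
       (RInt (fun s => theta s * g' s) 0 L
        + (PI * Rsumn N (fun j => IZR (d j) * g (x j)) - IZR (Zsumn N d) * PI * g 0))).
    { evar_last.
      - apply (is_RInt_ext (V := R_NormedModule)) with (2 := I4).
        intros s _. rewrite Ephi. unfold plus; simpl. ring.
      - unfold plus; simpl. rewrite GL. ring. }
    rewrite (is_RInt_unique _ _ _ _ I5).
    (* [G] is evaluated at the same point of the circle, so the tangent turns with [sigma]; this
       matches the term [IZR (Zsumn N d) * PI * g 0]. *)
    replace (theta L - theta 0) with (2 * PI).
    - replace (Rsumn N (fun j => IZR (d j) * psi (Phi (a j))))
        with (Rsumn N (fun j => IZR (d j) * g (x j))).
      + rewrite Hsum. change (psi (gamma 0)) with (g 0).
        match goal with |- ?x = ?y => change (@eq R x y) end. ring.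
      + apply Rsumn_ext. intros j Hj. unfold g. now rewrite (proj2 (Hx j Hj)).
    - unfold theta. destruct AL as [_ [_ EL]]. rewrite EL, expi_plus, expi_2PI.
      replace (expi (sigma 0) * RtoC 1)%C with (expi (sigma 0)) by ring. ring. }
  split.
  { replace phi with (fun w => snd (vortex_log N a d (Psi w) + ((0, c) + G (Psi w)))%C).
    - apply harmonic_Im; [apply (conf_open H)|].
      assert (HP := conformal_inv_holo 2 H Hd).
      assert (In : forall w, Om w -> unit_disk (Psi w))
        by (intros; now apply (conformal_inner _ H)).
      apply holo_plus.
      + apply (holo_comp Om unit_disk); auto. now apply vortex_log_holo.
      + apply holo_plus; [apply holo_const|]. now apply (holo_comp Om unit_disk).
    - apply functional_extensionality. intros w.
      unfold phi. rewrite <- snd_vortex_log. reflexivity. }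
  split.
  { destruct (vortex_angle_bound N a d) as [B1 HB1]. exists (B1 + (Rabs c + B)). intros w _.
    unfold phi. eapply Rle_trans; [apply Rabs_triang|]. apply Rplus_le_compat; [apply HB1|].
    eapply Rle_trans; [apply Rabs_triang|]. apply Rplus_le_compat; [lra|apply HB]. }
  split.
  { intros s Hs e He. destruct (Cphi s Hs e He) as [d1 [Hd1 K1]].
    exists d1; split; auto. intros w Hw Hws. apply K1; [now apply closure_of_mem|exact Hws]. }
  intros w Hw. assert (Dw := conformal_inner w H Hw).
  rewrite Hm by exact Dw. unfold phi.
  rewrite <- GE by (now apply disk_closed). rewrite <- expi_plus. f_equal. ring.
Qed.

Theorem theorem1p4 :
  forall (N : nat) (a : nat -> C) (d : nat -> Z) (b : C),
    (1 <= N)%nat ->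
    (forall j, (j < N)%nat -> Cmod (a j) = 1) ->
    (forall i j, (i < N)%nat -> (j < N)%nat -> a i = a j -> i = j) ->
    (forall j, (j < N)%nat -> d j <> 0%Z) ->
    Zsumn N d = 2%Z ->
    Cmod b = 1 ->
    (forall j, (j < N)%nat -> b <> a j) ->
    (forall m : C -> C, canonical_harmonic unit_disk N a d m ->
       (forall z, unit_disk z -> m z = disk_map N a d b z) \/
       (forall z, unit_disk z -> m z = Copp (disk_map N a d b z)))
    /\
    (forall (Om : C -> Prop) (Phi dPhi Psi : C -> C) (m : C -> C),
       C11_domain Om ->
       (forall z, closed_unit_disk z -> closure_set Om (Phi z)) ->
       (forall w, closure_set Om w -> closed_unit_disk (Psi w) /\ Phi (Psi w) = w) ->
       (forall z, closed_unit_disk z -> Psi (Phi z) = z) ->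
       (forall z, closed_unit_disk z -> contCC_within closed_unit_disk Phi z) ->
       (forall z, unit_disk z -> @is_derive C_AbsRing C_NormedModule Phi z (dPhi z)) ->
       (forall z, closed_unit_disk z -> contCC_within closed_unit_disk dPhi z) ->
       (forall z, closed_unit_disk z -> dPhi z <> RtoC 0) ->
       canonical_harmonic unit_disk N a d m ->
       canonical_harmonic Om N (fun j => Phi (a j)) d
         (fun w => Cmult (m (Psi w))
                     (Cdiv (dPhi (Psi w)) (RtoC (Cmod (dPhi (Psi w))))))).
Proof.
  intros N a d b _ Ha Hinj _ Hsum Hb Nb. split.
  - intros m Hm. now apply canonical_disk_formula.
  - intros Om Phi dPhi Psi m HO Himg Hright Hleft CPhi DPhi CdPhi Nz Hm.
    destruct (canonical_disk_phase N a d m Ha Hinj Hsum Hm) as [c [Hc Hn]].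
    assert (D : forall z, unit_disk z -> cder unit_disk Phi z (dPhi z)).
    { intros z Dz. apply cder_mono with everywhere; [easy|]. now apply is_derive_C_cder, DPhi. }
    apply (canonical_harmonic_transport Om Phi dPhi Psi N a d m c); auto.
    + split; auto.
      * apply HO.
      * now apply closed_disk_cder.
    + intros k. now apply (closed_disk_holo Phi dPhi).
Qed.
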